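(* Let $\Omega\subset\mathbb R^N$ be a bounded domain and let $H\in C(\overline\Omega\times\mathbb R^N)$ be coercive, i.e. $\lim_{r\to+\infty}\inf\{H(x,p)\mid x\in\overline\Omega,\ |p|\ge r\}=+\infty$. (i) Assume that $\Omega$ has a $C^1$-boundary, that $\gamma:\overline\Omega\to\mathbb R^N$ and $g:\partial\Omega\to\mathbb R$ are continuous, and that $n(x)\cdot\gamma(x)>0$ for all $x\in\partial\Omega$, where $n(x)$ is the outer unit normal to $\partial\Omega$ at $x$. Then there exists a solution $(v,c_n)\in W^{1,\infty}(\Omega)\times\mathbb R$ of (E-N). Moreover, the additive eigenvalue is unique and is represented by $$c_n=\inf\{a\in\mathbb R\mid \text{(E-N) with constant } a \text{ has a subsolution}\}.$$ (ii) Assume that $\Omega$ has a $C^0$-boundary. Then there exists a solution $(v,c_{sc})\in W^{1,\infty}(\Omega)\times\mathbb R$ of (E-SC). The additive eigenvalue is unique and is represented by $$c_{sc}=\inf\{a\in\mathbb R\mid H(x,Dv)=a \text{ in } \Omega \text{ has a subsolution}\}.$$ (iii) Assume that $\Omega$ has a $C^0$-boundary and that $g\in C(\partial\Omega)$. Then, for $a\in\mathbb R$, there exists a solution $v\in W^{1,\infty}(\Omega)$ of (D)$_a$ if and only if $a\ge c_{sc}$, where $c_{sc}$ is the constant in (ii).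
   Context: $\Omega$ has a $C^k$-boundary ($k\ge0$) if $\partial\Omega$ is locally the graph of a $C^k$ function: for each $z\in\partial\Omega$ there are $r>0$ and $b\in C^k(\mathbb R^{N-1})$ such that, after relabelling and re-orienting the coordinate axes, $\Omega\cap B(z,r)=\{(x',x_N)\in B(z,r)\mid x_N>b(x')\}$. Functions in $W^{1,\infty}(\Omega)$ are identified with their continuous extensions to $\overline\Omega$. For $a\in\mathbb R$ consider the stationary problem $H(x,Dv(x))=a$ in $\Omega$, $B(x,v(x),Dv(x))=0$ on $\partial\Omega$. It is called (E-N) if $B(x,r,p)=\gamma(x)\cdot p-g(x)$; (E-SC) if $B(x,r,p)=-1$ for all $(x,r,p)$; (D)$_a$ if $B(x,r,p)=r-g(x)$. All notions are in the viscosity sense: an upper semicontinuous (resp. lower semicontinuous) function $v:\overline\Omega\to\mathbb R$ is a subsolution (resp. supersolution) if for every $\phi\in C^1(\overline\Omega)$ and every $x_0\in\overline\Omega$ at which $v-\phi$ has a local maximum (resp. minimum) relative to $\overline\Omega$: $H(x_0,D\phi(x_0))\le a$ (resp. $\ge a$) if $x_0\in\Omega$, and $\min\{H(x_0,D\phi(x_0))-a,\ B(x_0,v(x_0),D\phi(x_0))\}\le0$ (resp. $\max\{H(x_0,D\phi(x_0))-a,\ B(x_0,v(x_0),D\phi(x_0))\}\ge0$) if $x_0\in\partial\Omega$. A solution is both a subsolution and a supersolution. A subsolution of $H(x,Dv)=a$ in $\Omega$ is only required to satisfy the condition at points of $\Omega$. For (E-N) and (E-SC) a solution is a pair $(v,a)$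 with $v\in C(\overline\Omega)$, $a\in\mathbb R$, such that $v$ is a solution of the problem with constant $a$; then $a$ is called an additive eigenvalue. *)

(* Defs.v *)
From HB Require Import structures.
From mathcomp Require Import all_boot all_order all_algebra.
From mathcomp Require Import all_classical all_reals all_analysis.

Set Implicit Arguments.
Unset Strict Implicit.
Unset Printing Implicit Defensive.

Import Order.TTheory GRing.Theory Num.Theory.
Import numFieldNormedType.Exports.

Local Open Scope classical_set_scope.
Local Open Scope ring_scope.

(* The library norm on 'rV[R]_m is the sup norm, so the Euclidean one is
   introduced separately; both induce the same topology and bounded sets. *)
Definition dotp (R : realType) (m : nat) (u v : 'rV[R]_m) : R :=
  \sum_i u 0 i * v 0 i.

Definition enorm (R : realType) (m : nat) (u : 'rV[R]_m) : R :=
  Num.sqrt (dotp u u).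

Definition partial (R : realType) (m : nat) (i : 'I_m) (f : 'rV[R]_m -> R)
    (x : 'rV[R]_m) : R :=
  'D_(delta_mx 0 i) f x.

Definition grad (R : realType) (m : nat) (f : 'rV[R]_m -> R) (x : 'rV[R]_m) :
    'rV[R]_m :=
  \row_i partial i f x.

(* Meant for open U: all partial derivatives up to order k exist on U and are
   continuous there. *)
Fixpoint Ck (R : realType) (m : nat) (U : set 'rV[R]_m) (k : nat)
    (f : 'rV[R]_m -> R) : Prop :=
  match k with
  | 0 => {within U, continuous f}
  | k'.+1 => {within U, continuous f} /\
      forall i, (forall x, U x -> derivable f x (delta_mx 0 i)) /\
                Ck U k' (partial i f)
  end.

Definition bdry (R : realType) (m : nat) (Omega : set 'rV[R]_m) :
    set 'rV[R]_m :=
  closure Omega `\` interior Omega.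

Definition bounded_domain (R : realType) (m : nat) (Omega : set 'rV[R]_m) :
    Prop :=
  [/\ open Omega, connected Omega, Omega !=set0 & bounded_set Omega].

(* In the orthonormal coordinates y = x *m Q, with y = (y', y_N), the set Omega
   is {y_N > b(y')} inside the ball B(z, r). *)
Definition local_graph (R : realType) (n : nat) (k : nat)
    (Omega : set 'rV[R]_n.+1) (z : 'rV[R]_n.+1) (r : R) (Q : 'M[R]_n.+1)
    (b : 'rV[R]_n -> R) : Prop :=
  [/\ 0 < r, Q *m Q^T = 1%:M, Ck setT k b &
      forall x, enorm (x - z) < r ->
        (Omega x <-> b (col' ord_max (x *m Q)) < (x *m Q) 0 ord_max)].

Definition Ck_boundary (R : realType) (n : nat) (k : nat)
    (Omega : set 'rV[R]_n.+1) : Prop :=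
  forall z, bdry Omega z -> exists r Q b, local_graph k Omega z r Q b.

(* Outward normal (Db(y'), -1) of the epigraph {y_N > b(y')}. *)
Definition graph_normal (R : realType) (n : nat) (b : 'rV[R]_n -> R)
    (y : 'rV[R]_n.+1) : 'rV[R]_n.+1 :=
  \row_j (if unlift ord_max j is Some i then grad b (col' ord_max y) 0 i
          else -1).

Definition outer_unit_normal (R : realType) (n : nat)
    (Omega : set 'rV[R]_n.+1) (z nu : 'rV[R]_n.+1) : Prop :=
  exists r Q b, local_graph 1 Omega z r Q b /\
    let m := graph_normal b (z *m Q) in
    nu = (enorm m)^-1 *: (m *m Q^T).

(* The Lebesgue integral over R^m of a bounded, compactly supported Borel
   function, written as an iterated one-dimensional integral. *)
Fixpoint iterated_integral (R : realType) (m : nat) :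
    ('rV[R]_m -> R) -> R :=
  match m return ('rV[R]_m -> R) -> R with
  | 0 => fun f => f 0
  | m'.+1 => fun f =>
      \int[@lebesgue_measure R]_t
        iterated_integral (fun x : 'rV[R]_m' => f (row_mx (t%:M : 'M[R]_1) x))
  end.

Definition borel_fun (R : realType) (m : nat) (A : set 'rV[R]_m)
    (f : 'rV[R]_m -> R) : Prop :=
  measurable_fun (A : set (g_sigma_algebraType (@open 'rV[R]_m))) f.

Definition test_function (R : realType) (m : nat) (Omega : set 'rV[R]_m)
    (phi : 'rV[R]_m -> R) : Prop :=
  (forall k, Ck setT k phi) /\
  exists K, [/\ compact K, K `<=` Omega & forall x, ~ K x -> phi x = 0].

(* An element of L^oo(Omega) always has a Borel representative that is bounded
   everywhere on Omega. *)
Definition weak_partial (R : realType) (m : nat) (Omega : set 'rV[R]_m)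
    (i : 'I_m) (v w : 'rV[R]_m -> R) : Prop :=
  forall phi, test_function Omega phi ->
    iterated_integral (fun x => v x * partial i phi x) =
    - iterated_integral (fun x => w x * phi x).

Definition bounded_on (R : realType) (m : nat) (A : set 'rV[R]_m)
    (f : 'rV[R]_m -> R) : Prop :=
  exists M, forall x, A x -> `|f x| <= M.

(* v is the continuous extension to the closure of Omega of a function in
   W^{1,oo}(Omega); values of v outside the closure are irrelevant. *)
Definition W1oo (R : realType) (m : nat) (Omega : set 'rV[R]_m)
    (v : 'rV[R]_m -> R) : Prop :=
  [/\ {within closure Omega, continuous v}, bounded_on Omega v &
      forall i, exists w,
        [/\ borel_fun Omega w, bounded_on Omega w & weak_partial Omega i v w]].

Definition usc_on (R : realType) (m : nat) (A : set 'rV[R]_m)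
    (v : 'rV[R]_m -> R) : Prop :=
  forall x0, A x0 -> forall t, v x0 < t ->
    \forall x \near within A (nbhs x0), v x < t.

Definition lsc_on (R : realType) (m : nat) (A : set 'rV[R]_m)
    (v : 'rV[R]_m -> R) : Prop :=
  forall x0, A x0 -> forall t, t < v x0 ->
    \forall x \near within A (nbhs x0), t < v x.

Definition local_max (R : realType) (m : nat) (A : set 'rV[R]_m)
    (f : 'rV[R]_m -> R) (x0 : 'rV[R]_m) : Prop :=
  \forall x \near within A (nbhs x0), f x <= f x0.

Definition local_min (R : realType) (m : nat) (A : set 'rV[R]_m)
    (f : 'rV[R]_m -> R) (x0 : 'rV[R]_m) : Prop :=
  \forall x \near within A (nbhs x0), f x0 <= f x.

(* C^1 of the (closed) set A: C^1 on some open neighbourhood of A. *)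
Definition C1_closed (R : realType) (m : nat) (A : set 'rV[R]_m)
    (phi : 'rV[R]_m -> R) : Prop :=
  exists U, [/\ open U, A `<=` U & Ck U 1 phi].

Section Viscosity.
Variables (R : realType) (m : nat) (Omega : set 'rV[R]_m).
Variable H : 'rV[R]_m -> 'rV[R]_m -> R.

Definition coercive : Prop :=
  ereal_inf [set (H xp.1 xp.2)%:E | xp in
    [set xp : 'rV[R]_m * 'rV[R]_m | closure Omega xp.1 /\ r <= enorm xp.2]]
    @[r --> +oo%R] --> +oo%E.

Definition subsolution_in (a : R) (v : 'rV[R]_m -> R) : Prop :=
  usc_on (closure Omega) v /\
  forall phi x0, C1_closed (closure Omega) phi -> Omega x0 ->
    local_max (closure Omega) (v \- phi) x0 -> H x0 (grad phi x0) <= a.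

Variable B : 'rV[R]_m -> R -> 'rV[R]_m -> R.

Definition subsolution (a : R) (v : 'rV[R]_m -> R) : Prop :=
  usc_on (closure Omega) v /\
  forall phi x0, C1_closed (closure Omega) phi -> closure Omega x0 ->
    local_max (closure Omega) (v \- phi) x0 ->
    (Omega x0 -> H x0 (grad phi x0) <= a) /\
    (bdry Omega x0 ->
      Num.min (H x0 (grad phi x0) - a) (B x0 (v x0) (grad phi x0)) <= 0).

Definition supersolution (a : R) (v : 'rV[R]_m -> R) : Prop :=
  lsc_on (closure Omega) v /\
  forall phi x0, C1_closed (closure Omega) phi -> closure Omega x0 ->
    local_min (closure Omega) (v \- phi) x0 ->
    (Omega x0 -> a <= H x0 (grad phi x0)) /\
    (bdry Omega x0 ->
      0 <= Num.max (H x0 (grad phi x0) - a) (B x0 (v x0) (grad phi x0))).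

Definition solution (a : R) (v : 'rV[R]_m -> R) : Prop :=
  subsolution a v /\ supersolution a v.

End Viscosity.

Definition neumann (R : realType) (m : nat) (gamma : 'rV[R]_m -> 'rV[R]_m)
    (g : 'rV[R]_m -> R) : 'rV[R]_m -> R -> 'rV[R]_m -> R :=
  fun x _ p => dotp (gamma x) p - g x.

Definition state_constraint (R : realType) (m : nat) :
    'rV[R]_m -> R -> 'rV[R]_m -> R :=
  fun _ _ _ => -1.

Definition dirichlet (R : realType) (m : nat) (g : 'rV[R]_m -> R) :
    'rV[R]_m -> R -> 'rV[R]_m -> R :=
  fun x r _ => r - g x.

(* Main.v *)
(* A subsolution of H(x, Du) = a is Lipschitz along segments of Omega by coercivity,
   and the graph boundary makes such functions equicontinuous up to the boundary:
   a neighbourhood of a boundary point, shifted in one direction, lies in Omega.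
   Perron's method solves lambda v + H(x, Dv) = 0 with the given boundary condition;
   letting lambda -> 0 along an ultrafilter, v - v(x0) and - lambda v converge to a
   solution v and its eigenvalue. For (D)_a, Perron's method is applied with lambda = 0
   to subsolutions below g on the boundary, starting from the solution of (E-SC).

   Uniqueness and the inf formula follow from: a subsolution for a' and a
   supersolution for a satisfy a <= a'. For (E-SC) and (D)_a this is Soner's doubling of
   variables with a shift into Omega. For (E-N) one doubles variables with a quadratic
   form whose gradient has a sign against gamma, using that near a boundary point Omega
   contains cones of aperture arbitrarily close to a half-space.

   For W^{1,oo}, the weak derivative of a function that is Lipschitz along segments is
   a limit superior of difference quotients: on almost every point of each line it is
   the derivative, since a Lipschitz function plus a linear one generates a Stieltjes
   measure with a density, and the lines are integrated first by Fubini. *)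
Require Import Defs.
From HB Require Import structures.
From mathcomp Require Import all_boot all_order all_algebra.
From mathcomp Require Import all_classical all_reals all_analysis.
From mathcomp Require Import measurable_realfun.
From mathcomp Require Import ring lra.

Set Implicit Arguments.
Unset Strict Implicit.
Unset Printing Implicit Defensive.

Import Order.TTheory GRing.Theory Num.Theory.
Import numFieldNormedType.Exports.
Local Open Scope classical_set_scope.
Local Open Scope ring_scope.

(** * Row vectors and C^1 functions *)

(** Coercivity carries the existence half. Continuous subsolutions at a fixed level are
    equicontinuous on the closure, so Perron's class can consist of continuous functions and its
    supremum is again continuous; no comparison principle for the discounted problem enters. In the
    inf formulas subsolutions are only upper semicontinuous, and their boundary values are the
    obstacle to comparison. For (E-SC) they are replaced by the limits of the interior values; for
    (E-N) the oblique condition is shown to force equality with these limits. At an oblique boundary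
    maximum the boundary alternatives of both functions must be excluded at once. A linear term
    tuned to the value of [g] puts the oblique derivative of one test function above [g] and that of
    the other below it, by a fixed margin; cone aperture, radius and penalization are then chosen,
    in this order, so that the error terms stay within the margin. *)

Section RowVectors.
Variables (R : realType) (m : nat).
Implicit Types (x y u v : 'rV[R]_m) (A B : set 'rV[R]_m) (e d r : R).

Lemma nbhs_rVP x A :
  nbhs x A <-> exists2 r : R, 0 < r & forall y, `|y - x| < r -> A y.
Proof.
split=> [/nbhs_normP[r /= r0 rA]|[r r0 rA]].
  by exists r => // y yx; apply: rA; rewrite /= distrC.
by apply/(nbhs_normP x); exists r => //= y /=; rewrite distrC => /rA.
Qed.

Lemma near_withinP A x (P : 'rV[R]_m -> Prop) :
  (\forall y \near within A (nbhs x), P y) <->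
  exists2 r : R, 0 < r & forall y, A y -> `|y - x| < r -> P y.
Proof.
rewrite (_ : (\forall y \near _, _) = nbhs x [set y | A y -> P y])// nbhs_rVP.
split=> -[r r0 h]; exists r => // y.
  by move=> Ay yx; exact: h.
by move=> yx Ay; exact: h.
Qed.

(** The codomain is a normed module so that one notion serves real functions, gradients and the
    field [gamma]. *)
Definition cont_on (W : normedModType R) A (f : 'rV[R]_m -> W) :=
  forall x, A x -> forall e, 0 < e ->
    exists2 d, 0 < d & forall y, A y -> `|y - x| < d -> `|f y - f x| < e.

Lemma within_contP (W : normedModType R) A (f : 'rV[R]_m -> W) :
  {within A, continuous f} <-> cont_on A f.
Proof.
rewrite subspace_continuousP; split=> cf x Ax.
  move=> e e0; move/cvgrPdist_lt : (cf x Ax) => /(_ e e0) /near_withinP[d d0 h].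
  by exists d => // y Ay yx; rewrite distrC; exact: h.
apply/cvgrPdist_lt => e e0; have [d d0 h] := cf x Ax e e0.
by apply/near_withinP; exists d => // y Ay yx; rewrite distrC; exact: h.
Qed.

Lemma closureP_rV A x :
  closure A x <-> forall r, 0 < r -> exists2 y, A y & `|y - x| < r.
Proof.
split=> [clA r r0|h B /nbhs_rVP[r r0 rB]].
  have /clA[y [Ay /= yx]] : nbhs x [set y | `|y - x| < r].
    by apply/nbhs_rVP; exists r.
  by exists y.
by have [y Ay yx] := h r r0; exists y; split=> //; exact: rB.
Qed.

Lemma openP_rV A :
  open A <-> forall x, A x -> exists2 r : R, 0 < r & forall y, `|y - x| < r -> A y.
Proof. by rewrite openE; split=> h x /h /nbhs_rVP. Qed.

Lemma le_entry_norm u j : `|u 0 j| <= `|u|.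
Proof.
rewrite [leRHS]/Num.norm /= mx_normrE.
by apply/bigmax_geP; right => /=; exists (0, j).
Qed.

Lemma norm_le_entries u (c : R) : 0 <= c -> (forall j, `|u 0 j| <= c) -> `|u| <= c.
Proof.
move=> c0 h; rewrite /Num.norm /= mx_normrE.
by apply/bigmax_leP; split=> //= -[i j] _; rewrite ord1; exact: h.
Qed.

Lemma norm_lt_entries u (c : R) : 0 < c -> (forall j, `|u 0 j| < c) -> `|u| < c.
Proof.
move=> c0 h; rewrite /Num.norm /= mx_normrE.
by apply/bigmax_ltP; split=> //= -[i j] _; rewrite ord1; exact: h.
Qed.

Lemma dotpC u v : dotp u v = dotp v u.
Proof. by apply: eq_bigr => i _; rewrite mulrC. Qed.

Lemma dotpDl u v y : dotp (u + v) y = dotp u y + dotp v y.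
Proof. by rewrite -big_split; apply: eq_bigr => i _; rewrite mxE mulrDl. Qed.

Lemma dotpDr u v y : dotp y (u + v) = dotp y u + dotp y v.
Proof. by rewrite dotpC dotpDl !(dotpC y). Qed.

Lemma dotpZl (a : R) u v : dotp (a *: u) v = a * dotp u v.
Proof. by rewrite mulr_sumr; apply: eq_bigr => i _; rewrite mxE mulrA. Qed.

Lemma dotpZr (a : R) u v : dotp u (a *: v) = a * dotp u v.
Proof. by rewrite dotpC dotpZl dotpC. Qed.

Lemma dotpNl u v : dotp (- u) v = - dotp u v.
Proof. by rewrite -scaleN1r dotpZl mulN1r. Qed.

Lemma dotpNr u v : dotp u (- v) = - dotp u v.
Proof. by rewrite dotpC dotpNl dotpC. Qed.

Lemma dotpBl u v y : dotp (u - v) y = dotp u y - dotp v y.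
Proof. by rewrite dotpDl dotpNl. Qed.

Lemma dotpBr u v y : dotp y (u - v) = dotp y u - dotp y v.
Proof. by rewrite dotpDr dotpNr. Qed.

Lemma dotp0l u : dotp 0 u = 0.
Proof. by apply: big1 => i _; rewrite mxE mul0r. Qed.

Lemma dotp0r u : dotp u 0 = 0.
Proof. by rewrite dotpC dotp0l. Qed.

(** Cauchy-Schwarz in the sup norm costs the factor [m], which recurs as [N] in later constants. *)
Lemma dotp_norm u v : `|dotp u v| <= m%:R * `|u| * `|v|.
Proof.
apply: (le_trans (ler_norm_sum _ _ _)).
apply: (@le_trans _ _ (\sum_(i < m) `|u| * `|v|)).
  by apply: ler_sum => i _; rewrite normrM ler_pM// le_entry_norm.
by rewrite sumr_const card_ord -mulrA mulr_natl.
Qed.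

Lemma dotp_ge0 u : 0 <= dotp u u.
Proof. by apply: sumr_ge0 => i _; rewrite -expr2 sqr_ge0. Qed.

Lemma norm_dotp u : `|u| ^+ 2 <= dotp u u.
Proof.
have h j : `|u 0 j| <= Num.sqrt (dotp u u).
  rewrite -(sqrtr_sqr (u 0 j)) ler_wsqrtr//.
  rewrite /dotp (bigD1 j)//= expr2 lerDl sumr_ge0// => i _.
  by rewrite -expr2 sqr_ge0.
have := norm_le_entries (sqrtr_ge0 _) h.
move=> /(lerXn2r 2); rewrite !nnegrE normr_ge0 sqrtr_ge0 => /(_ isT isT).
by rewrite sqr_sqrtr// dotp_ge0.
Qed.

Lemma dotp_le u : dotp u u <= m%:R * `|u| ^+ 2.
Proof.
by rewrite expr2 mulrA (le_trans (ler_norm _))// dotp_norm.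
Qed.

Lemma dotp_mulmx k (M : 'M[R]_(k, m)) (u : 'rV[R]_k) v :
  dotp (u *m M) v = dotp u (v *m M^T).
Proof.
rewrite /dotp; under eq_bigr do rewrite mxE mulr_suml.
rewrite exchange_big; apply: eq_bigr => i _.
rewrite mxE mulr_sumr; apply: eq_bigr => j _; rewrite !mxE.
by rewrite -mulrA; congr (_ * _); rewrite mulrC.
Qed.

Lemma dotp_delta u i : dotp u (delta_mx 0 i) = u 0 i.
Proof.
rewrite /dotp (bigD1 i)//= big1 ?addr0 => [|j ji]; first by rewrite mxE !eqxx mulr1.
by rewrite mxE eqxx /= (negbTE ji) mulr0.
Qed.

Lemma norm_delta_le1 i : `|delta_mx 0 i : 'rV[R]_m| <= 1.
Proof.
apply: norm_le_entries => // j; rewrite mxE eqxx /=.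
by case: (j == i); rewrite ?normr1 ?normr0.
Qed.

End RowVectors.

Lemma mulmx_norm (R : realType) m k (M : 'M[R]_(m, k)) :
  exists2 C : R, 0 < C & forall u : 'rV[R]_m, `|u *m M| <= C * `|u|.
Proof.
exists (1 + \sum_j \sum_i `|M i j|) => [|u].
  by rewrite ltr_pwDl// sumr_ge0// => j _; rewrite sumr_ge0.
apply: norm_le_entries => [|j].
  rewrite mulr_ge0// addr_ge0// sumr_ge0// => j _; exact: sumr_ge0.
rewrite mxE (le_trans (ler_norm_sum _ _ _))//.
apply: (@le_trans _ _ (\sum_i `|M i j| * `|u|)).
  by apply: ler_sum => i _; rewrite normrM mulrC ler_wpM2l// le_entry_norm.
rewrite -mulr_suml ler_wpM2r// (bigD1 j)//= addrCA lerDl addr_ge0//.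
by apply: sumr_ge0 => l _; exact: sumr_ge0.
Qed.

Section Derivatives.
Variables (R : realType) (m : nat).
Implicit Types (x y u v : 'rV[R]_m) (A U : set 'rV[R]_m) (f g : 'rV[R]_m -> R).
Implicit Types e d : R.

Lemma derivable_line f w v t : derivable f (w + t *: v) v ->
  is_derive t 1 (fun s => f (w + s *: v)) ('D_v f (w + t *: v)).
Proof.
have E : (fun h : R => h^-1 *: (((fun s => f (w + s *: v)) \o shift t) (h *: 1) - f (w + t *: v))) =
         (fun h => h^-1 *: ((f \o shift (w + t *: v)) (h *: v) - f (w + t *: v))).
  apply/funext => h /=; congr (_ *: (f _ - _)).
  by rewrite [h *: 1]mulr1 scalerDl addrCA.
by move=> df; apply: DeriveDef; rewrite /derivable /derive E.
Qed.

Lemma Ck_cont_on U k f : Ck U k f -> cont_on U f.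
Proof. by case: k => [cf|k [cf _]]; apply/within_contP. Qed.

Lemma Ck1_grad U f : Ck U 1 f -> cont_on U (grad f).
Proof.
move=> [_ h] x Ux e e0.
have hi i : exists d : R, 0 < d /\
    forall y, U y -> `|y - x| < d -> `|partial i f y - partial i f x| < e.
  have cp : cont_on U (partial i f) by apply/within_contP; exact: (h i).2.
  by have [d d0 hd] := cp x Ux e e0; exists d.
have [d hd] := choice hi.
exists (\big[Num.min/1]_i d i) => [|y Uy yx].
  by elim/big_ind: _ => // [a b a0 b0|i _]; [rewrite lt_min a0|exact: (hd i).1].
apply: norm_lt_entries => // i; rewrite !mxE; apply: (hd i).2 => //.
by apply: lt_le_trans yx _; exact: bigmin_le_cond.
Qed.

(* Sup-norm balls are boxes, so the path from y to z that changes one coordinate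
   at a time stays in the ball and the mean value theorem applies to each step. *)
Lemma Ck1_strict_diff U f x : open U -> Ck U 1 f -> U x -> forall e, 0 < e ->
  exists2 d, 0 < d & forall y z, `|y - x| < d -> `|z - x| < d ->
    `|f z - f y - dotp (grad f x) (z - y)| <= e * `|z - y|.
Proof.
move=> oU fC Ux e e0.
have [dU dU0 hU] := (openP_rV U).1 oU x Ux.
(* Each of the [m] coordinate steps gets an equal share of [e]; [m.+1] keeps the divisor nonzero
   when [m] is 0. *)
have e'0 : 0 < e / m.+1%:R by rewrite divr_gt0.
have [dg dg0 hg] := Ck1_grad fC Ux e'0.
exists (Num.min dU dg) => [|y z yx zx]; first by rewrite lt_min dU0.
set d := Num.min dU dg in yx zx.
pose w (k : nat) : 'rV[R]_m := \row_j (if (j < k)%N then z 0 j else y 0 j).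
have ball_entries (u : 'rV[R]_m) : (forall j, `|u 0 j - x 0 j| < d) -> `|u - x| < d.
  move=> h; apply: norm_lt_entries => [|j]; last by rewrite !mxE.
  by rewrite lt_min dU0.
have entries_ball (u : 'rV[R]_m) j : `|u - x| < d -> `|u 0 j - x 0 j| < d.
  by move=> h; apply: le_lt_trans h; have := le_entry_norm (u - x) j; rewrite !mxE.
have step (k : 'I_m) : `|f (w k.+1) - f (w k) - (z 0 k - y 0 k) * grad f x 0 k|
    <= e / m.+1%:R * `|z - y|.
  have wt (t : R) j : (w k + t *: delta_mx 0 k) 0 j =
      if j == k then y 0 k + t else w k 0 j.
    rewrite !mxE eqxx /=; case: eqVneq => [->|jk].
      by rewrite ltnn mulr1.
    by rewrite mulr0 addr0.
  have wS : w k.+1 = w k + (z 0 k - y 0 k) *: delta_mx 0 k.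
    apply/rowP => j; rewrite wt !mxE ltnS leq_eqVlt.
    have [->|jk] := eqVneq j k; first by rewrite eqxx /= addrC subrK.
    by rewrite (_ : (j == k :> nat) = false)//; apply/negbTE.
  have inB (t : R) : `|y 0 k + t - x 0 k| < d -> `|w k + t *: delta_mx 0 k - x| < d.
    move=> ht; apply: ball_entries => j; rewrite wt; case: eqVneq => [->|jk] //.
    by rewrite mxE; case: ifP => _; exact: entries_ball.
  (* With the linear part removed, the mean value theorem bounds the error of the step by the
     oscillation of one partial derivative. *)
  pose g (t : R) := f (w k + t *: delta_mx 0 k) - t * grad f x 0 k.
  pose dg' (t : R) := partial k f (w k + t *: delta_mx 0 k) - grad f x 0 k.
  have dgP (t : R) : `|y 0 k + t - x 0 k| < d -> is_derive t 1 g (dg' t) /\ `|dg' t| <= e / m.+1%:R.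
    move=> /inB; rewrite /d lt_min => /andP[tU tg]; split.
      have [_ /(_ k)[+ _]] := fC => /(_ _ (hU _ tU)) /derivable_line df.
      rewrite /g /dg'; apply: is_deriveB.
      rewrite -[X in is_derive _ _ _ X]scale1r -[X in is_derive _ _ X]/(( *%R^~ (grad f x 0 k)) : R -> R).
      have -> : ( *%R^~ (grad f x 0 k)) = (fun t : R => (grad f x 0 k) *: (t : R^o)).
        by apply/funext => s; rewrite /GRing.scale /= mulrC.
      have H : is_derive t (1:R) (fun t : R => (grad f x 0 k) *: (t : R^o)) (grad f x 0 k *: 1).
        exact: is_deriveZ.
      by apply: is_derive_eq; rewrite /GRing.scale/= mulr1 mul1r.
    have := hg _ (hU _ tU) tg; move/ltW; apply: le_trans.
    have := le_entry_norm (grad f (w k + t *: delta_mx 0 k) - grad f x) k.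
    by rewrite /dg' !mxE.
  have conv (s t : R) : `|y 0 k + s - x 0 k| < d -> `|y 0 k + t - x 0 k| < d ->
      forall c, s <= c <= t -> `|y 0 k + c - x 0 k| < d.
    rewrite !ltr_norml => /andP[s1 s2] /andP[t1 t2] c /andP[c1 c2].
    by rewrite ltr_norml; apply/andP; split; lra.
  have mvt (s t : R) : s < t -> `|y 0 k + s - x 0 k| < d -> `|y 0 k + t - x 0 k| < d ->
      `|g t - g s| <= e / m.+1%:R * (t - s).
    move=> st hs ht.
    have D c : c \in `]s, t[ -> is_derive c 1 g (dg' c).
      rewrite in_itv /= => /andP[c1 c2].
      by have [] := dgP c (conv _ _ hs ht c _); rewrite ?(ltW c1) ?(ltW c2).
    have C : {within `[s, t], continuous g}.
      apply: derivable_within_continuous => c; rewrite in_itv /= => c12.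
      by have [[]] := dgP c (conv _ _ hs ht c c12).
    have [c] := MVT st D C; rewrite in_itv /= => /andP[c1 c2] ->.
    rewrite normrM (gtr0_norm (_ : 0 < t - s)) ?subr_gt0// ler_wpM2r ?subr_ge0 ?(ltW st)//.
    by have [] := dgP c (conv _ _ hs ht c _); rewrite ?(ltW c1) ?(ltW c2).
  have g0 : g 0 = f (w k) by rewrite /g scale0r addr0 mul0r subr0.
  have -> : f (w k.+1) - f (w k) - (z 0 k - y 0 k) * grad f x 0 k = g (z 0 k - y 0 k) - g 0.
    by rewrite g0 /g -wS addrAC.
  have h0 : `|y 0 k + 0 - x 0 k| < d by rewrite addr0; exact: entries_ball.
  have h1 : `|y 0 k + (z 0 k - y 0 k) - x 0 k| < d.
    by rewrite [y 0 k + _]addrC subrK; exact: entries_ball.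
  have zyk : `|z 0 k - y 0 k| <= `|z - y| by have := le_entry_norm (z - y) k; rewrite !mxE.
  apply: (@le_trans _ _ (e / m.+1%:R * `|z 0 k - y 0 k|)); last by rewrite ler_wpM2l// ltW.
  have [zy|zy|zy] := ltgtP (z 0 k - y 0 k) 0.
  - by rewrite distrC (le_trans (mvt _ _ zy h1 h0))// sub0r ltr0_norm.
  - by rewrite (le_trans (mvt _ _ zy h0 h1))// subr0 gtr0_norm.
  - by rewrite zy subrr normr0 mulr0.
have wz : w m = z by apply/rowP => j; rewrite mxE ltn_ord.
have w0 : w 0%N = y by apply/rowP => j; rewrite mxE.
have -> : f z - f y - dotp (grad f x) (z - y) =
    \sum_(k < m) (f (w k.+1) - f (w k) - (z 0 k - y 0 k) * grad f x 0 k).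
  rewrite sumrB -wz -{1}w0; congr (_ - _); last first.
    by apply: eq_bigr => i _; rewrite [X in _ * X]mxE [X in _ + X]mxE mulrC wz.
  by rewrite -(big_mkord xpredT (fun k => f (w k.+1) - f (w k))) telescope_sumr.
apply: (le_trans (ler_norm_sum _ _ _)); apply: (le_trans (ler_sum _ (fun i _ => step i))).
rewrite sumr_const card_ord -mulrnAl ler_wpM2r// -mulr_natr -mulrA ler_piMr ?(ltW e0)//.
by rewrite mulrC ler_pdivrMr// mul1r ler_nat.
Qed.

End Derivatives.

(** * Test functions *)

Ltac vring := apply/rowP => ?; rewrite !mxE; ring.

Section TestFunctions.
Variables (R : realType) (m : nat).
Implicit Types (x y z u v p q c : 'rV[R]_m) (A U : set 'rV[R]_m).
Implicit Types (f g phi psi w : 'rV[R]_m -> R) (G : 'rV[R]_m -> 'rV[R]_m).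
Implicit Types (M : 'M[R]_m) (e d r t a b K : R).

(** Fréchet differentiability with gradient [p]. Partial derivatives control increments along the
    axes only, whereas arguments with test functions need increments in all directions. *)
Definition hasgrad f x p := forall e, 0 < e ->
  exists2 d, 0 < d & forall y, `|y - x| < d ->
    `|f y - f x - dotp p (y - x)| <= e * `|y - x|.

Lemma hasgrad_cont f x p : hasgrad f x p -> forall e, 0 < e ->
  exists2 d, 0 < d & forall y, `|y - x| < d -> `|f y - f x| < e.
Proof.
move=> fx e e0; have [d d0 hd] := fx 1 ltr01.
pose K := 1 + m%:R * `|p| : R.
have K0 : 0 < K by rewrite /K ltr_pwDl// mulr_ge0.
exists (Num.min d (e / K)) => [|y]; first by rewrite lt_min d0 divr_gt0.
rewrite lt_min ltr_pdivlMr// => /andP[yd ye].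
apply: le_lt_trans ye; have := hd y yd; have := dotp_norm p (y - x).
move: (ler_normD (f y - f x - dotp p (y - x)) (dotp p (y - x))); rewrite subrK.
by rewrite /K mulrDr mulr1 [_ * (m%:R * _)]mulrC mul1r => h1 h2 h3; lra.
Qed.

Lemma hasgrad_lin f g x p q a b : hasgrad f x p -> hasgrad g x q ->
  hasgrad (fun y => a * f y + b * g y) x (a *: p + b *: q).
Proof.
move=> fx gx e e0.
have K0 : 0 < `|a| + `|b| + 1 by rewrite ltr_wpDl// addr_ge0.
have e'0 : 0 < e / (`|a| + `|b| + 1) by rewrite divr_gt0.
have [df df0 hf] := fx _ e'0; have [dg dg0 hg] := gx _ e'0.
exists (Num.min df dg) => [|y]; first by rewrite lt_min df0.
rewrite lt_min => /andP[/hf {}hf /hg {}hg].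
rewrite dotpDl !dotpZl (_ : _ - _ - _ = a * (f y - f x - dotp p (y - x))
   + b * (g y - g x - dotp q (y - x))); last by ring.
apply: (le_trans (ler_normD _ _)); rewrite !normrM.
apply: le_trans (lerD (ler_wpM2l (normr_ge0 a) hf) (ler_wpM2l (normr_ge0 b) hg)) _.
rewrite -mulrDl mulrA ler_wpM2r// mulrA ler_pdivrMr// mulrC.
by rewrite ler_wpM2l ?(ltW e0)// lerDl.
Qed.

Lemma hasgrad_derive f x p : hasgrad f x p -> forall i,
  derivable f x (delta_mx 0 i) /\ partial i f x = p 0 i.
Proof.
move=> fx i.
have ex : (fun h : R => h^-1 *: ((f \o shift x) (h *: delta_mx 0 i) - f x)) @ 0^'
    --> p 0 i.
  apply/cvgrPdist_le => e e0; have [d d0 hd] := fx e e0.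
  apply/nbhs_normP; exists d => //= h /=; rewrite sub0r normrN => hd' h0.
  have nh : `|h *: delta_mx 0 i + x - x| <= `|h|.
    by rewrite addrK normrZ ler_piMr// norm_delta_le1.
  have := hd _ (le_lt_trans nh hd').
  move=> /le_trans /(_ (ler_wpM2l (ltW e0) nh)).
  rewrite addrK dotpZr dotp_delta.
  have -> : f (h *: delta_mx 0 i + x) - f x - h * p 0 i =
     - (h * (p 0 i - h^-1 *: (f (h *: delta_mx 0 i + x) - f x))).
    by rewrite /GRing.scale /=; field.
  by rewrite normrN normrM mulrC ler_pM2r// normr_gt0.
split; first by apply/cvg_ex; eexists; exact: ex.
by apply/cvg_lim.
Qed.

Lemma Ck1_hasgrad U f : open U -> Ck U 1 f -> forall x, U x -> hasgrad f x (grad f x).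
Proof.
move=> oU fC x Ux e e0; have [d d0 hd] := Ck1_strict_diff oU fC Ux e0.
by exists d => // y yx; apply: hd => //; rewrite subrr normr0.
Qed.

Lemma C1_closedP A phi : C1_closed A phi -> exists U,
  [/\ open U, A `<=` U, (forall x, U x -> hasgrad phi x (grad phi x)) &
      cont_on U (grad phi)].
Proof.
move=> [U [oU AU cU]]; exists U; split => //; first exact: Ck1_hasgrad.
exact: Ck1_grad.
Qed.

Lemma C1_closedI U A phi G : open U -> A `<=` U ->
  (forall x, U x -> hasgrad phi x (G x)) -> cont_on U G ->
  C1_closed A phi /\ forall x, U x -> grad phi x = G x.
Proof.
move=> oU AU gU cG; split.
  exists U; split => //; split.
    apply/within_contP => x Ux e e0.
    by have [d d0 hd] := hasgrad_cont (gU x Ux) e0; exists d => // y _ /hd.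
  move=> i; split=> [x Ux|]; first exact: (hasgrad_derive (gU x Ux) i).1.
  apply/within_contP => x Ux e e0; have [d d0 hd] := cG x Ux e e0.
  exists d => // y Uy yx; rewrite !(hasgrad_derive (gU _ _) i).2//.
  have := le_entry_norm (G y - G x) i; rewrite !mxE => /le_lt_trans; apply.
  exact: hd.
by move=> x Ux; apply/rowP => i; rewrite mxE (hasgrad_derive (gU _ Ux) i).2.
Qed.

Lemma C1_closed_grad A phi x : C1_closed A phi -> A x -> hasgrad phi x (grad phi x).
Proof. by move=> /C1_closedP[U [_ AU h _]] /AU /h. Qed.

Lemma C1_closed_cont A phi : C1_closed A phi -> cont_on A phi.
Proof.
move=> C x Ax e e0; have [d d0 hd] := hasgrad_cont (C1_closed_grad C Ax) e0.
by exists d => // y _ /hd.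
Qed.

Lemma C1_closed_gradcont A phi : C1_closed A phi -> cont_on A (grad phi).
Proof.
move=> /C1_closedP[U [_ AU _ h]] x /AU Ux e e0; have [d d0 hd] := h x Ux e e0.
by exists d => // y /AU Uy; exact: hd.
Qed.

Lemma C1_closed_lin A phi psi a b : C1_closed A phi -> C1_closed A psi ->
  C1_closed A (fun x => a * phi x + b * psi x) /\
  forall x, A x -> grad (fun x => a * phi x + b * psi x) x =
                   a *: grad phi x + b *: grad psi x.
Proof.
move=> /C1_closedP[U [oU AU gU cU]] /C1_closedP[V [oV AV gV cV]].
have AUV : A `<=` U `&` V by move=> x Ax; split; [exact: AU|exact: AV].
have [||C g] := @C1_closedI (U `&` V) A (fun x => a * phi x + b * psi x)
   (fun x => a *: grad phi x + b *: grad psi x) (openI oU oV) AUV.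
- by move=> x [Ux Vx]; apply: hasgrad_lin; [exact: gU|exact: gV].
- move=> x [Ux Vx] e e0.
  have K0 : 0 < `|a| + `|b| + 1 by rewrite ltr_wpDl// addr_ge0.
  have e'0 : 0 < e / (`|a| + `|b| + 1) by rewrite divr_gt0.
  have [df df0 hf] := cU _ Ux _ e'0; have [dg dg0 hg] := cV _ Vx _ e'0.
  exists (Num.min df dg) => [|y [Uy Vy]]; first by rewrite lt_min df0.
  rewrite lt_min => /andP[/(hf _ Uy) {}hf /(hg _ Vy) {}hg].
  rewrite opprD addrACA -!scalerBr; apply: (le_lt_trans (ler_normD _ _)).
  rewrite !normrZ.
  apply: (le_lt_trans (lerD (ler_wpM2l (normr_ge0 a) (ltW hf)) (ler_wpM2l (normr_ge0 b) (ltW hg)))).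
  by rewrite -mulrDl mulrA ltr_pdivrMr// mulrC ltr_pM2l// ltrDl.
- by split => // x /AUV; exact: g.
Qed.

Lemma C1_closedN A phi : C1_closed A phi ->
  C1_closed A (fun x => - phi x) /\
  forall x, A x -> grad (fun x => - phi x) x = - grad phi x.
Proof.
move=> C; have [D h] := C1_closed_lin (-1) 0 C C.
have E : (fun x => - phi x) = (fun x => -1 * phi x + 0 * phi x).
  by apply/funext => x; rewrite mul0r addr0 mulN1r.
by rewrite E; split => // x /h ->; rewrite scaleN1r scale0r addr0.
Qed.

(** All penalizations and perturbations of test functions have this form. [M] need not be symmetric,
    hence the factor [M + M^T] in the gradient. *)
Definition quad M c y (k : R) x : R := dotp ((x - y) *m M) (x - y) + dotp c (x - y) + k.

(** The remainder of the first-order expansion is exactly the quadratic form of [M] at [z - x]. *)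
Lemma quad_hasgrad M c y k x : hasgrad (quad M c y k) x ((x - y) *m (M + M^T) + c).
Proof.
move=> e e0; have [C C0 hC] := mulmx_norm M.
pose K := m%:R * C + 1.
have K0 : 0 < K by rewrite ltr_wpDl// mulr_ge0// ltW.
exists (e / K) => [|z]; first by rewrite divr_gt0.
rewrite ltr_pdivlMr// => zx.
have -> : quad M c y k z - quad M c y k x - dotp ((x - y) *m (M + M^T) + c) (z - x)
   = dotp ((z - x) *m M) (z - x).
  have -> : z - x = (z - y) - (x - y) by rewrite opprB addrA subrK.
  rewrite /quad; move: (z - y) (x - y) => {zx}z {}x.
  rewrite mulmxDr mulmxBl !(dotpDl, dotpBl, dotpBr, dotpNl) [dotp (x *m M^T) z]dotp_mulmx.
  rewrite [dotp (x *m M^T) x]dotp_mulmx trmxK [dotp x (z *m M)]dotpC [dotp x (x *m M)]dotpC.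
  by ring.
apply: (le_trans (dotp_norm _ _)); rewrite ler_wpM2r//.
apply: (@le_trans _ _ (m%:R * (C * `|z - x|))); first by rewrite ler_wpM2l.
apply: le_trans (ltW zx); rewrite mulrA mulrC ler_wpM2l// /K.
by rewrite lerDl.
Qed.

Lemma quad_C1 A M c y k : C1_closed A (quad M c y k) /\
  forall x, grad (quad M c y k) x = (x - y) *m (M + M^T) + c.
Proof.
have [||C g] := @C1_closedI setT A (quad M c y k)
  (fun x => (x - y) *m (M + M^T) + c) openT (fun _ _ => I).
- by move=> x _; exact: quad_hasgrad.
- move=> x _ e e0; have [C C0 hC] := mulmx_norm (M + M^T).
  exists (e / C) => [|z _]; first by rewrite divr_gt0.
  rewrite ltr_pdivlMr// => zx; rewrite opprD addrACA subrr addr0 -mulmxBl.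
  rewrite opprB addrA subrK; apply: le_lt_trans (hC _) _.
  by rewrite mulrC.
- by split => // x; exact: g.
Qed.

Lemma quad_cont M c y k : cont_on setT (quad M c y k).
Proof. by have [+ _] := quad_C1 setT M c y k; exact: C1_closed_cont. Qed.

Lemma quad_diag (a : R) c y k x :
  quad (a%:M) c y k x = a * dotp (x - y) (x - y) + dotp c (x - y) + k.
Proof. by rewrite /quad mul_mx_scalar dotpZl. Qed.

Lemma quad_diag_grad (a : R) c y k x :
  grad (quad (a%:M) c y k) x = (2 * a) *: (x - y) + c.
Proof.
rewrite (quad_C1 set0 _ _ _ _).2 tr_scalar_mx -raddfD mul_mx_scalar.
by rewrite (_ : a + a = 2 * a)//; ring.
Qed.

Lemma local_maxP A f x : local_max A f x <->
  exists2 r, 0 < r & forall y, A y -> `|y - x| < r -> f y <= f x.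
Proof. exact: near_withinP. Qed.

Lemma local_minP A f x : local_min A f x <->
  exists2 r, 0 < r & forall y, A y -> `|y - x| < r -> f x <= f y.
Proof. exact: near_withinP. Qed.

(** If [psi] touches [w] from above, it grows along [v] at least as fast as [w]. The statement is
    one-sided because at a boundary point only inward directions stay in [A]. *)
Lemma test_dir A w psi x v K : C1_closed A psi -> A x ->
  local_max A (w \- psi) x ->
  (exists2 d, 0 < d & forall t, 0 < t -> t < d ->
     A (x + t *: v) /\ w x + t * K <= w (x + t *: v)) ->
  K <= dotp (grad psi x) v.
Proof.
move=> C Ax /local_maxP[r r0 hr] [d d0 hd]; rewrite leNgt; apply/negP => lK.
have V0 : 0 < `|v| + 1 by rewrite ltr_wpDl.
have e0 : 0 < (K - dotp (grad psi x) v) / 2 / (`|v| + 1).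
  by rewrite !divr_gt0// subr_gt0.
have [d' d'0 hd'] := C1_closed_grad C Ax e0.
pose t := Num.min d (Num.min (r / (`|v| + 1)) (d' / (`|v| + 1))) / 2.
have mn0 : 0 < Num.min d (Num.min (r / (`|v| + 1)) (d' / (`|v| + 1))).
  by rewrite !lt_min d0 !divr_gt0.
have t0 : 0 < t by rewrite divr_gt0.
have : t < Num.min d (Num.min (r / (`|v| + 1)) (d' / (`|v| + 1))) by rewrite /t; lra.
rewrite !lt_min !ltr_pdivlMr// => /and3P[td tr td'].
have nt : `|x + t *: v - x| = t * `|v| by rewrite addrC addKr normrZ gtr0_norm.
have tv : t * `|v| <= t * (`|v| + 1) by rewrite ler_wpM2l ?(ltW t0)// lerDl.
have [Axt wxt] := hd t t0 td.
have := hr _ Axt; rewrite nt => /(_ (le_lt_trans tv tr)) /= h1.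
have := hd' (x + t *: v); rewrite nt => /(_ (le_lt_trans tv td')).
rewrite [x + _]addrC addrK dotpZr => /(le_trans (ler_norm _)) h2.
have h3 : (K - dotp (grad psi x) v) / 2 / (`|v| + 1) * (t * `|v|) <=
          (K - dotp (grad psi x) v) / 2 * t.
  apply: (le_trans (ler_wpM2l (ltW e0) tv)).
  by rewrite [t * _]mulrC mulrA divfK// gt_eqF.
rewrite [t *: v + x]addrC in h2.
have h4 : 0 < t * (K - dotp (grad psi x) v) by rewrite mulr_gt0// subr_gt0.
lra.
Qed.

Lemma test_dir_C1 A phi psi x v : C1_closed A phi -> C1_closed A psi -> A x ->
  local_max A (phi \- psi) x ->
  (exists2 d, 0 < d & forall t, 0 < t -> t < d -> A (x + t *: v)) ->
  dotp (grad phi x) v <= dotp (grad psi x) v.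
Proof.
move=> Cphi Cpsi Ax mx [d d0 hd].
have [C g] := C1_closed_lin 1 (-1) Cpsi Cphi.
have mx' : local_max A ((fun=> 0) \- (fun x => 1 * psi x + -1 * phi x)) x.
  case/local_maxP : mx => r r0 hr; apply/local_maxP; exists r => // y Ay /(hr y Ay) /=.
  lra.
have := @test_dir A _ _ x v 0 C Ax mx'; rewrite g//.
rewrite dotpDl !dotpZl mul1r mulN1r subr_ge0; apply.
by exists d => // t t0 td; split; [exact: hd|rewrite mulr0 addr0].
Qed.

(** At an interior point each axis direction and its opposite are admissible, so the one-sided
    inequalities become equalities. *)
Lemma test_grad_eq A phi psi x : C1_closed A phi -> C1_closed A psi ->
  nbhs x A -> local_max A (phi \- psi) x -> grad phi x = grad psi x.
Proof.
move=> Cphi Cpsi /nbhs_rVP[r r0 rA] mx.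
have Ax : A x by apply: rA; rewrite subrr normr0.
have dir v : exists2 d : R, 0 < d & forall t, 0 < t -> t < d -> A (x + t *: v).
  have V0 : 0 < `|v| + 1 by rewrite ltr_wpDl.
  exists (r / (`|v| + 1)) => [|t t0]; first by rewrite divr_gt0.
  rewrite ltr_pdivlMr// => td; apply: rA; rewrite addrC addKr normrZ gtr0_norm//.
  by apply: le_lt_trans td; rewrite ler_wpM2l ?(ltW t0)// lerDl.
apply/rowP => i; apply/eqP; rewrite eq_le.
have := test_dir_C1 Cphi Cpsi Ax mx (dir (delta_mx 0 i)).
have := test_dir_C1 Cphi Cpsi Ax mx (dir (- delta_mx 0 i)).
by rewrite !dotpNr !dotp_delta lerN2 => -> ->.
Qed.

End TestFunctions.

(** * Semicontinuity and attained maxima *)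

Section Maxima.
Variable R : realType.

(** If the supremum were not attained, every point would have a neighbourhood where [f] stays below
    some level smaller than the supremum; the near-covering form of compactness makes this level
    uniform. *)
Lemma usc_max (T : topologicalType) (A : set T) (f : T -> R) :
  compact A -> A !=set0 ->
  (forall x, A x -> forall t, f x < t -> \forall y \near x, A y -> f y < t) ->
  exists2 x, A x & forall y, A y -> f y <= f x.
Proof.
move=> /compact_near_coveringP /near_covering_withinP cA [a Aa] uf.
have [M hM] : exists M, forall x, A x -> f x < M.
  have : \forall M \near +oo%R, A `<=` [set x | f x < M].
    apply: (cA _ _ (fun M x => f x < M)) => x Ax.
    have := uf x Ax (f x + 1); rewrite ltrDl ltr01 => /(_ isT) h.
    exists ([set y | A y -> f y < f x + 1], [set M | f x + 1 <= M]) => /=.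
      by split => //; exact: nbhs_pinfty_ge (num_real _).
    by move=> [y M] /= [h1 h2] Ay; exact: lt_le_trans (h1 Ay) h2.
  by move=> /filter_ex[M hM]; exists M.
have sA : has_sup (f @` A).
  split; first by exists (f a); exists a.
  by exists M => _ [x Ax <-]; rewrite ltW// hM.
have [[x Ax fx]|no] := pselect (exists2 x, A x & f x = sup (f @` A)).
  exists x => // y Ay; rewrite fx; apply: ub_le_sup; first exact: sA.2.
  by exists y.
have lts x : A x -> f x < sup (f @` A).
  move=> Ax; rewrite lt_neqAle; apply/andP; split.
    by apply/eqP => e; apply: no; exists x.
  by apply: ub_le_sup; [exact: sA.2|exists x].
have : \forall t \near (sup (f @` A))^'-, A `<=` [set x | f x < t].
  apply: (cA _ _ (fun t x => f x < t)) => x Ax.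
  pose t := (f x + sup (f @` A)) / 2.
  have := lts x Ax => fs.
  have ft : f x < t by rewrite /t; lra.
  have ts : t < sup (f @` A) by rewrite /t; lra.
  exists ([set y | A y -> f y < t], [set s | t <= s]) => /=.
    split; first exact: uf.
    exact: nbhs_left_ge.
  by move=> [y s] /= [h1 h2] Ay; exact: lt_le_trans (h1 Ay) h2.
move=> H; have : \forall t \near (sup (f @` A))^'-,
    (A `<=` [set x | f x < t]) /\ t < sup (f @` A).
  by near=> t; split; near: t => //; exact: nbhs_left_lt.
move=> /filter_ex[t [ht ts]].
have st0 : 0 < sup (f @` A) - t by rewrite subr_gt0.
have [_ [x Ax <-]] := sup_adherent st0 sA.
by rewrite opprB addrC subrK => /lt_trans /(_ (ht _ Ax)); rewrite ltxx.
Unshelve. all: by end_near. Qed.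

Variable m : nat.
Implicit Types (x y : 'rV[R]_m) (A B : set 'rV[R]_m) (e d r t : R).

Lemma closed_ballr (z : 'rV[R]_m) r : closed [set y | `|y - z| <= r].
Proof.
move=> x /closureP_rV clx /=; apply/ler_addgt0Pr => e e0.
have [y /= yr yx] := clx e e0.
by rewrite -(subrK y x) -addrA (le_trans (ler_normD _ _))// distrC; lra.
Qed.

Lemma compact_setI_ballr A (z : 'rV[R]_m) r : compact A ->
  compact (A `&` [set y | `|y - z| <= r]).
Proof.
by move=> cA; apply: compact_closedI => //; exact: closed_ballr.
Qed.

Lemma usc_onP A v : usc_on A v <-> forall x, A x -> forall t, v x < t ->
  exists2 r, 0 < r & forall y, A y -> `|y - x| < r -> v y < t.
Proof. by split=> h x Ax t /(h x Ax) /near_withinP. Qed.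

Lemma lsc_onP A v : lsc_on A v <-> forall x, A x -> forall t, t < v x ->
  exists2 r, 0 < r & forall y, A y -> `|y - x| < r -> t < v y.
Proof. by split=> h x Ax t /(h x Ax) /near_withinP. Qed.

Lemma lsc_usc_opp A (v : 'rV[R]_m -> R) : lsc_on A v <-> usc_on A (fun x => - v x).
Proof.
rewrite lsc_onP usc_onP; split=> h x Ax t.
  rewrite ltrNl => /(h x Ax)[r r0 hr]; exists r => // y Ay /(hr y Ay).
  by rewrite ltrNl.
rewrite -ltrN2 => /(h x Ax)[r r0 hr]; exists r => // y Ay /(hr y Ay).
by rewrite ltrN2.
Qed.

Lemma cont_usc A (v : 'rV[R]_m -> R) : cont_on A v -> usc_on A v.
Proof.
move=> c; apply/usc_onP => x Ax t vt.
have t0 : 0 < t - v x by rewrite subr_gt0.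
have [d d0 hd] := c x Ax _ t0; exists d => // y Ay /(hd y Ay).
by rewrite ltr_norml => /andP[_]; rewrite ltrD2r.
Qed.

Lemma cont_onN A (v : 'rV[R]_m -> R) : cont_on A v -> cont_on A (fun x => - v x).
Proof.
move=> c x Ax e e0; have [d d0 hd] := c x Ax e e0; exists d => // y Ay yx.
by rewrite -opprD normrN; exact: hd.
Qed.

Lemma cont_lsc A (v : 'rV[R]_m -> R) : cont_on A v -> lsc_on A v.
Proof. by move=> /cont_onN /cont_usc /lsc_usc_opp. Qed.

Lemma usc_onB A (v f : 'rV[R]_m -> R) : usc_on A v -> cont_on A f ->
  usc_on A (v \- f).
Proof.
move=> /usc_onP uv cf; apply/usc_onP => x Ax t /= vt.
have e0 : 0 < (t - (v x - f x)) / 2 by rewrite divr_gt0// subr_gt0.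
have [|r r0 hr] := uv x Ax (v x + (t - (v x - f x)) / 2); first by rewrite ltrDl.
have [d d0 hd] := cf x Ax _ e0.
exists (Num.min r d) => [|y Ay]; first by rewrite lt_min r0.
rewrite lt_min => /andP[/(hr _ Ay) h /(hd _ Ay)]; rewrite ltr_norml => /andP[h' _].
lra.
Qed.

Lemma usc_subset A B v : usc_on A v -> B `<=` A -> usc_on B v.
Proof.
move=> /usc_onP h BA; apply/usc_onP => x Bx t /(h x (BA x Bx))[r r0 hr].
by exists r => // y /BA; exact: hr.
Qed.

Lemma cont_on_subset A B (W : normedModType R) (v : 'rV[R]_m -> W) :
  cont_on A v -> B `<=` A -> cont_on B v.
Proof.
move=> h BA x /BA Ax e /(h x Ax)[d d0 hd]; exists d => // y /BA; exact: hd.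
Qed.

Lemma usc_max_rV A v : compact A -> A !=set0 -> usc_on A v ->
  exists2 x, A x & forall y, A y -> v y <= v x.
Proof.
move=> cA A0 /usc_onP uv; apply: usc_max => // x Ax t vt.
have [r r0 hr] := uv x Ax t vt.
by apply/nbhs_rVP; exists r => // y yx Ay; exact: hr.
Qed.

(** The form common to the doublings of variables: [q1] penalizes the distance of the two points,
    [q2] and [q3] localize them separately. *)
Lemma pair_max A B (u w q1 q2 q3 : 'rV[R]_m -> R) :
  compact A -> compact B -> A !=set0 -> B !=set0 ->
  usc_on A u -> lsc_on B w -> cont_on setT q1 -> cont_on setT q2 -> cont_on setT q3 ->
  exists x y, [/\ A x, B y & forall x' y', A x' -> B y' ->
    u x' - w y' - q1 (x' - y') - q2 x' - q3 y' <=
    u x - w y - q1 (x - y) - q2 x - q3 y].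
Proof.
move=> cA cB [a Aa] [b Bb] /usc_onP uu /lsc_onP lw c1 c2 c3.
pose f (p : 'rV[R]_m * 'rV[R]_m) :=
  u p.1 - w p.2 - q1 (p.1 - p.2) - q2 p.1 - q3 p.2.
have [||[x y] [/= Ax By] h] := @usc_max _ (A `*` B) f (compact_setX cA cB).
- by exists (a, b).
- move=> [x y] [/= Ax By] t ft; rewrite /f /= in ft.
  (* Five terms vary, each by less than a sixth of the gap. *)
  pose e := (t - (u x - w y - q1 (x - y) - q2 x - q3 y)) / 6.
  have e0 : 0 < e by rewrite divr_gt0// subr_gt0.
  have [|r1 r10 h1] := uu x Ax (u x + e); first by rewrite ltrDl.
  have [|r2 r20 h2] := lw y By (w y - e); first by rewrite ltrBlDr ltrDl.
  have [r3 r30 h3] := c1 (x - y) I e e0.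
  have [r4 r40 h4] := c2 x I e e0.
  have [r5 r50 h5] := c3 y I e e0.
  pose r := Num.min (Num.min r1 r2) (Num.min (r3 / 2) (Num.min r4 r5)).
  have r0 : 0 < r by rewrite !lt_min r10 r20 r40 r50 divr_gt0.
  exists ([set x' | `|x' - x| < r], [set y' | `|y' - y| < r]) => /=.
    by split; apply/nbhs_rVP; exists r.
  move=> [x' y'] /= []; rewrite !lt_min.
  move=> /andP[/andP[x1 x2] /and3P[x3 x4 x5]] /andP[/andP[y1 y2] /and3P[y3 y4 y5]].
  move=> [/= Ax' By'].
  have := h1 _ Ax' x1; have := h2 _ By' y2; have := h4 _ I x4; have := h5 _ I y5.
  have := h3 (x' - y') I.
  have -> : x' - y' - (x - y) = (x' - x) - (y' - y) by vring.
  move=> h3'.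
  have {}h3' : `|q1 (x' - y') - q1 (x - y)| < e.
    by apply: h3'; apply: (le_lt_trans (ler_normB _ _)); lra.
  move: h3'; rewrite !ltr_norml => /andP[a1 _] /andP[a2 _] /andP[a3 _] a4 a5.
  rewrite /f /=; move: ft; rewrite /e in a1 a2 a3 a4 a5 *; lra.
- by exists x, y; split => // x' y' Ax' By'; exact: (h (x', y')).
Qed.

End Maxima.

(** * Lipschitz estimates *)

Section Segments.
Variables (R : realType) (m : nat).
Implicit Types (x y z e v p : 'rV[R]_m) (r s t d L : R).
Variable Omega : set 'rV[R]_m.
Local Notation cl := (closure Omega).

(** One direction [e] serves all points of the closure near [z]. The equicontinuity estimates use
    nothing else about the boundary. *)
Definition inner_shift z e r := 0 < r /\
  forall x, cl x -> `|x - z| < r -> forall s, 0 < s -> s < r -> Omega (x + s *: e).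

Definition inner_dir := forall z, cl z -> exists e r, inner_shift z e r.

(** A gradient bound gives no more than this: near a cusp of a C^0 boundary the norm of [y - x] may
    be much smaller than the length of any path in Omega. *)
Definition segLip L (u : 'rV[R]_m -> R) := forall x y,
  (forall t, 0 <= t -> t <= 1 -> Omega (x + t *: (y - x))) ->
  `|u y - u x| <= L * `|y - x|.

Hypothesis oO : open Omega.

Lemma compact_tube (K : set 'rV[R]_m) : compact K -> K `<=` Omega ->
  exists2 r, 0 < r & forall k, K k -> forall y, `|y - k| < r -> Omega y.
Proof.
move=> /compact_near_coveringP cK KO.
have : \forall r \near (0 : R)^'+, K `<=` [set k | forall y, `|y - k| < r -> Omega y].
  apply: (cK _ _ (fun r k => forall y, `|y - k| < r -> Omega y)) => k /KO Ok.
  have [r r0 hr] := (openP_rV Omega).1 oO k Ok.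
  have r2 : 0 < r / 2 by rewrite divr_gt0.
  exists ([set k' | `|k' - k| < r / 2], [set s | s <= r / 2]) => /=.
    by split; [apply/nbhs_rVP; exists (r / 2)|exact: nbhs_right_le].
  move=> [k' s] /= [kk' sr] y yk'; apply: hr.
  rewrite -(subrK k' y) -addrA (le_lt_trans (ler_normD _ _))//; lra.
move=> H; have : \forall r \near (0 : R)^'+,
   (K `<=` [set k | forall y, `|y - k| < r -> Omega y]) /\ 0 < r.
  by near=> r; split; near: r => //; exact: nbhs_right_gt.
by move=> /filter_ex[r [hr r0]]; exists r => // k Kk y; exact: hr.
Unshelve. all: by end_near. Qed.

Lemma segment_rV_compact x y : compact [set x + t *: (y - x) | t in `[0, 1 : R]%classic].
Proof.
apply: continuous_compact; last exact: segment_compact.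
apply: continuous_subspaceT => t; apply: cvgD; first exact: cvg_cst.
by apply: cvgZr_tmp; exact: cvg_id.
Qed.

Hypothesis cO : compact cl.

Let subO x : Omega x -> cl x. Proof. exact: subset_closure. Qed.

(* The sup-convolution [u_e y = max_x u x - |x - y|^2 / (2 e)] inherits the gradient
   bound of u and is therefore almost L-Lipschitz at scales below e; walking along
   the segment in small steps keeps the maximum points inside Omega. *)
Lemma grad_bound_half (u : 'rV[R]_m -> R) L : 0 <= L -> usc_on cl u ->
  (forall phi x, C1_closed cl phi -> Omega x -> local_max cl (u \- phi) x ->
     `|grad phi x| <= L) ->
  forall x y, (forall t, 0 <= t -> t <= 1 -> Omega (x + t *: (y - x))) ->
  u x - m%:R * L * `|y - x| <= u y.
Proof.
move=> L0 uu hL x y seg.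
have Ox : Omega x by have := seg 0; rewrite scale0r addr0; exact.
have Oy : Omega y by have := seg 1; rewrite scale1r addrC subrK; apply.
have cl0 : cl !=set0 by exists x; exact: subO.
have [|rho rho0 hrho] := compact_tube (@segment_rV_compact x y).
  by move=> _ [t tI <-]; move: tI; rewrite /= in_itv /= => /andP[t0 t1]; exact: seg.
have {}hrho t z : 0 <= t -> t <= 1 -> `|z - (x + t *: (y - x))| < rho -> Omega z.
  move=> t0 t1; apply: hrho.
  by exists t => //=; rewrite in_itv /= t0.
have [xM clxM hM] := usc_max_rV cO cl0 uu.
set M := u xM in hM.
set D := `|y - x|; have D0 : 0 <= D by rewrite normr_ge0.
(* A level below which the walk never falls. Where [ue z] is at least [m0], the penalty
   [a * q (X z - z)] is at most [M - m0], so the maximum point stays within [rho] of the segment,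
   hence in Omega. *)
pose m0 := u x - m%:R * D * (L + 1).
have Mm0 : 0 <= M - m0.
  have : 0 <= m%:R * D * (L + 1) by rewrite !mulr_ge0// addr_ge0.
  by have := hM x (subO Ox); rewrite /m0; lra.
pose q z : R := dotp z z.
have xm (a : R) z : exists x', cl x' /\ forall x'', cl x'' ->
    u x'' - a * q (x'' - z) <= u x' - a * q (x' - z).
  have [|x' clx' hx'] := usc_max_rV cO cl0 (@usc_onB _ _ _ u (quad a%:M 0 z 0) uu _).
    exact: cont_on_subset (quad_cont _ _ _ _) (@subsetT _ _).
  exists x'; split => // x'' /hx' /=.
  by rewrite !quad_diag !dotp0l !addr0.
have main a : 0 < a -> (M - m0) < a * rho ^+ 2 ->
    exists x', [/\ cl x', u x - m%:R * L * D <= u x' & (2 * a) * `|x' - y| <= L].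
  move=> a0 arho.
  have [X hX] := choice (xm a).
  pose ue z := u (X z) - a * q (X z - z).
  have good t : 0 <= t -> t <= 1 -> m0 <= ue (x + t *: (y - x)) ->
      (2 * a) * `|X (x + t *: (y - x)) - (x + t *: (y - x))| <= L.
    move=> t0 t1; set z := x + _ => mz.
    have OX : Omega (X z).
      apply: (hrho t) => //; rewrite -/z.
      have h1 : a * `|X z - z| ^+ 2 <= a * q (X z - z).
        by rewrite ler_wpM2l ?(ltW a0)//; exact: norm_dotp.
      have h2 := hM _ (hX z).1; rewrite /ue in mz.
      have : a * `|X z - z| ^+ 2 < a * rho ^+ 2 by lra.
      by rewrite ltr_pM2l// ltr_pXn2r// ?nnegrE ?normr_ge0 ?(ltW rho0).
    have [C _] := quad_C1 cl a%:M 0 z 0.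
    have := hL _ _ C OX; rewrite quad_diag_grad addr0 normrZ gtr0_norm ?mulr_gt0//; apply.
    apply/local_maxP; exists 1 => // x'' clx'' _ /=.
    by rewrite !quad_diag !dotp0l !addr0; exact: (hX z).2.
  have step t z' : 0 <= t -> t <= 1 -> m0 <= ue (x + t *: (y - x)) ->
      ue (x + t *: (y - x)) - m%:R * `|x + t *: (y - x) - z'| *
        (L + a * `|x + t *: (y - x) - z'|) <= ue z'.
    move=> t0 t1 mz; have gz := good t t0 t1 mz.
    set z := x + _ in gz mz *.
    have h := (hX z').2 _ (hX z).1; rewrite -/(ue z') in h.
    apply: le_trans h; rewrite /ue -addrA lerD2l.
    have -> : q (X z - z') = q (X z - z) + dotp (z - z') (2 *: (X z - z) + (z - z')).
      have -> : X z - z' = (X z - z) + (z - z') by rewrite addrA subrK.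
      rewrite /q; move: (X z - z) (z - z') => A B; rewrite !(dotpDl, dotpDr, dotpZr).
      by rewrite [dotp B A]dotpC; ring.
    suff : a * dotp (z - z') (2 *: (X z - z) + (z - z')) <=
        m%:R * `|z - z'| * (L + a * `|z - z'|).
      by rewrite [a * (_ + dotp _ _)]mulrDr; lra.
    have := dotp_norm (z - z') (2 *: (X z - z) + (z - z')).
    move=> /(le_trans (ler_norm _)) h'.
    apply: (le_trans (ler_wpM2l (ltW a0) h')).
    have h2 : `|2 *: (X z - z) + (z - z')| <= 2 * `|X z - z| + `|z - z'|.
      by rewrite (le_trans (ler_normD _ _))// normrZ ger0_norm.
    have -> : a * (m%:R * `|z - z'| * `|2 *: (X z - z) + (z - z')|) =
              m%:R * `|z - z'| * (a * `|2 *: (X z - z) + (z - z')|) by ring.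
    rewrite ler_wpM2l ?mulr_ge0//.
    have : a * `|2 *: (X z - z) + (z - z')| <= a * (2 * `|X z - z| + `|z - z'|).
      by rewrite ler_wpM2l ?(ltW a0).
    by lra.
  have walk n : (0 < n)%N -> a * (D / n%:R) <= 1 -> forall k, (k <= n)%N ->
      u x - k%:R * (m%:R * (D / n%:R) * (L + a * (D / n%:R))) <=
      ue (x + (k%:R / n%:R) *: (y - x)).
    move=> n0 an1; elim=> [_|k IH kn].
      rewrite !mul0r subr0 scale0r addr0.
      have := (hX x).2 x (subO Ox); rewrite -/(ue x) subrr /q dotp0l mulr0 subr0.
      by [].
    have nR : 0 < n%:R :> R by rewrite ltr0n.
    have hk : 0 <= k%:R / n%:R :> R by rewrite divr_ge0.
    have hk1 : k%:R / n%:R <= 1 :> R by rewrite ler_pdivrMr// mul1r ler_nat ltnW.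
    have {}IH := IH (ltnW kn).
    have dz : `|x + (k%:R / n%:R) *: (y - x) - (x + (k.+1%:R / n%:R) *: (y - x))| = D / n%:R.
      rewrite opprD addrACA subrr add0r -scalerBl -mulrBl -natr1 opprD addrA subrr add0r.
      by rewrite normrZ normrM normrN1 mul1r gtr0_norm ?invr_gt0// mulrC.
    have bound : k%:R * (m%:R * (D / n%:R) * (L + a * (D / n%:R))) <= m%:R * D * (L + 1).
      have -> : k%:R * (m%:R * (D / n%:R) * (L + a * (D / n%:R))) =
        (k%:R / n%:R) * (m%:R * D * (L + a * (D / n%:R))) by field; rewrite gt_eqF.
      apply: (@le_trans _ _ (m%:R * D * (L + a * (D / n%:R)))).
        by rewrite ler_piMl// !mulr_ge0// addr_ge0// !mulr_ge0// ?ltW// invr_ge0 ltW.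
      by rewrite ler_wpM2l ?mulr_ge0// lerD2l.
    have m0k : m0 <= ue (x + (k%:R / n%:R) *: (y - x)) by rewrite /m0; lra.
    have := step _ (x + (k.+1%:R / n%:R) *: (y - x)) hk hk1 m0k.
    rewrite dz -[k.+1%:R in X in _ -> X <= _]natr1 mulrDl mul1r; lra.
  have uey : u x - m%:R * L * D <= ue y.
    rewrite leNgt; apply/negP => lt.
    pose gap := u x - m%:R * L * D - ue y.
    have gap0 : 0 < gap by rewrite subr_gt0.
    (* With [n] steps the accumulated excess over the Lipschitz bound is [m D (a D) / n], which
       drops below the supposed gap. *)
    have [n hn] : exists n : nat, (m%:R * D * (a * D) / gap + a * D + 1 < n%:R :> R).
      by exists (Num.truncn (m%:R * D * (a * D) / gap + a * D + 1)).+1; exact: truncnS_gt.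
    have aD0 : 0 <= a * D by rewrite mulr_ge0// ltW.
    have mDaD : 0 <= m%:R * D * (a * D) by rewrite mulr_ge0// mulr_ge0.
    have mg : 0 <= m%:R * D * (a * D) / gap by rewrite divr_ge0 ?(ltW gap0).
    have nR : 0 < n%:R :> R by lra.
    have n0 : (0 < n)%N by rewrite -(ltr0n R).
    have an1 : a * (D / n%:R) <= 1 by rewrite mulrA ler_pdivrMr// mul1r; lra.
    have := walk n n0 an1 n (leqnn n).
    rewrite divff ?gt_eqF// scale1r [x + _]addrC subrK.
    have -> : n%:R * (m%:R * (D / n%:R) * (L + a * (D / n%:R))) =
       m%:R * D * L + (m%:R * D * (a * D)) / n%:R by field; rewrite gt_eqF.
    have : (m%:R * D * (a * D)) / n%:R < gap.
      by rewrite ltr_pdivrMr// [gap * _]mulrC -ltr_pdivrMr//; move: hn; clearbody gap; lra.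
    by rewrite /gap; lra.
  exists (X y); split; first exact: (hX y).1.
    apply: (le_trans uey); rewrite /ue lerBlDr lerDl mulr_ge0 ?(ltW a0)//.
    exact: dotp_ge0.
  have := good 1 ler01 (lexx _); rewrite scale1r [x + _]addrC subrK; apply.
  apply: le_trans uey; rewrite /m0 /D lerD2l lerN2 mulrAC ler_wpM2l ?mulr_ge0//.
  by rewrite lerDl.
rewrite leNgt; apply/negP => lt.
have [r r0 hr] := (usc_onP cl u).1 uu y (subO Oy) _ lt.
have rr0 : 0 < rho ^+ 2 by rewrite exprn_gt0.
(* The first term keeps maximum points in the tube around the segment; the second brings [x'] within
   [r] of [y], where upper semicontinuity gives the contradiction. *)
pose a := (M - m0) / rho ^+ 2 + L / r + 1.
have a1 : 0 <= (M - m0) / rho ^+ 2 by rewrite divr_ge0 ?(ltW rr0).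
have a2 : 0 <= L / r by rewrite divr_ge0 ?(ltW r0).
have a0 : 0 < a by rewrite /a; lra.
have [|x' [clx' ux' dx']] := main a a0.
  by rewrite -ltr_pdivrMr// /a; lra.
have : `|x' - y| < r.
  have h : 2 * a * `|x' - y| < 2 * a * r.
    apply: (le_lt_trans dx'); rewrite -ltr_pdivrMr// /a; lra.
  by rewrite ltr_pM2l ?mulr_gt0// in h.
move=> /(hr _ clx'); lra.
Qed.

Lemma grad_bound_segLip (u : 'rV[R]_m -> R) L : 0 <= L -> usc_on cl u ->
  (forall phi x, C1_closed cl phi -> Omega x -> local_max cl (u \- phi) x ->
     `|grad phi x| <= L) ->
  segLip (m%:R * L) u.
Proof.
move=> L0 uu hL x y seg; rewrite ler_norml; apply/andP; split.
  have := grad_bound_half L0 uu hL seg; lra.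
have := @grad_bound_half u L L0 uu hL y x; rewrite distrC => h.
have {}h := h _; suff : u y - m%:R * L * `|y - x| <= u x by lra.
apply: h => t t0 t1; have := seg (1 - t).
have -> : x + (1 - t) *: (y - x) = y + t *: (x - y) by vring.
by apply; lra.
Qed.

End Segments.

(** * Equicontinuity and extension to the closure *)

Section Extension.
Variables (R : realType) (m : nat).
Implicit Types (x y z e v p : 'rV[R]_m) (r s t d L eps : R).
Variable Omega : set 'rV[R]_m.
Local Notation cl := (closure Omega).
Hypothesis oO : open Omega.

(** From a boundary point the segment to [x + s *: e] is not contained in Omega; it is started at
    [x + s' *: e] instead, and continuity at [x] removes the small [s']. *)
Lemma shift_bound L (u : 'rV[R]_m -> R) z e r x s : 0 <= L ->
  segLip Omega L u -> cont_on cl u -> inner_shift Omega z e r ->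
  cl x -> `|x - z| < r -> 0 < s -> s < r ->
  `|u (x + s *: e) - u x| <= L * (s * `|e|).
Proof.
move=> L0 uL uc [r0 hr] clx xz s0 sr; apply/ler_addgt0Pr => eps eps0.
have [d d0 hd] := uc x clx eps eps0.
have E0 : 0 < `|e| + 1 by rewrite ltr_wpDl.
pose s' := Num.min s (d / (`|e| + 1)) / 2.
have mn0 : 0 < Num.min s (d / (`|e| + 1)) by rewrite lt_min s0 divr_gt0.
have s'0 : 0 < s' by rewrite divr_gt0.
have : s' < Num.min s (d / (`|e| + 1)) by rewrite /s'; lra.
rewrite lt_min ltr_pdivlMr// => /andP[s's s'd].
have h1 : `|u (x + s' *: e) - u x| < eps.
  apply: hd; first by apply: subset_closure; apply: hr => //; lra.
  rewrite [x + _]addrC addrK normrZ gtr0_norm//; apply: le_lt_trans s'd.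
  by rewrite ler_wpM2l ?(ltW s'0)// lerDl.
have h2 : `|u (x + s *: e) - u (x + s' *: e)| <= L * (s * `|e|).
  have sE : x + s *: e - (x + s' *: e) = (s - s') *: e by vring.
  apply: (le_trans (uL _ _ _)).
    move=> t t0 t1; rewrite sE.
    have -> : x + s' *: e + t *: ((s - s') *: e) = x + (s' + t * (s - s')) *: e.
      by vring.
    have h : 0 <= t * (s - s') by rewrite mulr_ge0// subr_ge0 ltW.
    have h' : t * (s - s') <= s - s' by rewrite ler_piMl// subr_ge0 ltW.
    apply: hr => //; lra.
  rewrite sE normrZ ler_wpM2l// ler_wpM2r//; rewrite gtr0_norm; lra.
by have := ler_distD (u (x + s' *: e)) (u (x + s *: e)) (u x); lra.
Qed.

(** With [x] in Omega the whole segment lies in Omega. This version serves functions not known to be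
    continuous up to the boundary, from which the extension is built. *)
Lemma shift_bound_in L (u : 'rV[R]_m -> R) z e r x s :
  segLip Omega L u -> inner_shift Omega z e r ->
  Omega x -> `|x - z| < r -> 0 < s -> s < r ->
  `|u (x + s *: e) - u x| <= L * (s * `|e|).
Proof.
move=> uL [r0 hr] Ox xz s0 sr.
have sE : x + s *: e - x = s *: e by vring.
apply: (le_trans (uL _ _ _)); last by rewrite sE normrZ gtr0_norm.
move=> t t0 t1; rewrite sE scalerA.
have [->|tn0] := eqVneq t 0; first by rewrite mul0r scale0r addr0.
have t00 : 0 < t by rewrite lt_neqAle eq_sym tn0.
apply: hr => //; first exact: subset_closure.
- by rewrite mulr_gt0.
- by apply: le_lt_trans sr; rewrite ler_piMl// ltW.
Qed.

(* Two points near z are joined by moving both by s e, where a whole ball around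
   z + s e lies in Omega. *)
Lemma equicont_gen L z : 0 <= L -> inner_dir Omega -> cl z -> forall eps, 0 < eps ->
  exists2 d, 0 < d & forall u : 'rV[R]_m -> R, segLip Omega L u ->
    (forall x y, Omega x -> Omega y -> `|x - z| < d -> `|y - z| < d ->
      `|u x - u y| <= eps) /\
    (cont_on cl u -> forall x y, cl x -> cl y -> `|x - z| < d -> `|y - z| < d ->
      `|u x - u y| <= eps).
Proof.
move=> L0 dirO clz eps eps0; have [e [r sh]] := dirO z clz.
have [r0 hr] := sh.
have K0 : 0 < L * `|e| + 1 by rewrite ltr_wpDl// mulr_ge0.
pose s := Num.min r (eps / 4 / (L * `|e| + 1)) / 2.
have mn0 : 0 < Num.min r (eps / 4 / (L * `|e| + 1)) by rewrite lt_min r0 !divr_gt0.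
have s0 : 0 < s by rewrite divr_gt0.
have : s < Num.min r (eps / 4 / (L * `|e| + 1)) by rewrite /s; lra.
rewrite lt_min ltr_pdivlMr// => /andP[sr se].
have sLe : L * (s * `|e|) <= eps / 4.
  apply: (le_trans _ (ltW se)); rewrite mulrCA ler_wpM2l ?(ltW s0)// lerDl//.
have Ozs : Omega (z + s *: e) by apply: hr => //; rewrite subrr normr0.
have [rho rho0 hrho] := (openP_rV Omega).1 oO _ Ozs.
have L10 : 0 < L + 1 by lra.
pose d := Num.min r (Num.min rho (eps / 8 / (L + 1))).
have d0 : 0 < d by rewrite !lt_min r0 rho0 !divr_gt0.
exists d => // u uL.
have mid x y : `|x - z| < d -> `|y - z| < d ->
    `|u (x + s *: e) - u (y + s *: e)| <= eps / 4.
  rewrite !lt_min !ltr_pdivlMr// => /and3P[x1 x2 x3] /and3P[y1 y2 y3].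
  have sE : x + s *: e - (y + s *: e) = x - y by vring.
  apply: (le_trans (uL _ _ _)).
    move=> t t0 t1; apply: hrho; rewrite sE.
    have -> : y + s *: e + t *: (x - y) - (z + s *: e) =
      (1 - t) *: (y - z) + t *: (x - z) by vring.
    apply: (le_lt_trans (ler_normD _ _)); rewrite !normrZ !ger0_norm ?subr_ge0//.
    have : (1 - t) * `|y - z| <= (1 - t) * Num.max `|x - z| `|y - z|.
      by rewrite ler_wpM2l ?subr_ge0// le_max lexx orbT.
    have : t * `|x - z| <= t * Num.max `|x - z| `|y - z|.
      by rewrite ler_wpM2l// le_max lexx.
    have : Num.max `|x - z| `|y - z| < rho by rewrite gt_max x2.
    lra.
  rewrite sE; have -> : x - y = (x - z) - (y - z) by vring.
  have h : `|x - z - (y - z)| <= `|x - z| + `|y - z| := ler_normB _ _.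
  have := ler_wpM2l L0 h; have := normr_ge0 (x - z); have := normr_ge0 (y - z).
  by move: x3 y3; lra.
have comb (a b a' b' : R) : `|a' - a| <= eps / 4 -> `|a' - b'| <= eps / 4 ->
    `|b' - b| <= eps / 4 -> `|a - b| <= eps.
  by rewrite !ler_norml; lra.
split=> [x y Ox Oy xd yd|uc x y clx cly xd yd];
  (have xr : `|x - z| < r by move: xd; rewrite /d lt_min => /andP[]);
  (have yr : `|y - z| < r by move: yd; rewrite /d lt_min => /andP[]);
  apply: (comb _ _ (u (x + s *: e)) (u (y + s *: e)));
  first [exact: mid
        | exact: le_trans (shift_bound_in uL sh _ _ s0 sr) sLe
        | exact: le_trans (shift_bound L0 uL uc sh _ _ s0 sr) sLe].
Qed.

Lemma equicont L z : 0 <= L -> inner_dir Omega -> cl z -> forall eps, 0 < eps ->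
  exists2 d, 0 < d & forall u : 'rV[R]_m -> R, segLip Omega L u -> cont_on cl u ->
    forall x y, cl x -> cl y -> `|x - z| < d -> `|y - z| < d -> `|u x - u y| <= eps.
Proof.
move=> L0 dO clz eps eps0; have [d d0 hd] := equicont_gen L0 dO clz eps0.
by exists d => // u uL; exact: (hd u uL).2.
Qed.

(** By equicontinuity the interior values near a boundary point form a Cauchy filter; its limit is
    the boundary value. *)
Lemma segLip_extension L (u : 'rV[R]_m -> R) : 0 <= L -> inner_dir Omega ->
  segLip Omega L u ->
  exists v : 'rV[R]_m -> R, [/\ cont_on cl v, (forall x, Omega x -> v x = u x) & segLip Omega L v].
Proof.
move=> L0 dO uL.
have lim z : exists l : R, (Omega z -> l = u z) /\
    (cl z -> forall eps, 0 < eps -> exists2 d, 0 < d &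
       forall x, Omega x -> `|x - z| < d -> `|u x - l| <= eps).
  have [Oz|nOz] := pselect (Omega z).
    exists (u z); split => // clz eps eps0.
    have [d d0 hd] := equicont_gen L0 dO clz eps0.
    by exists d => // x Ox xz; apply: (hd u uL).1 => //; rewrite subrr normr0.
  have [clz|nclz] := pselect (cl z); last by exists 0.
  pose F := u @ within Omega (nbhs z).
  have PF : ProperFilter F.
    by apply: fmap_proper_filter; exact: within_nbhs_proper.
  have cF : cauchy F.
    apply/cauchy_ballP => eps eps0 /=.
    have e2 : 0 < eps / 2 by rewrite divr_gt0.
    have [d d0 hd] := equicont_gen L0 dO clz e2.
    have FA : F [set u x | x in [set x | Omega x /\ `|x - z| < d]].
      by apply/near_withinP; exists d => // y Oy yz; exists y.
    exists ([set u x | x in [set x | Omega x /\ `|x - z| < d]],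
            [set u x | x in [set x | Omega x /\ `|x - z| < d]]) => //=.
    move=> [a b] /= [[x [Ox xz] <-] [y [Oy yz] <-]].
    have := (hd u uL).1 x y Ox Oy xz yz; rewrite -ball_normE /ball_ /=; lra.
  have [l hl] : exists l : R, F --> l by apply/cvg_ex; apply/cauchy_cvgP.
  exists l; split => // _ eps eps0.
  move/cvgrPdist_lt : hl => /(_ eps eps0) /near_withinP[d d0 hd].
  by exists d => // x Ox /(hd x Ox) /ltW; rewrite distrC.
have [v hv] := choice lim; exists v; split.
- move=> z clz eps eps0; have e4 : 0 < eps / 4 by rewrite divr_gt0.
  have [d d0 hd] := (hv z).2 clz _ e4.
  have d2 : 0 < d / 2 by rewrite divr_gt0.
  exists (d / 2) => // y cly yz; have [d' d'0 hd'] := (hv y).2 cly _ e4.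
  have mn0 : 0 < Num.min (d / 2) d' by rewrite lt_min d2.
  have [x Ox] := (closureP_rV _ _).1 cly _ mn0.
  rewrite lt_min => /andP[x1 x2].
  have xz : `|x - z| < d.
    rewrite -(subrK y x) -addrA (le_lt_trans (ler_normD _ _))//; lra.
  by have := hd' x Ox x2; have := hd x Ox xz; rewrite !ler_norml ltr_norml; lra.
- by move=> x Ox; exact: (hv x).1.
- move=> x y seg; rewrite !(hv _).1; first exact: uL.
    by have := seg 0; rewrite scale0r addr0; apply.
  by have := seg 1; rewrite scale1r addrC subrK; apply.
Qed.

(* Equicontinuity makes the relation "pointwise bounded oscillation between x and y"
   relatively open and closed in the connected set cl. *)
Lemma pointwise_osc L x : 0 <= L -> inner_dir Omega -> connected Omega -> cl x ->
  forall y, cl y -> exists M : R, forall u, segLip Omega L u -> cont_on cl u ->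
    `|u x - u y| <= M.
Proof.
move=> L0 dO cO clx.
pose B := [set y | cl y /\ exists M : R, forall u, segLip Omega L u -> cont_on cl u ->
    `|u x - u y| <= M].
suff BE : B = cl by move=> y; rewrite -{1}BE => -[].
have loc y : cl y -> exists2 d : R, 0 < d & forall z, cl z -> `|z - y| < d ->
    (B z <-> B y).
  move=> cly; have [d d0 hd] := equicont L0 dO cly ltr01.
  exists d => // z clz zy.
  have yy : `|y - y| < d by rewrite subrr normr0.
  split=> -[_ [M hM]]; split => //; exists (M + 1) => u uL uc;
    have := hM u uL uc; have := hd u uL uc _ _ clz cly zy yy;
    rewrite !ler_norml; lra.
apply: (connected_closure cO).
- by exists x; split => //; exists 0 => u _ _; rewrite subrr normr0.
- exists [set z | exists y, B y /\ exists2 d : R, `|z - y| < d &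
     forall z, cl z -> `|z - y| < d -> B z].
    apply/openP_rV => z [y [By [d zd hd]]].
    exists (d - `|z - y|) => [|w wz]; first by rewrite subr_gt0.
    exists y; split => //; exists d => //.
    by rewrite -(subrK z w) -addrA (le_lt_trans (ler_normD _ _))//; lra.
  apply/seteqP; split=> [y By|z [clz [y [By [d zd hd]]]]]; last exact: hd.
  have [cly _] := By; split => //; exists y; split => //.
  have [d d0 hd] := loc y cly; exists d; first by rewrite subrr normr0.
  by move=> z clz /(hd z clz) h; apply/h.
- exists (closure B); first exact: closed_closure.
  apply/seteqP; split=> [y By|y [cly clBy]].
    by split; [exact: By.1|exact: subset_closure].
  have [d d0 hd] := loc y cly; have [z Bz /(hd z Bz.1) h] := (closureP_rV _ _).1 clBy d d0.
  exact/h.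
Qed.

End Extension.

(** * Consequences of continuity and coercivity of the Hamiltonian *)

Section Hamiltonian.
Variables (R : realType) (m : nat).
Implicit Types (x y z e v p q : 'rV[R]_m) (r s t d L eps a C : R).
Variables (Omega : set 'rV[R]_m) (H : 'rV[R]_m -> 'rV[R]_m -> R).
Local Notation cl := (closure Omega).
Hypothesis cO : compact cl.
Hypothesis O0 : cl !=set0.
Hypothesis contH : {within [set xp : 'rV[R]_m * 'rV[R]_m | cl xp.1],
  continuous (fun xp => H xp.1 xp.2)}.
Hypothesis coerH : coercive Omega H.

Lemma H_cont x p : cl x -> forall eps, 0 < eps -> exists2 d, 0 < d &
  forall y q, cl y -> `|y - x| < d -> `|q - p| < d -> `|H y q - H x p| < eps.
Proof.
move=> clx eps eps0; have := contH; rewrite subspace_continuousP => /(_ (x, p) clx).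
move=> /cvgrPdist_lt /(_ eps eps0); rewrite near_withinE.
move=> [[U V] /= [/nbhs_rVP[r r0 hr] /nbhs_rVP[s s0 hs]] UV].
exists (Num.min r s) => [|y q cly]; first by rewrite lt_min r0.
rewrite !lt_min => /andP[/hr Uy _] /andP[_ /hs Vq].
by have := UV (y, q) (conj Uy Vq) cly; rewrite distrC.
Qed.

Lemma ballr_compact L : compact [set p : 'rV[R]_m | `|p| <= L].
Proof.
apply: bounded_closed_compact.
  by exists L; split; [exact: num_real|move=> x Lx p /= /le_trans; apply; exact: ltW].
move=> p /closureP_rV clp /=; apply/ler_addgt0Pr => eps eps0.
have [q /= qL qp] := clp eps eps0.
by rewrite -(subrK q p) (le_trans (ler_normD _ _))// distrC; lra.
Qed.

(** Only one of the two gradients is bounded by [K]: in a doubling of variables an estimate is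
    available for one of them, and the other is close to it. *)
Lemma H_unif_cont K eps : 0 < eps -> exists2 d, 0 < d &
  forall x y p q, cl x -> cl y -> `|p| <= K -> `|y - x| < d -> `|q - p| < d ->
    `|H y q - H x p| < eps.
Proof.
move=> eps0.
have /compact_near_coveringP cK := compact_setX cO (@ballr_compact K).
pose P (d : R) (xp : 'rV[R]_m * 'rV[R]_m) := cl xp.1 -> forall y q, cl y ->
  `|y - xp.1| < d -> `|q - xp.2| < d -> `|H y q - H xp.1 xp.2| < eps.
have : \forall d \near (0 : R)^'+, cl `*` [set p | `|p| <= K] `<=` P d.
  apply: cK => -[x p] [/= clx pK].
  have e2 : 0 < eps / 2 by rewrite divr_gt0.
  have [d d0 hd] := H_cont p clx e2; have d2 : 0 < d / 2 by rewrite divr_gt0.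
  exists ([set xp | `|xp.1 - x| < d / 2 /\ `|xp.2 - p| < d / 2], [set s | s <= d / 2]).
    split; last exact: nbhs_right_le.
    exists ([set x' | `|x' - x| < d / 2], [set p' | `|p' - p| < d / 2]) => //=.
    by split; apply/nbhs_rVP; exists (d / 2).
  move=> [[x' p'] s] /= [[xx' pp'] sd] clx' y q cly yx' qp'.
  have h1 := hd x' p' clx'; have h2 := hd y q cly.
  have : `|y - x| < d.
    rewrite -(subrK x' y) -addrA (le_lt_trans (ler_normD _ _))//; move: yx' => /=; lra.
  have : `|q - p| < d.
    rewrite -(subrK p' q) -addrA (le_lt_trans (ler_normD _ _))//; move: qp' => /=; lra.
  move=> qd yd; have := h2 yd qd; have : `|H x' p' - H x p| < eps / 2 by apply: h1; lra.
  by rewrite !ltr_norml; lra.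
move=> h; have hh : \forall d \near (0 : R)^'+,
   (cl `*` [set p | `|p| <= K] `<=` P d) /\ 0 < d.
  by near=> d; split; near: d => //; exact: nbhs_right_gt.
have [d [hd d0]] := @filter_ex _ ((0 : R)^'+) _ _ hh; exists d => // x y p q clx cly pK.
by move=> yx qp; exact: (hd (x, p)).
Unshelve. all: by end_near. Qed.

Lemma H_coercive a : exists2 L, 0 < L & forall x p, cl x -> H x p <= a -> `|p| <= L.
Proof.
have /cvgeyPgt /(_ a) := coerH.
move=> [L [_ hL]]; exists (Num.max 1 (L + 1)) => [|x p clx Hxp].
  by rewrite lt_max ltr01.
rewrite leNgt; apply/negP; rewrite gt_max => /andP[_ Lp].
have := hL (L + 1); rewrite ltrDl ltr01 => /(_ isT) hinf.
have : ((H x p)%:E <= a%:E)%E by rewrite lee_fin.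
rewrite leNgt => /negP; apply; apply: lt_le_trans hinf _.
apply: ereal_inf_lbound; exists (x, p) => //=; split => //.
(* Coercivity is stated with the Euclidean norm, which dominates the sup norm. *)
apply: (le_trans (ltW Lp)); rewrite /enorm -[X in X <= _]ger0_norm// -sqrtr_sqr.
by rewrite ler_wsqrtr// norm_dotp.
Qed.

Lemma H_max L : 0 <= L -> exists C, forall x p, cl x -> `|p| <= L -> H x p <= C.
Proof.
move=> L0; have [x0 clx0] := O0.
have [||[x p] _ h] := @usc_max R _ (cl `*` [set p | `|p| <= L]) (fun xp => H xp.1 xp.2)
  (compact_setX cO (@ballr_compact L)).
- by exists (x0, 0); split => //=; rewrite normr0.
- move=> [x p] [/= clx pL] t Ht; have t0 : 0 < t - H x p by rewrite subr_gt0.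
  have [d d0 hd] := H_cont p clx t0.
  exists ([set x' | `|x' - x| < d], [set p' | `|p' - p| < d]) => //=.
    by split; apply/nbhs_rVP; exists d.
  move=> [x' p'] /= [xx' pp'] [/= clx' p'L].
  by have := hd x' p' clx' xx' pp'; rewrite ltr_norml => /andP[_]; rewrite ltrD2r.
- by exists (H x p) => y q cly qL; exact: (h (y, q)).
Qed.

(** Where [H] is negative, coercivity confines the gradient to a ball, and compactness provides a
    minimum there. *)
Lemma H_min : exists C, forall x p, cl x -> C <= H x p.
Proof.
have [L L0 hL] := H_coercive 0; have [x0 clx0] := O0.
have [||[x p] _ h] := @usc_max R _ (cl `*` [set p | `|p| <= L]) (fun xp => - H xp.1 xp.2)
  (compact_setX cO (@ballr_compact L)).
- by exists (x0, 0); split => //=; rewrite normr0 ltW.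
- move=> [x p] [/= clx pL] t Ht; have t0 : 0 < t + H x p by lra.
  have [d d0 hd] := H_cont p clx t0.
  exists ([set x' | `|x' - x| < d], [set p' | `|p' - p| < d]) => //=.
    by split; apply/nbhs_rVP; exists d.
  move=> [x' p'] /= [xx' pp'] [/= clx' p'L].
  by have := hd x' p' clx' xx' pp'; rewrite ltr_norml => /andP[]; lra.
- exists (Num.min 0 (H x p)) => y q cly.
  rewrite ge_min; have [//|Hlt] := leP 0 (H y q).
  have := h (y, q); rewrite /= lerN2; apply; split => //=.
  by apply: hL (ltW Hlt).
Qed.

End Hamiltonian.

(** * Perron's method *)

Section ViscosityTests.
Variables (R : realType) (m : nat).
Implicit Types (x y z p q : 'rV[R]_m) (r s t d eps : R).
Implicit Types (u v w phi psi g : 'rV[R]_m -> R).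
Implicit Types (E G : 'rV[R]_m -> R -> 'rV[R]_m -> Prop).
Variable cl : set 'rV[R]_m.

(** [E] is the set of admissible triples of point, value and gradient. Interior and boundary
    conditions are merged in it, so stability and Perron's method are proved once for all boundary
    conditions. *)
Definition vsub E w := forall phi x, C1_closed cl phi -> cl x ->
  local_max cl (w \- phi) x -> E x (w x) (grad phi x).

Definition vsuper G w := forall phi x, C1_closed cl phi -> cl x ->
  local_min cl (w \- phi) x -> G x (w x) (grad phi x).

Lemma vsuper_opp G w : vsuper G w <->
  vsub (fun x r p => G x (- r) (- p)) (fun x => - w x).
Proof.
split=> h phi x C clx mx; have [CN gN] := C1_closedN C.
  rewrite opprK -gN//; apply: h => //.
  case/local_maxP : mx => r r0 hr; apply/local_minP; exists r => // y cly /(hr y cly) /=.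
  lra.
have := h _ x CN clx; rewrite gN// !opprK; apply.
case/local_minP : mx => r r0 hr; apply/local_maxP; exists r => // y cly /(hr y cly) /=.
lra.
Qed.

(* Penalizing by |x - x0|^2 makes the maximum strict, so that the functions
   approximating v have nearby maximum points. *)
Lemma vsub_stable E (Ee : R -> 'rV[R]_m -> R -> 'rV[R]_m -> Prop) v :
  compact cl -> cont_on cl v ->
  (forall x0 r0 p0, cl x0 -> ~ E x0 r0 p0 -> exists2 d, 0 < d &
     forall x r p eps, cl x -> `|x - x0| < d -> `|r - r0| < d -> `|p - p0| < d ->
       0 < eps -> eps < d -> ~ Ee eps x r p) ->
  (forall x0 eps, cl x0 -> 0 < eps -> exists w, [/\ usc_on cl w,
     (forall x, cl x -> w x <= v x + eps), v x0 - eps <= w x0 & vsub (Ee eps) w]) ->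
  vsub E v.
Proof.
move=> cK vc HE Hw phi x0 C clx0 mx; apply: contrapT => nE.
have [d d0 hd] := HE _ _ _ clx0 nE.
case/local_maxP : mx => r r0 hr.
have d20 : 0 < d / 4 by rewrite divr_gt0.
have [r1 r10 h1] := vc x0 clx0 _ d20.
have [r2 r20 h2] := C1_closed_gradcont C clx0 d20.
have [r3 r30 h3] := C1_closed_cont C clx0 d20.
pose rho := Num.min (Num.min r r1) (Num.min (Num.min r2 r3) (d / 8)) / 2.
have mn0 : 0 < Num.min (Num.min r r1) (Num.min (Num.min r2 r3) (d / 8)).
  by rewrite !lt_min r0 r10 r20 r30 divr_gt0.
have rho0 : 0 < rho by rewrite divr_gt0.
have : rho < Num.min (Num.min r r1) (Num.min (Num.min r2 r3) (d / 8)).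
  by rewrite /rho; move: mn0; lra.
rewrite !lt_min => /andP[/andP[pr pr1] /andP[/andP[pr2 pr3] prd]].
have rr0 : 0 < rho ^+ 2 by rewrite exprn_gt0.
(* The perturbed maximum point satisfies [|x1 - x0|^2 <= 2 eps], which is less than [rho^2]; it is
   therefore interior to the ball. *)
pose eps := Num.min (rho ^+ 2 / 4) (d / 8).
have eps0 : 0 < eps by rewrite lt_min !divr_gt0.
have : eps <= Num.min (rho ^+ 2 / 4) (d / 8) by [].
rewrite le_min => /andP[epsr epsd].
have [w [uw wv wx0 sw]] := Hw x0 eps clx0 eps0.
pose q1 := quad (1 : R)%:M 0 x0 0.
have [Cq gq] := quad_C1 cl (1 : R)%:M 0 x0 0.
have [Cs gs] := C1_closed_lin 1 1 C Cq.
pose phi1 x := 1 * phi x + 1 * q1 x.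
have q1E x : q1 x = dotp (x - x0) (x - x0).
  by rewrite /q1 quad_diag dotp0l !addr0 mul1r.
pose K := cl `&` [set x | `|x - x0| <= rho].
have cKr : compact K by exact: compact_setI_ballr.
have K0 : K !=set0 by exists x0; split => //=; rewrite subrr normr0 ltW.
have [x1 [clx1 x1r] hx1] : exists2 x1, K x1 & forall y, K y -> (w \- phi1) y <= (w \- phi1) x1.
  apply: usc_max_rV => //; apply: usc_onB; first by apply: usc_subset uw _ => x [].
  by apply: cont_on_subset (C1_closed_cont Cs) _ => x [].
have x0K : K x0 by split => //=; rewrite subrr normr0 ltW.
have := hx1 x0 x0K; rewrite /= /phi1 !q1E subrr dotp0l !mul1r addr0 => h01.
have wx1 := wv x1 clx1.
have := hr x1 clx1 (le_lt_trans x1r pr) => /= v01.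
have nd := norm_dotp (x1 - x0).
have x1rho : `|x1 - x0| < rho.
  have h : `|x1 - x0| ^+ 2 < rho ^+ 2 by lra.
  by rewrite ltr_pXn2r// ?nnegrE ?normr_ge0 ?(ltW rho0) in h.
have mx1 : local_max cl (w \- phi1) x1.
  apply/local_maxP; exists (rho - `|x1 - x0|) => [|y cly yx1]; first by rewrite subr_gt0.
  apply: hx1; split => //=.
  by rewrite -(subrK x1 y) -addrA (le_trans (ler_normD _ _))//; lra.
have sE := sw _ _ Cs clx1 mx1.
have a1 := h1 x1 clx1 (lt_trans x1rho pr1).
have a2 := h2 x1 clx1 (lt_trans x1rho pr2).
have a3 := h3 x1 clx1 (lt_trans x1rho pr3).
apply: hd sE => //.
- by lra.
- move: a1 a3; rewrite !ltr_norml => /andP[b1 b2] /andP[b3 b4].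
  have := sqr_ge0 `|x1 - x0|; move: nd wx1 h01 => *; apply/andP; split; lra.
- rewrite gs// gq !scale1r addr0 tr_scalar_mx -raddfD mul_mx_scalar.
  rewrite addrAC (le_lt_trans (ler_normD _ _))// normrZ [`|1 + 1|]ger0_norm//; lra.
- by lra.
Qed.

Section Perron.
Variables (E G : 'rV[R]_m -> R -> 'rV[R]_m -> Prop) (T : set 'rV[R]_m).
Variables (g w0 : 'rV[R]_m -> R).
Hypothesis cK : compact cl.

(** Members are continuous, and [equi] passes this on to their supremum. The ceiling [g] on [T] is
    for the Dirichlet problem; [T] is empty in the discounted one. *)
Definition perron_class w := [/\ cont_on cl w, vsub E w,
  (forall x, cl x -> w0 x <= w x) & (forall x, cl x -> T x -> w x <= g x)].

Hypothesis closedE : forall x0 r0 p0, cl x0 -> ~ E x0 r0 p0 -> exists2 d, 0 < d &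
  forall x r p, cl x -> `|x - x0| < d -> `|r - r0| < d -> `|p - p0| < d -> ~ E x r p.
Hypothesis bump : forall phi x0 r0, C1_closed cl phi -> cl x0 ->
  ~ G x0 r0 (grad phi x0) -> (T x0 -> r0 <= g x0) -> exists2 d, 0 < d &
    forall x r, cl x -> `|x - x0| < d -> `|r - r0| < d ->
    (T x -> r <= g x) /\
    forall psi, C1_closed cl psi -> local_max cl (phi \- psi) x -> E x r (grad psi x).
Hypothesis w0S : perron_class w0.
Hypothesis equi : forall x, cl x -> forall eps, 0 < eps -> exists2 d, 0 < d &
  forall w, perron_class w -> forall y, cl y -> `|y - x| < d -> `|w y - w x| <= eps.
Hypothesis bnd : forall x, cl x -> exists M, forall w, perron_class w -> w x <= M.

Local Ltac slra := repeat match goal with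
  | h : is_true _ |- _ => revert h | h : _ = _ |- _ => revert h end;
  clear - cK closedE bump w0S equi bnd; intros; lra.

(** If the supremum [v] failed the supersolution condition at [x0], replacing it near [x0] by the
    larger of [v] and a slightly raised, bent-down copy of the test function would give a member of
    the class exceeding [v] at [x0]. *)
Lemma perron : exists v, perron_class v /\ vsuper G v.
Proof.
pose v x := sup [set w x | w in perron_class].
have sv x : cl x -> has_sup [set w x | w in perron_class].
  move=> clx; split; first by exists (w0 x); exists w0.
  by have [M hM] := bnd clx; exists M => _ [w wS <-]; exact: hM.
have wv w x : perron_class w -> cl x -> w x <= v x.
  by move=> wS clx; apply: ub_le_sup; [exact: (sv x clx).2|exists w].
have vw x eps : cl x -> 0 < eps -> exists2 w, perron_class w & v x - eps < w x.
  move=> clx eps0; have [_ [w wS <-] h] := sup_adherent eps0 (sv x clx).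
  by exists w.
have vub x M : cl x -> (forall w, perron_class w -> w x <= M) -> v x <= M.
  move=> clx h; apply: ge_sup; first by exists (w0 x); exists w0.
  by move=> _ [w wS <-]; exact: h.
have vc : cont_on cl v.
  move=> x clx eps eps0; have e4 : 0 < eps / 4 by rewrite divr_gt0.
  have [d d0 hd] := equi clx e4; exists d => // y cly yx.
  have h1 : v y <= v x + eps / 4.
    apply: vub => // w wS; have := hd w wS y cly yx; have := wv w x wS clx.
    by rewrite ler_norml; slra.
  have h2 : v x <= v y + eps / 4.
    apply: vub => // w wS; have := hd w wS y cly yx; have := wv w y wS cly.
    by rewrite ler_norml; slra.
  by rewrite ltr_norml; apply/andP; split; slra.
have vE : vsub E v.
  apply: (@vsub_stable E (fun _ => E)) => // [x0 r0 p0 clx0 nE|x0 eps clx0 eps0].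
    by have [d d0 hd] := closedE clx0 nE; exists d => // x r p eps *; exact: hd.
  have [w wS hw] := vw x0 eps clx0 eps0; exists w; have [wc wE _ _] := wS.
  split => //; first exact: cont_usc.
    by move=> x clx; have := wv w x wS clx; slra.
  exact: ltW.
have vw0 x : cl x -> w0 x <= v x by exact: wv.
have vT x : cl x -> T x -> v x <= g x.
  by move=> clx Tx; apply: vub => // w [_ _ _]; apply.
exists v; split; first by split.
move=> phi x0 C clx0 mn; apply: contrapT => nG.
case/local_minP : mn => rho rho0 hrho.
pose q1 := quad (-1 : R)%:M 0 x0 0.
have [Cq gq] := quad_C1 cl (-1 : R)%:M 0 x0 0.
have [Cs gs] := C1_closed_lin 1 1 C Cq.
pose phi1 x := 1 * phi x + 1 * q1 x.
have q1E x : q1 x = - dotp (x - x0) (x - x0).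
  by rewrite /q1 quad_diag dotp0l !addr0 mulN1r.
have g1 : grad phi1 x0 = grad phi x0.
  by rewrite gs// gq subrr mul0mx !scale1r !addr0.
have nG1 : ~ G x0 (v x0) (grad phi1 x0) by rewrite g1.
have [d d0 hd] := bump Cs clx0 nG1 (vT x0 clx0).
have d2 : 0 < d / 2 by rewrite divr_gt0.
have [r3 r30 h3] := C1_closed_cont Cs clx0 d2.
pose r1 := Num.min (Num.min rho r3) d.
have r10 : 0 < r1 by rewrite !lt_min rho0 r30.
have : r1 <= Num.min (Num.min rho r3) d by [].
rewrite !le_min => /andP[/andP[r1rho r1r3] r1d].
(* The second bound puts the raised copy below [v] from distance [r1 / 2] on, so that the two pieces
   glue continuously; the first keeps its values in the range where [bump] applies. *)
pose k := Num.min (d / 4) (r1 ^+ 2 / 8).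
have k0 : 0 < k by rewrite lt_min !divr_gt0// exprn_gt0.
have : k <= Num.min (d / 4) (r1 ^+ 2 / 8) by [].
rewrite le_min => /andP[kd kr].
pose c := v x0 - phi1 x0 + k.
have phi1x0 : phi1 x0 = phi x0.
  by rewrite /phi1 q1E subrr dotp0l oppr0 !mul1r addr0.
have below x : cl x -> `|x - x0| < r1 -> phi1 x + c <= v x + k - `|x - x0| ^+ 2.
  move=> clx xr; have := hrho x clx (lt_le_trans xr r1rho) => /=.
  have := norm_dotp (x - x0); rewrite /c phi1x0 /phi1 q1E !mul1r; slra.
pose W x := if `|x - x0| < r1 then Num.max (v x) (phi1 x + c) else v x.
have vW x : v x <= W x by rewrite /W; case: ifP => // _; rewrite le_max lexx.
have Wfar x : cl x -> r1 / 2 <= `|x - x0| -> W x = v x.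
  move=> clx xr; rewrite /W; case: ifP => // xr1; apply: max_l.
  have := below x clx xr1.
  have : (r1 / 2) ^+ 2 <= `|x - x0| ^+ 2.
    by rewrite lerXn2r ?nnegrE ?normr_ge0//; slra.
  by rewrite expr_div_n; move: kr; slra.
have Wc : cont_on cl W.
  move=> x clx eps eps0.
  have [d1 d10 hd1] := vc x clx eps eps0.
  have [d3 d30 hd3] := C1_closed_cont Cs clx eps0.
  have [xr|xr] := ltP `|x - x0| r1.
    exists (Num.min (r1 - `|x - x0|) (Num.min d1 d3)) => [|y cly].
      by rewrite !lt_min subr_gt0 xr d10.
    rewrite !lt_min => /and3P[yx /(hd1 y cly) {}hd1 /(hd3 y cly) {}hd3].
    have yr : `|y - x0| < r1.
      by rewrite -(subrK x y) -addrA (le_lt_trans (ler_normD _ _))//; slra.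
    rewrite /W xr yr; move: hd1 hd3; rewrite -!/(phi1 _) !ltr_norml.
    by case: (leP (v y)); case: (leP (v x)) => ? ? /andP[? ?] /andP[? ?];
       apply/andP; split; slra.
  exists (Num.min (r1 / 2) d1) => [|y cly]; first by rewrite lt_min d10 divr_gt0.
  rewrite lt_min => /andP[yx /(hd1 y cly)].
  rewrite !Wfar//; first by apply: le_trans xr; slra.
  have := ler_distD y x x0; rewrite (distrC x y); slra.
have WS : perron_class W.
  split=> //; last first.
  - move=> x clx Tx; rewrite /W; case: ifP => xr; last exact: vT.
    rewrite ge_max vT//=; have [|hlt] := leP (phi1 x + c) (v x).
      by move=> /le_trans; apply; exact: vT.
    have bx := below x clx xr; apply: (hd x _ clx _ _).1 => //.
      exact: lt_le_trans xr r1d.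
    have := h3 x clx (lt_le_trans xr r1r3); rewrite -!/(phi1 _) /c !ltr_norml => /andP[? ?].
    by apply/andP; split; slra.
  - by move=> x clx; apply: (le_trans (vw0 x clx)).
  move=> psi x Cpsi clx /local_maxP[r r0 hr].
  have [Wv|Wv] := eqVneq (W x) (v x).
    rewrite Wv; apply: vE => //; apply/local_maxP; exists r => // y cly /(hr y cly) /=.
    by have := vW y; rewrite -Wv; slra.
  have xr : `|x - x0| < r1 by move: Wv; rewrite /W; case: ifP => //; rewrite eqxx.
  have WE : W x = phi1 x + c.
    by move: Wv; rewrite /W xr; case: (leP (v x)) => //; rewrite eqxx.
  apply: (hd x _ clx _ _).2 => //.
  - exact: lt_le_trans xr r1d.
  - have := h3 x clx (lt_le_trans xr r1r3); rewrite WE -!/(phi1 _) /c !ltr_norml => /andP[? ?].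
    by apply/andP; split; slra.
  apply/local_maxP; exists (Num.min r (r1 - `|x - x0|)) => [|y cly].
    by rewrite lt_min r0 subr_gt0.
  rewrite lt_min => /andP[/(hr y cly) /= h yx].
  have yr : `|y - x0| < r1.
    by rewrite -(subrK x y) -addrA (le_lt_trans (ler_normD _ _))//; slra.
  have : phi1 y + c <= W y by rewrite /W yr le_max lexx orbT.
  by move: h; rewrite WE -!/(phi1 _); slra.
have := wv W x0 WS clx0; rewrite /W subrr normr0 r10 ge_max => /andP[_].
by rewrite /c; lra.
Qed.

End Perron.
End ViscosityTests.

(** * Comparison principles *)

Section ComparisonInside.
Variables (R : realType) (m : nat).
Implicit Types (x y z e p q : 'rV[R]_m) (r s t d eps a b : R).
Variables (Omega : set 'rV[R]_m) (H : 'rV[R]_m -> 'rV[R]_m -> R).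
Local Notation cl := (closure Omega).
Hypothesis oO : open Omega.
Hypothesis cO : compact cl.
Hypothesis O0 : cl !=set0.
Hypothesis contH : {within [set xp : 'rV[R]_m * 'rV[R]_m | cl xp.1],
  continuous (fun xp => H xp.1 xp.2)}.
Hypothesis coerH : coercive Omega H.

Lemma unif_cont_on (A : set 'rV[R]_m) (f : 'rV[R]_m -> R) eps :
  compact A -> cont_on A f -> 0 < eps ->
  exists2 d, 0 < d & forall x y, A x -> A y -> `|y - x| < d -> `|f y - f x| < eps.
Proof.
move=> /compact_near_coveringP cA fc eps0.
pose P (d : R) x := A x -> forall y, A y -> `|y - x| < d -> `|f y - f x| < eps.
have h : \forall d \near (0 : R)^'+, A `<=` P d.
  apply: cA => x Ax; have e2 : 0 < eps / 2 by rewrite divr_gt0.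
  have [d d0 hd] := fc x Ax _ e2; have d2 : 0 < d / 2 by rewrite divr_gt0.
  exists ([set x' | `|x' - x| < d / 2], [set s | s <= d / 2]).
    by split; [apply/nbhs_rVP; exists (d / 2)|exact: nbhs_right_le].
  move=> [x' s] /= [xx' sd] Ax' y Ay yx'.
  have h2 := hd y Ay; have : `|f x' - f x| < eps / 2 by apply: hd => //; move: xx'; lra.
  have : `|y - x| < d.
    rewrite -(subrK x' y) -addrA (le_lt_trans (ler_normD _ _))//; move: yx' => /=; lra.
  by move=> /h2; rewrite !ltr_norml; lra.
have hh : \forall d \near (0 : R)^'+, (A `<=` P d) /\ 0 < d.
  by near=> d; split; near: d => //; exact: nbhs_right_gt.
have [d [hd d0]] := @filter_ex _ ((0 : R)^'+) _ _ hh; exists d => // x y Ax.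
exact: hd.
Unshelve. all: by end_near. Qed.

Local Ltac slra := repeat match goal with
  | h : is_true _ |- _ => revert h | h : _ = _ |- _ => revert h end;
  clear - oO cO O0 contH coerH; intros; lra.

(* Soner's argument: the penalization centres x around y + s e, which pushes the
   maximum point of the subsolution into Omega. *)
Lemma comparison_shift (u w : 'rV[R]_m -> R) a a' z e r :
  cont_on cl u -> lsc_on cl w -> cl z -> inner_shift Omega z e r ->
  (forall phi x, C1_closed cl phi -> Omega x -> local_max cl (u \- phi) x ->
     H x (grad phi x) <= a') ->
  (forall phi y, C1_closed cl phi -> cl y -> `|y - z| < r ->
     local_min cl (w \- phi) y -> a <= H y (grad phi y)) ->
  (forall x, cl x -> u x - w x <= u z - w z) ->
  a <= a'.
Proof.
move=> uc wl clz [r0 hr] usub wsup zmax; rewrite leNgt; apply/negP => a'a.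
have aa0 : 0 < a - a' by rewrite subr_gt0.
have [L L0 hL] := H_coercive coerH a'.
have [dH dH0 hdH] := @H_unif_cont _ _ Omega H cO contH L _ aa0.
(* On the ball of radius [r / 2] the localizing term then changes the gradient by at most
   [dH / 4]. *)
pose al := dH / (4 * r).
have al0 : 0 < al by rewrite divr_gt0// mulr_gt0.
have al20 : 0 <= 2 * al by rewrite mulr_ge0// ltW.
have alE : 2 * al * (r / 2) = dH / 4 by rewrite /al; field; rewrite gt_eqF.
clearbody al.
(* This is an eighth of [al (r / 2)^2], so errors of a few [eta] cannot push [y] to the edge of the
   localizing ball. *)
pose eta := al * r ^+ 2 / 32.
have r20 : 0 < r ^+ 2 by rewrite exprn_gt0.
have eta0 : 0 < eta by rewrite divr_gt0// mulr_gt0.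
have etaE : eta = al * r ^+ 2 / 32 by [].
clearbody eta.
have [d1 d10 hd1] := unif_cont_on cO uc eta0.
have E0 : 0 < `|e| + 1 by rewrite ltr_wpDl.
pose s := Num.min r (Num.min d1 dH / (2 * (`|e| + 1))) / 2.
have mn0 : 0 < Num.min r (Num.min d1 dH / (2 * (`|e| + 1))).
  by rewrite lt_min r0 divr_gt0 ?lt_min ?d10// mulr_gt0.
have s0 : 0 < s by rewrite divr_gt0.
have : s < Num.min r (Num.min d1 dH / (2 * (`|e| + 1))) by rewrite /s; slra.
rewrite lt_min ltr_pdivlMr ?mulr_gt0// lt_min => /andP[sr /andP[sd1 sdH]].
have se : s * `|e| <= s * (`|e| + 1) by rewrite ler_wpM2l ?(ltW s0)// lerDl.
clearbody s; clear mn0.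
pose B := cl `&` [set y | `|y - z| <= r / 2].
have cB : compact B by exact: compact_setI_ballr.
have zB : B z by split => //=; rewrite subrr normr0 divr_ge0// ltW.
have Br y : B y -> Omega (y + s *: e).
  by move=> [cly /= yz]; apply: hr => //; move: yz; slra.
have [rho rho0 hrho] : exists2 rho, 0 < rho & forall y, B y ->
    forall x, `|x - (y + s *: e)| < rho -> Omega x.
  have cBs : compact [set y + s *: e | y in B].
    apply: continuous_compact cB; apply/within_contP => y _ eps eps0.
    by exists eps => // y' _; rewrite opprD addrACA subrr addr0.
  have [|rho rho0 hrho] := compact_tube oO cBs; first by move=> _ [y By <-]; exact: Br.
  by exists rho => // y By x; apply: hrho; exists y.
have [xu clxu hxu] := usc_max_rV cO O0 (cont_usc uc).
have [xw clxw hxw] := usc_max_rV cO O0 ((lsc_usc_opp _ _).1 wl).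
pose C0 := u xu - w xw - (u z - w z) + eta.
have C00 : 0 <= C0.
  by have := hxu z clz; have := hxw z clz; rewrite /C0; move: eta0; slra.
have C0E : C0 = u xu - w xw - (u z - w z) + eta by [].
clearbody C0.
pose tau := Num.min rho (Num.min d1 dH) / 2.
have tau0 : 0 < tau by rewrite divr_gt0// !lt_min rho0 d10.
have [trho td1 tdH] : [/\ tau <= rho / 2, tau <= d1 / 2 & tau <= dH / 2].
  have h : Num.min rho (Num.min d1 dH) <= Num.min rho (Num.min d1 dH) by [].
  move: h; rewrite !le_min => /and3P[h1 h2 h3].
  by split; rewrite ler_pM2r.
clearbody tau.
have tau20 : 0 < tau ^+ 2 by rewrite exprn_gt0.
(* At the maximum [b |x - y - s e|^2 <= C0 < b tau^2], which puts [x] within [tau] of [y + s e] and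
   hence in Omega. *)
pose b := C0 / tau ^+ 2 + 1.
have b0 : 0 < b by rewrite ltr_wpDl// divr_ge0// ltW.
have bE : b * tau ^+ 2 = C0 + tau ^+ 2 by rewrite /b mulrDl mul1r divfK ?gt_eqF.
clearbody b.
have [||x [y [clx By mx]]] := @pair_max _ _ cl B u w (quad b%:M 0 (s *: e) 0)
   (quad 0 0 0 0) (quad al%:M 0 z 0) cO cB O0 _ (cont_usc uc) _
   (@quad_cont _ _ _ _ _ _) (@quad_cont _ _ _ _ _ _) (@quad_cont _ _ _ _ _ _).
- by exists z.
- apply/lsc_onP => x [clx _] t tw.
  have [r1 r10 hr1] := (lsc_onP _ _).1 wl x clx t tw.
  by exists r1 => // y [cly _]; exact: hr1.
have qz x' : quad (0 : 'M[R]_m) 0 0 0 x' = 0.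
  by rewrite /quad mulmx0 !dotp0l !addr0.
have {}mx x' y' : cl x' -> B y' ->
   u x' - w y' - b * dotp (x' - y' - s *: e) (x' - y' - s *: e)
     - al * dotp (y' - z) (y' - z) <=
   u x - w y - b * dotp (x - y - s *: e) (x - y - s *: e)
     - al * dotp (y - z) (y - z).
  move=> clx' By'; have := mx x' y' clx' By'.
  by rewrite !qz !quad_diag !dotp0l !addr0 !subr0.
have [cly yr] := By; rewrite /= in yr.
have Oz := Br z zB.
(* At the competing pair [(z + s e, z)] both penalizations vanish. *)
have h1 := mx (z + s *: e) z (subset_closure Oz) zB.
have zs : z + s *: e - z - s *: e = 0 by vring.
rewrite zs subrr !dotp0l !mulr0 !subr0 in h1.
have h2 : u z - eta <= u (z + s *: e).
  have := hd1 z (z + s *: e) clz (subset_closure Oz).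
  rewrite addrAC subrr add0r normrZ gtr0_norm// => h.
  by have : `|u (z + s *: e) - u z| < eta by [apply: h; slra]; rewrite ltr_norml; slra.
have nx := norm_dotp (x - y - s *: e); have ny := norm_dotp (y - z).
have bnx := ler_wpM2l (ltW b0) nx; have any := ler_wpM2l (ltW al0) ny.
have alny : 0 <= al * `|y - z| ^+ 2 by rewrite mulr_ge0 ?(ltW al0)// sqr_ge0.
have bny : 0 <= b * `|x - y - s *: e| ^+ 2 by rewrite mulr_ge0 ?(ltW b0)// sqr_ge0.
have ux := hxu x clx; have wy := hxw y cly.
have xtau : `|x - y - s *: e| < tau.
  have h : b * `|x - y - s *: e| ^+ 2 < b * tau ^+ 2.
    rewrite bE C0E; slra.
  by rewrite ltr_pM2l// ltr_pXn2r ?nnegrE ?normr_ge0 ?(ltW tau0)// in h.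
have Ox : Omega x by apply: (hrho y) => //; rewrite opprD addrA; slra.
have xy : `|x - y| <= `|x - y - s *: e| + s * `|e|.
  by rewrite -{1}(subrK (s *: e) (x - y)) (le_trans (ler_normD _ _))// normrZ (gtr0_norm s0).
have uxy : u x <= u y + eta.
  have : `|u x - u y| < eta by apply: hd1 => //; slra.
  by rewrite ltr_norml; slra.
have yz : `|y - z| < r / 2.
  have zy := zmax y cly.
  have h : al * `|y - z| ^+ 2 < al * (r / 2) ^+ 2.
    by rewrite expr_div_n; move: h1 h2 uxy zy bny alny bnx any eta0 etaE; slra.
  by rewrite ltr_pM2l// ltr_pXn2r ?nnegrE ?normr_ge0// ?divr_ge0// ?(ltW r0)// in h.
pose p := (2 * b) *: (x - y - s *: e).
have Hx : H x p <= a'.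
  have [C g] := quad_C1 cl b%:M 0 (y + s *: e) 0.
  have -> : p = grad (quad b%:M 0 (y + s *: e) 0) x.
    by rewrite quad_diag_grad addr0 opprD addrA.
  apply: usub => //; apply/local_maxP; exists 1 => // x' clx' _ /=.
  have := mx x' y clx' By; rewrite !quad_diag !dotp0l !addr0 !opprD !addrA; slra.
have pL := hL x p clx Hx.
have Hy : a <= H y (p - (2 * al) *: (y - z)).
  have [C1 g1] := quad_C1 cl b%:M 0 (x - s *: e) 0.
  have [C2 g2] := quad_C1 cl al%:M 0 z 0.
  have [C g] := C1_closed_lin (-1) (-1) C1 C2.
  have -> : p - (2 * al) *: (y - z) =
    grad (fun y => -1 * quad b%:M 0 (x - s *: e) 0 y + -1 * quad al%:M 0 z 0 y) y.
    by rewrite g// !quad_diag_grad !addr0 /p; vring.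
  apply: wsup => //; first by move: yz; slra.
  apply/local_minP; exists (r / 2 - `|y - z|) => [|y' cly' yy'].
    by rewrite subr_gt0.
  have By' : B y'.
    split => //=; rewrite -(subrK y y') -addrA (le_trans (ler_normD _ _))//.
    by move: yy'; slra.
  have sw v : dotp (v - (x - s *: e)) (v - (x - s *: e)) = dotp (x - v - s *: e) (x - v - s *: e).
    by have -> : v - (x - s *: e) = - (x - v - s *: e) by [vring]; rewrite dotpNl dotpNr opprK.
  have := mx x y' clx By'; rewrite /= !quad_diag !dotp0l !addr0 !sw; slra.
have := hdH x y p (p - (2 * al) *: (y - z)) clx cly pL.
rewrite distrC addrAC subrr add0r normrN normrZ ger0_norm//.
have q4 : 2 * al * `|y - z| < dH.
  apply: (@le_lt_trans _ _ (2 * al * (r / 2))).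
    by rewrite ler_wpM2l ?(ltW yz).
  by rewrite alE; move: dH0; slra.
have xy' : `|x - y| < dH by slra.
by move=> /(_ xy' q4); rewrite ltr_norml; move: Hx Hy; slra.
Qed.

End ComparisonInside.

(** * Cones at boundary points and the oblique quadratic form *)

Section ObliqueGeometry.
Variables (R : realType) (m : nat).
Implicit Types (x y z e p q v nrm gam : 'rV[R]_m) (r s t d eps a b k L C : R).
Variable Omega : set 'rV[R]_m.
Local Notation cl := (closure Omega).
Local Notation N := (m%:R : R).

(* Near z, Omega contains the cones with axis - nrm based at points of its closure,
   and their aperture is as close to a half-space as one wishes. *)
Definition inner_cone z nrm := forall k, 0 < k -> exists2 r, 0 < r &
  forall x y, cl x -> `|x - z| < r -> `|y - z| < r ->
    dotp nrm (y - x) < - (k * `|y - x|) -> Omega y.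

(** The added half is the contrapositive, based at a point outside Omega. It supplies the signs at
    boundary maximum points. *)
Lemma inner_coneN z nrm : inner_cone z nrm -> forall k, 0 < k -> exists2 r, 0 < r &
  (forall x y, cl x -> `|x - z| < r -> `|y - z| < r ->
    dotp nrm (y - x) < - (k * `|y - x|) -> Omega y) /\
  (forall x y, ~ Omega x -> cl y -> `|x - z| < r -> `|y - z| < r ->
    dotp nrm (y - x) <= k * `|y - x|).
Proof.
move=> h k k0; have [r r0 hr] := h k k0; exists r => //; split => // x y nOx cly xz yz.
rewrite leNgt; apply/negP => lt; apply: nOx; apply: (hr y x) => //.
by rewrite -opprB dotpNr normrN ltrN2.
Qed.

(** The vector [- v] lies strictly inside a cone of sufficiently wide aperture. With [v = gamma z]
    this makes [- gamma z] an inner direction. *)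
Lemma inner_cone_shift z nrm v : inner_cone z nrm -> 0 < dotp nrm v ->
  exists2 r, 0 < r & inner_shift Omega z (- v) r.
Proof.
move=> cz v0; have V0 : 0 < `|v| + 1 by rewrite ltr_wpDl.
have k0 : 0 < dotp nrm v / (`|v| + 1) by rewrite divr_gt0.
have [r r0 hr] := cz _ k0.
have V1 : 0 < `|v| + 2 by rewrite ltr_wpDl.
exists (r / (`|v| + 2)); first by rewrite divr_gt0.
split=> [|x clx]; first by rewrite divr_gt0.
rewrite ltr_pdivlMr// => xr s s0; rewrite ltr_pdivlMr// => sr.
have nv : 0 <= `|v| by rewrite normr_ge0.
have xr' : `|x - z| * 2 <= `|x - z| * (`|v| + 2) by rewrite ler_wpM2l// lerDr.
have nx : 0 <= `|x - z| by rewrite normr_ge0.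
apply: (hr x) => //; first by lra.
  have -> : x + s *: - v - z = (x - z) - s *: v by vring.
  rewrite (le_lt_trans (ler_normB _ _))// normrZ gtr0_norm//.
  have : s * `|v| + s * 2 < r by rewrite -mulrDr.
  have [h|h] := leP `|x - z| s; first by lra.
  have : s * `|v| <= `|x - z| * `|v| by rewrite ler_wpM2r// ltW.
  move: xr; rewrite mulrDr; lra.
have -> : x + s *: - v - x = - (s *: v) by vring.
rewrite dotpNr dotpZr normrN normrZ (gtr0_norm s0) ltrN2.
rewrite mulrCA ltr_pM2l// -mulrA -[X in _ < X]mulr1 ltr_pM2l// mulrC ltr_pdivrMr//.
by rewrite mul1r ltrDl.
Qed.

(** Both points are shifted by a multiple of their distance; the segment between the shifted points
    then lies in the cone at [y]. The shift being proportional to [|x - y|], equicontinuity improves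
    to a Lipschitz bound up to the boundary. *)
Lemma inner_cone_lip z nrm v L (u : 'rV[R]_m -> R) : 0 <= L ->
  inner_cone z nrm -> 0 < dotp nrm v -> segLip Omega L u -> cont_on cl u ->
  exists r C, [/\ 0 < r, 0 <= C & forall x y, cl x -> cl y -> `|x - z| < r ->
    `|y - z| < r -> `|u x - u y| <= C * `|x - y|].
Proof.
move=> L0 cz v0 uL uc; have [r1 r10 sh] := inner_cone_shift cz v0.
have V0 : 0 < `|v| + 1 by rewrite ltr_wpDl.
pose k := dotp nrm v / (2 * (`|v| + 1)).
have k0 : 0 < k by rewrite divr_gt0// mulr_gt0.
have kv : k * `|v| <= dotp nrm v / 2.
  rewrite /k invfM mulrA -mulrA ler_piMr ?divr_ge0 ?(ltW v0)//.
  by rewrite mulrC ler_pdivrMr// mul1r lerDl.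
have [r2 r20 hr2] := cz k k0.
(* Half of the decrease [s * dotp nrm v] pays for the aperture term of the shift; the other half, by
   this choice of [K], for all terms proportional to [|x - y|]. *)
pose K := 2 * (N * `|nrm| + k + 1) / dotp nrm v.
have K0 : 0 < K by rewrite divr_gt0// mulr_gt0// ltr_wpDl// addr_ge0 ?(ltW k0)// mulr_ge0.
have KE : K * (dotp nrm v / 2) = N * `|nrm| + k + 1.
  by rewrite /K; field; rewrite gt_eqF.
clearbody K.
have K1 : 0 < K + 1 by rewrite ltr_wpDl// ltW.
pose r := Num.min r1 r2 / (4 * (K + 1) * (`|v| + 1)).
have mn0 : 0 < Num.min r1 r2 by rewrite lt_min r10.
have r0 : 0 < r by rewrite divr_gt0// !mulr_gt0.
have rE : r * (4 * (K + 1) * (`|v| + 1)) = Num.min r1 r2.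
  by rewrite /r divfK// gt_eqF// !mulr_gt0.
clearbody r.
have rmin : 4 * r * (K * `|v| + K + `|v| + 1) <= Num.min r1 r2.
  by rewrite -rE le_eqVlt; apply/orP; left; apply/eqP; ring.
have nv : 0 <= `|v| by rewrite normr_ge0.
have rKv : 0 <= r * (K * `|v|) by rewrite !mulr_ge0 ?(ltW r0) ?(ltW K0).
have rK : 0 < r * K by rewrite mulr_gt0.
have rv : 0 <= r * `|v| by rewrite mulr_ge0 ?(ltW r0).
move: rmin; rewrite le_min !mulrDr => /andP[rm1 rm2].
exists r, (2 * L * (K * `|v|) + L); split => //.
  by rewrite addr_ge0// !mulr_ge0// ltW.
move=> x y clx cly xr yr.
have [->|xy] := eqVneq x y; first by rewrite !subrr !normr0 mulr0.
have d0 : 0 < `|x - y| by rewrite normr_gt0 subr_eq0.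
have d2 : `|x - y| < 2 * r.
  have -> : x - y = (x - z) - (y - z) by vring.
  rewrite (le_lt_trans (ler_normB _ _))//; lra.
set D := `|x - y| in d0 d2 *.
pose s := K * D.
have s0 : 0 < s by rewrite mulr_gt0.
have sr : s < 2 * (r * K).
  by rewrite /s [r * K]mulrC mulrCA ltr_pM2l.
have svr : s * `|v| <= 2 * (r * (K * `|v|)).
  have -> : 2 * (r * (K * `|v|)) = (2 * (r * K)) * `|v| by ring.
  by rewrite ler_wpM2r// ltW.
have s_def : s = K * D by [].
clearbody s.
have inO t : 0 <= t -> t <= 1 -> Omega (y + s *: - v + t *: (x + s *: - v - (y + s *: - v))).
  move=> t0 t1.
  have -> : y + s *: - v + t *: (x + s *: - v - (y + s *: - v)) =
    y + (t *: (x - y) - s *: v) by vring.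
  have tD : t * D <= D by rewrite ler_piMl// ltW.
  have tD0 : 0 <= t * D by rewrite mulr_ge0// ltW.
  have nw : `|t *: (x - y) - s *: v| <= D + s * `|v|.
    by rewrite (le_trans (ler_normB _ _))// !normrZ (ger0_norm t0) (gtr0_norm s0) -/D lerD2r.
  apply: (hr2 y) => //; first by lra.
    rewrite addrAC (le_lt_trans (ler_normD _ _))//; lra.
  have -> : y + (t *: (x - y) - s *: v) - y = t *: (x - y) - s *: v by vring.
  rewrite dotpBr !dotpZr.
  have h1 : dotp nrm (x - y) <= N * `|nrm| * D.
    by rewrite (le_trans (ler_norm _))// dotp_norm.
  have h2 : t * dotp nrm (x - y) <= N * `|nrm| * D.
    by apply: (le_trans (ler_wpM2l t0 h1)); rewrite ler_piMl// !mulr_ge0// ltW.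
  have h3 := ler_wpM2l (ltW k0) nw.
  have h4 : k * (s * `|v|) <= s * (dotp nrm v / 2) by rewrite mulrCA ler_wpM2l// ltW.
  have h5 : s * (dotp nrm v / 2) = (N * `|nrm| + k + 1) * D.
    by rewrite s_def mulrAC KE.
  move: h3 h5; rewrite mulrDr !mulrDl mul1r => h3 h5.
  have : s * dotp nrm v = 2 * (s * (dotp nrm v / 2)) by field.
  by lra.
have h1 := uL _ _ inO.
have srr1 : s < r1 by lra.
have h2 := shift_bound L0 uL uc sh clx _ s0 srr1.
have h3 := shift_bound L0 uL uc sh cly _ s0 srr1.
have {}h2 : `|u (x + s *: - v) - u x| <= L * (s * `|- v|) by apply: h2; lra.
have {}h3 : `|u (y + s *: - v) - u y| <= L * (s * `|- v|) by apply: h3; lra.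
have E : x + s *: - v - (y + s *: - v) = x - y by vring.
rewrite E -/D in h1; rewrite normrN in h2 h3.
have sE : L * (s * `|v|) = L * (K * `|v|) * D by rewrite s_def; ring.
rewrite sE in h2 h3; move: h1 h2 h3; rewrite mulrDl -mulrA -[2 * L * _]mulrA.
rewrite -[2 * (L * (K * `|v|)) * D]mulrA !ler_norml; lra.
Qed.

Lemma mulmx_outer x y v : x *m (y^T *m v) = dotp x y *: v.
Proof.
apply/rowP => j; rewrite mulmxA !mxE big_ord1; congr (_ * _).
by rewrite mxE; apply: eq_bigr => i _; rewrite mxE.
Qed.

(* Splitting xi = P xi + (nrm.xi / nrm.gam) gam, the form
   (|P xi|^2 + (nrm.xi)^2 / nrm.gam) / 2 has the required oblique gradient. *)
Lemma oblique_form nrm gam : 0 < dotp nrm gam -> exists (M : 'M[R]_m) C, [/\ 0 < C,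
  (forall x, dotp (x *m (M + M^T)) gam = dotp nrm x) &
  (forall x, `|x| ^+ 2 <= C * dotp (x *m M) x)].
Proof.
set nu := dotp nrm gam => nu0.
pose P : 'M[R]_m := 1%:M - nu^-1 *: (nrm^T *m gam).
have xP x : x *m P = x - (nu^-1 * dotp x nrm) *: gam.
  by rewrite mulmxBr mulmx1 -scalemxAr mulmx_outer scalerA.
pose S : 'M[R]_m := P *m P^T + nu^-1 *: (nrm^T *m nrm).
have ST : S^T = S by rewrite /S linearD /= linearZ /= !trmx_mul !trmxK.
have xS x y : dotp (x *m S) y = dotp (x *m P) (y *m P) + nu^-1 * (dotp x nrm * dotp y nrm).
  rewrite /S mulmxDr mulmxA -scalemxAr mulmx_outer dotpDl !dotpZl.
  by rewrite [dotp (x *m P *m P^T) y]dotp_mulmx trmxK [dotp nrm y]dotpC.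
exists (2^-1 *: S), (4 + 4 * nu^-1 * `|gam| ^+ 2); split.
- by rewrite ltr_pwDl// !mulr_ge0// ?invr_ge0 ?sqr_ge0// ltW.
(* [P] annihilates [gam], so only the second term of [S] contributes. *)
- move=> x; rewrite linearZ /= ST -scalerDl (_ : 2^-1 + 2^-1 = 1 :> R) ?scale1r; last by field.
  rewrite xS (xP gam) [dotp gam nrm]dotpC -/nu mulVf ?gt_eqF// scale1r subrr dotp0r add0r.
  by rewrite mulrCA mulVf ?gt_eqF// mulr1 dotpC.
- move=> x; rewrite -scalemxAr dotpZl xS.
  have xE : x = x *m P + (nu^-1 * dotp x nrm) *: gam by rewrite xP subrK.
  have h : `|x| <= `|x *m P| + nu^-1 * `|dotp x nrm| * `|gam|.
    rewrite {1}xE (le_trans (ler_normD _ _))// normrZ normrM gtr0_norm// invr_gt0//.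
  have h2 := norm_dotp (x *m P).
  have h3 : 0 <= nu^-1 by rewrite invr_ge0 ltW.
  set A := `|x *m P| in h h2 *; set B := dotp (x *m P) _ in h2 *.
  have dd : dotp x nrm * dotp x nrm = `|dotp x nrm| ^+ 2 by rewrite -normrX expr2 ger0_norm// -expr2 sqr_ge0.
  rewrite dd; set D := `|dotp x nrm| in h *; set G := `|gam| in h *.
  have A0 : 0 <= A by rewrite /A normr_ge0.
  have B0 : 0 <= B by exact: dotp_ge0.
  have h4 : `|x| ^+ 2 <= (A + nu^-1 * D * G) ^+ 2.
    rewrite lerXn2r ?nnegrE ?normr_ge0// addr_ge0// !mulr_ge0//; exact: normr_ge0.
  have h5 : (A + nu^-1 * D * G) ^+ 2 <= 2 * A ^+ 2 + 2 * (nu^-1 * D * G) ^+ 2.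
    have := sqr_ge0 (A - nu^-1 * D * G); move: (nu^-1 * D * G) => X; nra.
  apply: (le_trans h4); apply: (le_trans h5).
  have -> : (4 + 4 * nu^-1 * G ^+ 2) * (2^-1 * (B + nu^-1 * D ^+ 2)) =
    2 * B + 2 * (nu^-1 * D * G) ^+ 2 + (2 * (nu^-1 * D ^+ 2) + 2 * (nu^-1 * (G ^+ 2 * B))).
    by field; rewrite gt_eqF.
  have : 0 <= nu^-1 * D ^+ 2 by rewrite mulr_ge0// sqr_ge0.
  have : 0 <= nu^-1 * (G ^+ 2 * B) by apply: mulr_ge0 => //; apply: mulr_ge0 => //; exact: sqr_ge0.
  lra.
Qed.

End ObliqueGeometry.

(** * Comparison at an oblique boundary maximum *)

Section ComparisonOblique.
Variables (R : realType) (m : nat).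
Implicit Types (x y z e p q v nrm gam : 'rV[R]_m) (r s t d eps a b k L C : R).
Variables (Omega : set 'rV[R]_m) (H : 'rV[R]_m -> 'rV[R]_m -> R).
Local Notation cl := (closure Omega).
Local Notation N := (m%:R : R).
Hypothesis oO : open Omega.
Hypothesis cO : compact cl.
Hypothesis O0 : cl !=set0.
Hypothesis contH : {within [set xp : 'rV[R]_m * 'rV[R]_m | cl xp.1],
  continuous (fun xp => H xp.1 xp.2)}.
Hypothesis coerH : coercive Omega H.

Lemma bdryE x : bdry Omega x <-> cl x /\ ~ Omega x.
Proof. by rewrite /bdry (interior_id _).1. Qed.

Lemma cl_cases x : cl x -> Omega x \/ bdry Omega x.
Proof.
by move=> clx; have [|nO] := pselect (Omega x); [left|right; apply/bdryE].
Qed.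

Variables (gamma : 'rV[R]_m -> 'rV[R]_m) (g : 'rV[R]_m -> R).
Hypothesis gammac : cont_on cl gamma.
Hypothesis gc : cont_on (bdry Omega) g.

Local Ltac slra := clear - oO cO O0 contH coerH gammac gc; lra.

(* Perturbing the test function |x - y|^2 into an anisotropic quadratic form plus
   linear terms gives the strict sign of gamma.p - g at boundary maximum points,
   thanks to the Lipschitz bound on u. *)
Lemma comparison_oblique (u w : 'rV[R]_m -> R) a a' z nrm L : 0 <= L ->
  cont_on cl u -> segLip Omega L u ->
  bdry Omega z -> inner_cone Omega z nrm -> 0 < dotp nrm (gamma z) ->
  subsolution Omega H (neumann gamma g) a' u ->
  supersolution Omega H (neumann gamma g) a w ->
  (forall x, cl x -> u x - w x <= u z - w z) ->
  a <= a'.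
Proof.
move=> L0 uc uL bz cz nu0 [_ usub] [wl wsup] zmax; rewrite leNgt; apply/negP => a'a.
have clz : cl z by case: bz.
have nOz : ~ Omega z by have [] := (bdryE z).1 bz.
have aa0 : 0 < a - a' by rewrite subr_gt0.
set gam := gamma z in nu0 *; set nu := dotp nrm gam in nu0 *.
have [r0 [Cu [r00 Cu0 hu]]] := inner_cone_lip L0 cz nu0 uL uc.
have [M [Cp [Cp0 Mgam Mpos]]] := oblique_form nu0.
have [CS CS0 hS] := mulmx_norm (M + M^T).
have nnrm : 0 <= `|nrm| := normr_ge0 nrm.
have ngam : 0 <= `|gam| := normr_ge0 gam.
have N0 : 0 <= N by [].
have gg0 : 0 < dotp gam gam.
  have : gam != 0 by apply/eqP => g0; move: nu0; rewrite /nu g0 dotp0r ltxx.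
  by rewrite -normr_gt0 => h; apply: lt_le_trans (norm_dotp gam); rewrite exprn_gt0.
(* With [al * r = A * eta], this size makes [al |x - z|^2] exceed the loss from [eta nrm . (x - z)]
   by at least [eta r] once [|x - z| >= r / 2]. *)
have [A [A0 AE]] : exists A : R, 0 < A /\ A = 4 * (N * `|nrm| + 1).
  by eexists; split; last reflexivity; rewrite mulr_gt0// ltr_wpDl// mulr_ge0.
have [Kq [Kq0 KqE]] : exists Kq : R, 0 <= Kq /\ Kq = (`|g z| + nu) / dotp gam gam * `|gam|.
  eexists; split; last reflexivity.
  by rewrite !mulr_ge0// ?invr_ge0 ?(ltW gg0)// addr_ge0// ltW.
(* [C'] bounds, per unit of [|xi|], the variation of all terms other than [b Q]; then [C2] bounds
   [b |xi|], and [K] bounds the gradient [py]. *)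
have [C' [C'0 C'E]] : exists C' : R, 0 <= C' /\ C' = Cu + N * Kq + N * `|nrm| + 2 * N * A.
  by eexists; split; last reflexivity; rewrite !addr_ge0// !mulr_ge0// ltW.
have [C2 [C20 C2E]] : exists C2 : R, 0 <= C2 /\ C2 = Cp * C'.
  by eexists; split; last reflexivity; rewrite mulr_ge0// ltW.
have [K [K0 KE]] : exists K : R, 0 <= K /\ K = Kq + CS * C2.
  by eexists; split; last reflexivity; rewrite addr_ge0// mulr_ge0// ltW.
have [dH dH0 hdH] := @H_unif_cont _ _ Omega H cO contH K _ aa0.
have nA0 : 0 < `|nrm| + A + 1 by move: nnrm A0; slra.
have [eta [eta0 eta1 etaH]] : exists eta : R, [/\ 0 < eta, eta <= 1 & eta * (`|nrm| + A) < dH].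
  exists (Num.min 1 (dH / (2 * (`|nrm| + A + 1)))); split.
  - by rewrite lt_min ltr01 divr_gt0// mulr_gt0.
  - by rewrite ge_min lexx.
  - apply: (@le_lt_trans _ _ (dH / (2 * (`|nrm| + A + 1)) * (`|nrm| + A + 1))).
      apply: ler_pM; rewrite ?addr_ge0 ?ge_min ?lexx ?orbT ?le_min ?ler01 ?lerDl ?(ltW A0)//.
      by rewrite divr_ge0 ?(ltW dH0)// mulr_ge0// ltW.
    have -> : dH / (2 * (`|nrm| + A + 1)) * (`|nrm| + A + 1) = dH / 2.
      by field; rewrite gt_eqF.
    by move: dH0; slra.
pose mu := eta * nu / 2.
have mu0 : 0 < mu by rewrite divr_gt0// mulr_gt0.
have muE : eta * nu = 2 * mu by rewrite /mu; field.
have munu : mu <= nu.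
  have : eta * nu <= 1 * nu by rewrite ler_wpM2r// ltW.
  by rewrite muE; move: nu0 mu0; slra.
clearbody mu.
(* Up to errors, [py] has oblique derivative [g z - mu], and the extra term [eta nrm] in [px] adds
   [eta nu = 2 mu]. Both boundary alternatives thus fail by the margin [mu]. *)
pose q : 'rV[R]_m := ((g z - mu) / dotp gam gam) *: gam.
have qgam : dotp gam q = g z - mu by rewrite dotpZr divfK// gt_eqF.
have nq : `|q| <= Kq.
  rewrite normrZ KqE ler_wpM2r// normrM [X in _ * X]gtr0_norm ?invr_gt0//.
  rewrite ler_wpM2r ?invr_ge0 ?(ltW gg0)//.
  by rewrite (le_trans (ler_normB _ _))// lerD2l gtr0_norm.
clearbody q.
have [K' [K'0 K'E]] : exists K' : R, 0 <= K' /\ K' = K + `|nrm| + A.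
  by eexists; split; last reflexivity; rewrite !addr_ge0// ltW.
have [k [k0 hk]] : exists k : R, 0 < k /\ k * (C2 + 4 * N * `|gam|) <= mu / 4.
  have D0 : 0 < C2 + 4 * N * `|gam| + 1 by rewrite ltr_wpDl// addr_ge0// !mulr_ge0.
  exists (mu / 4 / (C2 + 4 * N * `|gam| + 1)); split; first by rewrite !divr_gt0.
  by rewrite mulrAC ler_pdivrMr// ler_wpM2l ?lerDl// divr_ge0// ltW.
have [om [om0 hom]] : exists om : R, 0 < om /\ om * (N * K' + 1) <= mu / 4.
  have D0 : 0 < N * K' + 1 by rewrite ltr_wpDl// mulr_ge0.
  exists (mu / 4 / (N * K' + 1)); split; first by rewrite !divr_gt0.
  by rewrite divfK// gt_eqF.
have [rc rc0 [_ hc]] := inner_coneN cz k0.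
have [rg rg0 hg] := gammac clz om0.
have [rb rb0 hb] := gc bz om0.
have [r [rr0 rr1]] : exists r : R, 0 < r /\ [/\ r < r0, r < rc, r < rg & r < rb].
  exists (Num.min (Num.min r0 rc) (Num.min rg rb) / 2).
  have h : 0 < Num.min (Num.min r0 rc) (Num.min rg rb).
    by rewrite !lt_min r00 rc0 rg0 rb0.
  split; first by rewrite divr_gt0.
  have : Num.min (Num.min r0 rc) (Num.min rg rb) / 2 < Num.min (Num.min r0 rc) (Num.min rg rb) by move: h; slra.
  by rewrite !lt_min => /andP[/andP[? ?] /andP[? ?]].
case: rr1 => rr0' rrc rrg rrb.
have [al [al0 alE]] : exists al : R, 0 < al /\ al * r = A * eta.
  exists (A * eta / r); split; first by rewrite divr_gt0// mulr_gt0.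
  by rewrite divfK// gt_eqF.
(* The first bound confines [x] to the ball of radius [r / 2]; the second makes [al |x - z|]
   comparable to [eta k] when [x] is on the boundary. *)
pose err0 := Num.min (eta * r) (2 * (eta * k) ^+ 2 / al).
have err00 : 0 < err0.
  by rewrite lt_min mulr_gt0//= divr_gt0// mulr_gt0// exprn_gt0// mulr_gt0.
(* b is the inverse of the usual penalization parameter epsilon *)
have [b [b0 berr br bdH]] : exists b : R,
    [/\ 0 < b, C' * C2 < err0 * b, C2 < r / 2 * b & C2 < dH * b].
  have CC : 0 <= C' * C2 by rewrite mulr_ge0.
  exists (C' * C2 / err0 + C2 / (r / 2) + C2 / dH + 1).
  have h1 : 0 <= C' * C2 / err0 by rewrite divr_ge0// ltW.
  have r20 : 0 < r / 2 by rewrite divr_gt0.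
  have h2 : 0 <= C2 / (r / 2) by rewrite divr_ge0// ltW.
  have h3 : 0 <= C2 / dH by rewrite divr_ge0// ltW.
  split; first by move: h1 h2 h3; slra.
  - by rewrite -ltr_pdivrMl// mulrC; move: h1 h2 h3; slra.
  - by rewrite -ltr_pdivrMl// mulrC; move: h1 h2 h3; slra.
  - by rewrite -ltr_pdivrMl// mulrC; move: h1 h2 h3; slra.
pose B := cl `&` [set y | `|y - z| <= r].
have cB : compact B by exact: compact_setI_ballr.
have zB : B z by split => //=; rewrite subrr normr0 ltW.
have B0 : B !=set0 by exists z.
have uB : usc_on B u by apply: usc_subset (cont_usc uc) _ => x [].
have wB : lsc_on B w.
  apply/lsc_onP => x [clx _] t tw.
  have [r1 r10 hr1] := (lsc_onP _ _).1 wl x clx t tw.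
  by exists r1 => // y [cly _]; exact: hr1.
have [x [y [[clx /= xr] [cly /= yr] mx]]] := @pair_max _ _ B B u w (quad (b *: M) q 0 0)
   (quad al%:M (eta *: nrm) z 0) (quad 0 0 0 0) cB cB B0 B0 uB wB
   (@quad_cont _ _ _ _ _ _) (@quad_cont _ _ _ _ _ _) (@quad_cont _ _ _ _ _ _).
have qz x' : quad (0 : 'M[R]_m) 0 0 0 x' = 0.
  by rewrite /quad mulmx0 !dotp0l !addr0.
pose Q xi : R := dotp (xi *m M) xi.
have Q1 xi : quad (b *: M) q 0 0 xi = b * Q xi + dotp q xi.
  by rewrite /quad subr0 -scalemxAr dotpZl addr0.
have {}mx x' y' : B x' -> B y' ->
   u x' - w y' - (b * Q (x' - y') + dotp q (x' - y'))
     - (al * dotp (x' - z) (x' - z) + eta * dotp nrm (x' - z)) <=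
   u x - w y - (b * Q (x - y) + dotp q (x - y))
     - (al * dotp (x - z) (x - z) + eta * dotp nrm (x - z)).
  move=> Bx' By'; have := mx x' y' Bx' By'.
  by rewrite !qz !Q1 !quad_diag !dotpZl !addr0 !subr0.
set xi := x - y in mx *.
have nxi : 0 <= `|xi| by rewrite normr_ge0.
have uxy : u x <= u y + Cu * `|xi|.
  have h1 : `|x - z| < r0 by exact: le_lt_trans xr rr0'.
  have h2 : `|y - z| < r0 by exact: le_lt_trans yr rr0'.
  by have := hu x y clx cly h1 h2; rewrite ler_norml -/xi; slra.
have nqxi : - (N * Kq * `|xi|) <= dotp q xi.
  have : N * `|q| * `|xi| <= N * Kq * `|xi| by rewrite ler_wpM2r// ler_wpM2l.
  by have := dotp_norm q xi; rewrite ler_norml; slra.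
have Qxi : b * `|xi| ^+ 2 <= Cp * (b * Q xi).
  by rewrite [Cp * _]mulrCA ler_wpM2l ?(ltW b0)//; exact: Mpos.
(* Comparison with the diagonal pair [(y, y)]: the Lipschitz bound on [u] makes the quadratic term
   [b Q xi] at most linear in [|xi|], so the gradients stay bounded as [b] grows. *)
have bxi : b * `|xi| <= C2.
  have h := mx y y (conj cly yr) (conj cly yr).
  rewrite subrr /Q mul0mx !dotp0r mulr0 add0r subr0 -/(Q xi) in h.
  have h1 : al * dotp (y - z) (y - z) - al * dotp (x - z) (x - z) <= 2 * N * A * `|xi|.
    have -> : al * dotp (y - z) (y - z) - al * dotp (x - z) (x - z) =
       - (al * dotp xi ((x - z) + (y - z))).
      have -> : xi = (x - z) - (y - z) by rewrite /xi; vring.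
      move: (x - z) (y - z) => X Y; rewrite !(dotpBl, dotpDr) [dotp Y X]dotpC; ring.
    have h2 := dotp_norm xi ((x - z) + (y - z)).
    have h3 : `|x - z + (y - z)| <= 2 * r by rewrite (le_trans (ler_normD _ _))//; move: xr yr; slra.
    have h4 : N * `|xi| * `|x - z + (y - z)| <= N * `|xi| * (2 * r).
      by rewrite ler_wpM2l// mulr_ge0.
    have h5 : - dotp xi ((x - z) + (y - z)) <= N * `|xi| * (2 * r).
      by move: h2 h4; rewrite ler_norml; slra.
    rewrite -mulrN; apply: (le_trans (ler_wpM2l (ltW al0) h5)).
    have -> : al * (N * `|xi| * (2 * r)) = (2 * N * `|xi|) * (al * r) by ring.
    rewrite alE; have -> : 2 * N * A * `|xi| = (2 * N * `|xi|) * A by ring.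
    by rewrite ler_wpM2l ?mulr_ge0// ler_piMr// ltW.
  have h2 : eta * dotp nrm (y - z) - eta * dotp nrm (x - z) <= N * `|nrm| * `|xi|.
    have -> : eta * dotp nrm (y - z) - eta * dotp nrm (x - z) = eta * - dotp nrm xi.
      have -> : xi = (x - z) - (y - z) by rewrite /xi; vring.
      by rewrite !dotpBr; ring.
    have h3 : - dotp nrm xi <= N * `|nrm| * `|xi|.
      by have := dotp_norm nrm xi; rewrite ler_norml; slra.
    apply: (le_trans (ler_wpM2l (ltW eta0) h3)); by rewrite ler_piMl// !mulr_ge0//.
  have h3 : b * Q xi <= C' * `|xi|.
    by rewrite C'E !mulrDl; move: h h1 h2 uxy nqxi; slra.
  have h4 : `|xi| * (b * `|xi|) <= `|xi| * C2.
    rewrite mulrCA -expr2 (le_trans Qxi)// C2E (mulrCA `|xi|) [`|xi| * C']mulrC.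
    by rewrite ler_wpM2l// ltW.
  have [->|xi0] := eqVneq `|xi| 0; first by rewrite mulr0.
  by rewrite ler_pM2l// in h4; rewrite lt_neqAle eq_sym xi0.
have xiC2 : `|xi| < r / 2 by rewrite -(ltr_pM2l b0) (le_lt_trans bxi)// mulrC.
have xidH : `|xi| < dH by rewrite -(ltr_pM2l b0) (le_lt_trans bxi)// mulrC.
have C'err : C' * `|xi| < err0.
  rewrite -(ltr_pM2l b0) mulrCA (le_lt_trans (ler_wpM2l C'0 bxi))//.
  by rewrite [b * _]mulrC.
(* Comparison with the pair [(z, z)], where all penalizations vanish. *)
have loc : al * `|x - z| ^+ 2 + eta * dotp nrm (x - z) <= C' * `|xi|.
  have h := mx z z zB zB.
  rewrite !subrr /Q mul0mx !dotp0r !mulr0 !addr0 !subr0 -/(Q xi) in h.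
  have h1 := zmax y cly.
  have h2 := ler_wpM2l (ltW al0) (norm_dotp (x - z)).
  have h3 : 0 <= b * Q xi.
    have : 0 <= Cp * (b * Q xi) by apply: le_trans Qxi; rewrite mulr_ge0 ?sqr_ge0 ?(ltW b0).
    by rewrite pmulr_rge0.
  have h4 : Cu * `|xi| + N * Kq * `|xi| <= C' * `|xi|.
    by rewrite -mulrDl ler_wpM2r// C'E -addrA lerDl addr_ge0// !mulr_ge0// ltW.
  by move: h h1 h2 h3 h4 uxy nqxi; slra.
have : C' * `|xi| < err0 by [].
rewrite lt_min => /andP[err1 err2].
have xz : `|x - z| < r / 2.
  rewrite ltNge; apply/negP => h.
  have h1 : - (N * `|nrm| * `|x - z|) <= dotp nrm (x - z).
    by have := dotp_norm nrm (x - z); rewrite ler_norml; slra.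
  have h2 : A * eta / 2 * `|x - z| <= al * `|x - z| ^+ 2.
    by rewrite -alE expr2 mulrA ler_wpM2r// -mulrA ler_wpM2l ?(ltW al0).
  have h3 := ler_wpM2l (ltW eta0) h1.
  have h4 : A * eta / 2 * `|x - z| = 2 * (eta * (N * `|nrm| * `|x - z|)) + 2 * (eta * `|x - z|).
    by rewrite AE; field.
  have h5 : 0 <= eta * (N * `|nrm| * `|x - z|) by rewrite !mulr_ge0// ltW.
  have h6 : eta * (r / 2) <= eta * `|x - z| by rewrite ler_wpM2l// ltW.
  by move: h2 h3 h4 h5 h6 loc err1; slra.
have yz : `|y - z| < r.
  have -> : y - z = (x - z) - xi by rewrite /xi; vring.
  by rewrite (le_lt_trans (ler_normB _ _))//; move: xz xiC2; slra.
pose py : 'rV[R]_m := b *: (xi *m (M + M^T)) + q.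
pose px : 'rV[R]_m := py + eta *: nrm + (2 * al) *: (x - z).
have pyK : `|py| <= K.
  rewrite (le_trans (ler_normD _ _))// KE addrC lerD// normrZ gtr0_norm//.
  apply: (le_trans (ler_wpM2l (ltW b0) (hS xi))).
  by rewrite mulrCA ler_wpM2l// ltW.
have alxz : 2 * al * `|x - z| <= A * eta.
  have : al * `|x - z| <= al * (r / 2) by rewrite ler_wpM2l// ltW.
  by rewrite [al * (r / 2)]mulrA alE; slra.
have n2al : `|2 * al| = 2 * al by rewrite gtr0_norm// mulr_gt0.
have pxy : `|px - py| < dH.
  have -> : px - py = eta *: nrm + (2 * al) *: (x - z) by rewrite /px; vring.
  apply: le_lt_trans etaH; rewrite (le_trans (ler_normD _ _))//.
  rewrite [`|eta *: _|]normrZ [`|(2 * al) *: _|]normrZ (gtr0_norm eta0) n2al mulrDr.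
  by rewrite [eta * A]mulrC lerD2l.
have pxK : `|px| <= K'.
  rewrite /px -addrA (le_trans (ler_normD _ _))// K'E -addrA lerD//.
  rewrite (le_trans (ler_normD _ _))//.
  rewrite [`|eta *: _|]normrZ [`|(2 * al) *: _|]normrZ (gtr0_norm eta0) n2al lerD//.
    by rewrite ler_piMl.
  by rewrite (le_trans alxz)// ler_piMr// ltW.
have gpy : dotp gam py = g z - mu + b * dotp nrm xi.
  by rewrite /py dotpDr qgam dotpZr dotpC Mgam addrC.
have small p v' : `|p| <= K' -> cl v' -> `|v' - z| < rg ->
    `|dotp (gamma v' - gam) p| <= om * (N * K').
  move=> pK clv vz; have := hg v' clv vz => /ltW h.
  apply: (le_trans (dotp_norm _ _)).
  have -> : om * (N * K') = N * om * K' by ring.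
  by rewrite ler_pM// ?mulr_ge0// ler_wpM2l.
have bxk : k * (b * `|xi|) <= k * C2 by rewrite ler_wpM2l// ltW.
have hk1 : 0 <= k * (4 * N * `|gam|) by rewrite !mulr_ge0// ltW.
move: hk hom; rewrite !mulrDr mulr1 => hk hom.
have Hx : H x px <= a'.
  have [C1 g1] := quad_C1 cl (b *: M) q y 0.
  have [C2' g2] := quad_C1 cl al%:M (eta *: nrm) z 0.
  have [C3 g3] := C1_closed_lin 1 1 C1 C2'.
  have pxE : px = grad (fun x => 1 * quad (b *: M) q y 0 x + 1 * quad al%:M (eta *: nrm) z 0 x) x.
    rewrite g3// !scale1r quad_diag_grad g1 /px /py linearZ /= -scalerDr -scalemxAr.
    by rewrite -/xi -!addrA; congr (_ + (_ + _)); rewrite addrC.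
  have mxx : local_max cl (u \- (fun x => 1 * quad (b *: M) q y 0 x + 1 * quad al%:M (eta *: nrm) z 0 x)) x.
    apply/local_maxP; exists (r / 2) => [|x' clx' x'x]; first by rewrite divr_gt0.
    have x'z : `|x' - z| <= r.
      by rewrite -(subrK x x') -addrA (le_trans (ler_normD _ _))//; move: x'x xz; slra.
    have := mx x' y (conj clx' x'z) (conj cly yr).
    rewrite /= !quad_diag !dotpZl !addr0 !mul1r /quad -!scalemxAr !dotpZl !addr0 -/xi -/(Q _) -/(Q xi).
    by slra.
  have [Ox|bx] := cl_cases clx.
    by rewrite pxE; have [+ _] := usub _ x C3 clx mxx; exact.
  have [_ /(_ bx)] := usub _ x C3 clx mxx.
  rewrite -pxE ge_min subr_le0 => /orP[//|]; rewrite /neumann => bad; exfalso.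
  have nOx : ~ Omega x by have [] := (bdryE x).1 bx.
  have hx : dotp (gamma x) px = dotp gam py + eta * nu + 2 * al * dotp gam (x - z)
      + dotp (gamma x - gam) px.
    have gpx p : dotp gam (p + eta *: nrm + (2 * al) *: (x - z)) =
        dotp gam p + eta * nu + 2 * al * dotp gam (x - z).
      by rewrite dotpDr [dotp gam (p + _)]dotpDr !dotpZr [dotp gam nrm]dotpC.
    rewrite -(gpx py) -/px.
    by rewrite dotpBl addrC subrK.
  (* The quadratic form contributes [b * dotp nrm xi] to the oblique derivative. As [x] is outside
     Omega and [y] in the closure, the cone property bounds this below by [- k C2]. *)
  have c1 : - (k * `|xi|) <= dotp nrm xi.
    have h1 : `|x - z| < rc by exact: le_lt_trans xr rrc.
    have h2 : `|y - z| < rc by exact: le_lt_trans yr rrc.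
    have := hc x y nOx cly h1 h2; have -> : y - x = - xi by rewrite /xi opprB.
    by rewrite dotpNr normrN; slra.
  have c2 : - (k * `|x - z|) <= dotp nrm (x - z).
    have h1 : `|x - z| < rc by exact: le_lt_trans xr rrc.
    have h2 : `|z - z| < rc by rewrite subrr normr0.
    have := hc x z nOx clz h1 h2; have -> : z - x = - (x - z) by rewrite opprB.
    by rewrite dotpNr normrN; slra.
  have c3 : al * `|x - z| <= 2 * (eta * k).
    rewrite leNgt; apply/negP => h.
    have xz0 : 0 <= `|x - z| by rewrite normr_ge0.
    have ek0 : 0 < eta * k by rewrite mulr_gt0.
    have h1 := ler_wpM2l (ltW eta0) c2.
    have h3 : al * (C' * `|xi|) < 2 * (eta * k) ^+ 2.
      by move: err2; rewrite ltr_pdivlMr// mulrC.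
    have h5 : al * (al * `|x - z| ^+ 2 + eta * dotp nrm (x - z)) <= al * (C' * `|xi|).
      by rewrite ler_wpM2l// ltW.
    have h6 := ler_wpM2l (ltW al0) h1.
    have h8 : al * (al * `|x - z| ^+ 2) = (al * `|x - z|) ^+ 2 by ring.
    have h9 : al * (eta * - (k * `|x - z|)) = - (eta * k * (al * `|x - z|)) by ring.
    (* With [Y = al |x - z|] and [E = eta k], the bounds say [Y^2 - E Y < 2 E^2], that is
       [(Y - 2 E) (Y + E) < 0]. *)
    have h10 : 0 < (al * `|x - z| - 2 * (eta * k)) * (al * `|x - z| + eta * k).
      by rewrite mulr_gt0 ?subr_gt0// ltr_wpDl// mulr_ge0// ltW.
    move: h3 h5 h6 h10; rewrite [al * (al * _ + _)]mulrDr h8 h9 !expr2.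
    by move: (al * `|x - z|) (eta * k) => Y E2; slra.
  have c4 : - (2 * (k * (4 * N * `|gam|)) / 2) <= 2 * al * dotp gam (x - z).
    have h1 := dotp_norm gam (x - z).
    have h2 : al * (N * `|gam| * `|x - z|) <= 2 * k * (N * `|gam|).
      have -> : al * (N * `|gam| * `|x - z|) = (al * `|x - z|) * (N * `|gam|) by ring.
      rewrite ler_wpM2r ?mulr_ge0//; apply: (le_trans c3).
      by rewrite ler_wpM2l// ler_piMl// ltW.
    have h3 : - (al * (N * `|gam| * `|x - z|)) <= al * dotp gam (x - z).
      by rewrite -mulrN ler_wpM2l ?(ltW al0)//; move: h1; rewrite ler_norml; slra.
    by move: h2 h3; slra.
  have c5 : - (k * (b * `|xi|)) <= b * dotp nrm xi.
    by rewrite mulrCA -mulrN ler_wpM2l// ltW.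
  have c6 : `|g x - g z| < om by apply: hb => //; exact: le_lt_trans xr rrb.
  have c7 : `|dotp (gamma x - gam) px| <= om * (N * K').
    by apply: small => //; exact: le_lt_trans xr rrg.
  move: bad; rewrite hx gpy muE; move: c4 c5 c6 c7 hk hom mu0 bxk; rewrite ltr_norml ler_norml.
  by slra.
have Hy : a <= H y py.
  have [C1 g1] := quad_C1 cl (- (b *: M)) q x 0.
  have pyE : py = grad (quad (- (b *: M)) q x 0) y.
    rewrite g1 /py; congr (_ + _); rewrite -scalerN linearZ /= -scalerDr -scalemxAr; congr (_ *: _).
    have -> : y - x = - xi by rewrite /xi opprB.
    rewrite linearN /= -opprD mulNmx mulmxN opprK//.
  have mny : local_min cl (w \- quad (- (b *: M)) q x 0) y.
    apply/local_minP; exists (r - `|y - z|) => [|y' cly' y'y]; first by rewrite subr_gt0.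
    have y'z : `|y' - z| <= r.
      by rewrite -(subrK y y') -addrA (le_trans (ler_normD _ _))//; move: y'y; slra.
    have := mx x y' (conj clx xr) (conj cly' y'z).
    have sw v : quad (- (b *: M)) q x 0 v = - (b * Q (x - v) + dotp q (x - v)).
      rewrite /quad -(opprB x v) mulmxN mulNmx opprK dotpNr -scalemxAr dotpZl dotpNr addr0.
      by rewrite -opprD.
    by rewrite /= !sw -/xi; slra.
  have [Oy|byy] := cl_cases cly.
    by rewrite pyE; have [+ _] := wsup _ y C1 cly mny; exact.
  have [_ /(_ byy)] := wsup _ y C1 cly mny.
  rewrite -pyE le_max subr_ge0 => /orP[//|]; rewrite /neumann => bad; exfalso.
  have nOy : ~ Omega y by have [] := (bdryE y).1 byy.
  have hy : dotp (gamma y) py = dotp gam py + dotp (gamma y - gam) py.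
    by rewrite dotpBl addrC subrK.
  have c1 : dotp nrm xi <= k * `|xi|.
    by apply: hc => //; [exact: le_lt_trans yr rrc|exact: le_lt_trans xr rrc].
  have c5 : b * dotp nrm xi <= k * (b * `|xi|).
    by rewrite mulrCA ler_wpM2l// ltW.
  have c6 : `|g y - g z| < om by apply: hb => //; exact: le_lt_trans yr rrb.
  have pyK' : `|py| <= K' by rewrite K'E; move: pyK nnrm A0; slra.
  have c7 : `|dotp (gamma y - gam) py| <= om * (N * K').
    by apply: small => //; exact: le_lt_trans yr rrg.
  move: bad; rewrite hy gpy; move: c5 c6 c7 hk hk1 hom mu0 bxk; rewrite ltr_norml ler_norml.
  by slra.
have := hdH y x py px cly clx pyK xidH pxy; rewrite ltr_norml.
by move: Hx Hy; slra.
Qed.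

End ComparisonOblique.

(** * Comparison of levels for (E-SC) and (E-N) *)

Section Comparison.
Variables (R : realType) (m : nat).
Implicit Types (x y z e p q v nrm gam : 'rV[R]_m) (r s t d eps a b k L C : R).
Variables (Omega : set 'rV[R]_m) (H : 'rV[R]_m -> 'rV[R]_m -> R).
Local Notation cl := (closure Omega).
Local Notation N := (m%:R : R).
Hypothesis oO : open Omega.
Hypothesis cO : compact cl.
Hypothesis O0 : cl !=set0.
Hypothesis contH : {within [set xp : 'rV[R]_m * 'rV[R]_m | cl xp.1],
  continuous (fun xp => H xp.1 xp.2)}.
Hypothesis coerH : coercive Omega H.

(** [L] depends on the level [a] alone, which is what makes a whole Perron class equicontinuous. *)
Lemma subsolution_segLip a : exists2 L, 0 <= L & forall u, usc_on cl u ->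
  (forall phi x, C1_closed cl phi -> Omega x -> local_max cl (u \- phi) x ->
     H x (grad phi x) <= a) -> segLip Omega L u.
Proof.
have [L L0 hL] := H_coercive coerH a.
exists (N * L) => [|u uu usub]; first by rewrite mulr_ge0// ltW.
apply: grad_bound_segLip => //; first exact: ltW.
by move=> phi x C Ox mx; exact: (hL x _ (subset_closure Ox) (usub _ _ C Ox mx)).
Qed.

Lemma local_max_ext (u w phi : 'rV[R]_m -> R) x : (forall y, Omega y -> w y = u y) ->
  Omega x -> local_max cl (w \- phi) x -> local_max cl (u \- phi) x.
Proof.
move=> uw Ox /local_maxP[r r0 hr]; have [r' r'0 hr'] := (openP_rV _).1 oO x Ox.
apply/local_maxP; exists (Num.min r r') => [|y cly]; first by rewrite lt_min r0.
rewrite lt_min => /andP[yr yr']; have := hr y cly yr; rewrite /= !uw//.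
exact: hr'.
Qed.

Lemma usc_onB_lsc (A : set 'rV[R]_m) (u w : 'rV[R]_m -> R) :
  usc_on A u -> lsc_on A w -> usc_on A (u \- w).
Proof.
move=> /usc_onP uu /lsc_onP lw; apply/usc_onP => x Ax t /= h.
pose e := (t - (u x - w x)) / 2.
have e0 : 0 < e by rewrite divr_gt0// subr_gt0.
have [|r r0 hr] := uu x Ax (u x + e); first by rewrite ltrDl.
have [|s s0 hs] := lw x Ax (w x - e); first by rewrite ltrBlDr ltrDl.
exists (Num.min r s) => [|y Ay]; first by rewrite lt_min r0.
rewrite lt_min => /andP[/(hr _ Ay) h1 /(hs _ Ay) h2]; rewrite /e in h1 h2; lra.
Qed.

(** The boundary values of [u] are uncontrolled, so [u] is replaced by the extension of its interior
    values. This is still a subsolution, because local maxima at points of the open set Omega see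
    only interior values. *)
Lemma comparison_state_constraint (u w : 'rV[R]_m -> R) a a' :
  inner_dir Omega -> subsolution_in Omega H a' u ->
  supersolution Omega H (@state_constraint R m) a w -> a <= a'.
Proof.
move=> dO [uu usub] [wl wsup].
have [L L0 hL] := subsolution_segLip a'.
have uL : segLip Omega L u by apply: hL => // phi x; exact: usub.
have [v [vc vu vL]] := segLip_extension oO L0 dO uL.
have [z clz zmax] := usc_max_rV cO O0 (usc_onB_lsc (cont_usc vc) wl).
have [e [r sh]] := dO z clz.
apply: (comparison_shift oO cO O0 contH coerH vc wl clz sh) => // [phi x C Ox|phi y C cly _].
  by move=> /(local_max_ext vu Ox); exact: usub.
move=> mn; have [h1 h2] := wsup _ _ C cly mn.
have [/h1 //|/h2] := cl_cases oO cly.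
(* The boundary operator is -1, so the maximum is nonnegative only if the inequality for [H] holds
   on the boundary too. *)
by rewrite le_max subr_ge0 /state_constraint => /orP[//|]; rewrite oppr_ge0 ler10.
Qed.

Variables (gamma : 'rV[R]_m -> 'rV[R]_m) (g : 'rV[R]_m -> R).
Hypothesis gammac : cont_on cl gamma.
Hypothesis gc : cont_on (bdry Omega) g.
Hypothesis cone : forall z, bdry Omega z -> exists2 nrm,
  inner_cone Omega z nrm & 0 < dotp nrm (gamma z).

Local Ltac slra := clear - oO cO O0 contH coerH gammac gc cone; lra.

(** The zero direction serves at interior points, so they need no separate treatment in shift
    arguments. *)
Lemma interior_shift z : Omega z -> exists r, inner_shift Omega z 0 r.
Proof.
move=> Oz; have [r r0 hr] := (openP_rV _).1 oO z Oz.
by exists r; split => // x _ xz s _ _; rewrite scaler0 addr0; exact: hr.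
Qed.

Lemma cone_inner_dir : inner_dir Omega.
Proof.
move=> z clz; have [Oz|bz] := cl_cases oO clz.
  by have [r hr] := interior_shift Oz; exists 0, r.
have [nrm cz n0] := cone bz; have [r r0 hr] := inner_cone_shift cz n0.
by exists (- gamma z), r.
Qed.

(* If u jumped up at a boundary point, a steep linear function in the normal
   direction would touch it from above there, contradicting both alternatives
   of the boundary condition. *)
Lemma neumann_sub_cont (u v : 'rV[R]_m -> R) a :
  subsolution Omega H (neumann gamma g) a u -> cont_on cl v ->
  (forall x, Omega x -> v x = u x) -> forall x, cl x -> u x = v x.
Proof.
move=> [uu usub] vc vu x0 clx0.
have [Ox|bx0] := cl_cases oO clx0; first by rewrite vu.
apply/eqP; rewrite eq_le; apply/andP; split; last first.
  apply/ler_addgt0Pr => e e0; have e2 : 0 < e / 2 by rewrite divr_gt0.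
  have [d d0 hd] := vc x0 clx0 _ e2.
  have [|r r0 hr] := (usc_onP _ _).1 uu x0 clx0 (u x0 + e / 2); first by rewrite ltrDl.
  have mn0 : 0 < Num.min d r by rewrite lt_min d0.
  have [y Oy] := (closureP_rV _ _).1 clx0 _ mn0; rewrite lt_min => /andP[yd yr].
  have := hd y (subset_closure Oy) yd; have := hr y (subset_closure Oy) yr.
  rewrite (vu y Oy) ltr_norml; slra.
rewrite leNgt; apply/negP => lt.
have nOx0 : ~ Omega x0 by have [] := (bdryE oO x0).1 bx0.
pose dl := (u x0 - v x0) / 2.
have dl0 : 0 < dl by rewrite divr_gt0// subr_gt0.
have dlE : v x0 + dl = u x0 - dl by rewrite /dl; field.
clearbody dl.
have [nrm cz nu0] := cone bx0.
set gam := gamma x0 in nu0 *; set nu := dotp nrm gam in nu0 *.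
have N0 : 0 <= N by [].
have nn0 : 0 <= `|nrm| := normr_ge0 nrm.
have ng0 : 0 <= `|gam| := normr_ge0 gam.
have [r1 r10 h1] := vc x0 clx0 _ dl0.
(* The linear term varies by at most [T N |nrm| < dl] on the ball, too little to make up for the
   jump; hence the maximum point is not in Omega. *)
have [T [T0 TE]] : exists T : R, 0 < T /\ 2 * T * (N * `|nrm| + 1) = dl.
  have D0 : 0 < N * `|nrm| + 1 by rewrite ltr_wpDl// mulr_ge0.
  exists (dl / (2 * (N * `|nrm| + 1))); split; first by rewrite divr_gt0// mulr_gt0.
  by field; rewrite gt_eqF.
have [c0 [c00 c0E]] : exists c0 : R, 0 < c0 /\ 8 * c0 * (N * (`|gam| + 1) + 1) = T * nu.
  have D0 : 0 < N * (`|gam| + 1) + 1 by rewrite ltr_wpDl// mulr_ge0// addr_ge0.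
  exists (T * nu / (8 * (N * (`|gam| + 1) + 1))); split.
    by rewrite divr_gt0// mulr_gt0.
  by field; rewrite gt_eqF.
have k0 : 0 < c0 / (4 * T) by rewrite divr_gt0// mulr_gt0.
have kE : T * (c0 / (4 * T)) = c0 / 4 by field; rewrite gt_eqF.
move: (c0 / (4 * T)) k0 kE => k k0 kE.
have [rc rc0 [_ hc]] := inner_coneN cz k0.
have e40 : 0 < c0 / 4 by rewrite divr_gt0.
have [|ru ru0 hu] := (usc_onP _ _).1 uu x0 clx0 (u x0 + c0 / 4); first by rewrite ltrDl.
have [om [om0 om1 omE]] : exists om : R, [/\ 0 < om, om <= 1 & om * (N * `|nrm|) <= nu / 4].
  have D0 : 0 < N * `|nrm| + 1 by rewrite ltr_wpDl// mulr_ge0.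
  exists (Num.min 1 (nu / 4 / (N * `|nrm| + 1))); split.
  - by rewrite lt_min ltr01 !divr_gt0.
  - by rewrite ge_min lexx.
  - apply: (@le_trans _ _ (nu / 4 / (N * `|nrm| + 1) * (N * `|nrm| + 1))).
      apply: ler_pM; rewrite ?mulr_ge0 ?ge_min ?lexx ?orbT ?lerDl//.
      by rewrite le_min ler01 !divr_ge0 ?(ltW nu0) ?(ltW D0).
    by rewrite divfK// gt_eqF.
have [rg rg0 hg] := gammac clx0 om0.
have [rb rb0 hb] := gc bx0 ltr01.
have [L L0 hL] := H_coercive coerH a.
pose G := Num.max (`|g x0| + 1) (N * (`|gam| + 1) * L).
have G0 : 0 < G by rewrite lt_max; apply/orP; left; rewrite ltr_wpDl.
have [G1 G2] : `|g x0| + 1 <= G /\ N * (`|gam| + 1) * L <= G.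
  by split; rewrite le_max lexx ?orbT.
clearbody G.
have [r [r0 rr1 rrc [rru rrg rrb rG]]] : exists r, [/\ 0 < r, r < r1, r < rc &
    [/\ r < ru, r < rg, r < rb & 2 * r * (G + 1) < T * nu]].
  have G10 : 0 < 2 * (G + 1) by rewrite mulr_gt0// ltr_wpDl// ltW.
  pose mn := Num.min (Num.min r1 rc) (Num.min (Num.min ru rg) (Num.min rb (T * nu / (2 * (G + 1))))).
  have mn0 : 0 < mn.
    by rewrite !lt_min r10 rc0 ru0 rg0 rb0 divr_gt0// mulr_gt0.
  have : mn / 2 < mn by move: mn0; slra.
  rewrite {2}/mn !lt_min ltr_pdivlMr// => /andP[/andP[? ?] /andP[/andP[? ?] /andP[? E]]].
  exists (mn / 2); split => //; first by rewrite divr_gt0.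
  split => //; by rewrite -mulrA mulrCA.
(* With these scalings the variation of the test function on the ball of radius [r] stays bounded as
   [r] shrinks, while its oblique derivative grows like [T nu / r] and exceeds [G]. *)
pose t := T / r; pose C := c0 / r ^+ 2.
have t0 : 0 < t by rewrite divr_gt0.
have rr0 : 0 < r ^+ 2 by rewrite exprn_gt0.
have C0 : 0 < C by rewrite divr_gt0.
have tr : t * r = T by rewrite divfK// gt_eqF.
have Crr : C * r ^+ 2 = c0 by rewrite divfK// gt_eqF.
clearbody t C.
pose B := cl `&` [set y | `|y - x0| <= r].
have cB : compact B by exact: compact_setI_ballr.
have x0B : B x0 by split => //=; rewrite subrr normr0 ltW.
have B0 : B !=set0 by exists x0.
have [x1 [clx1 /= x1r] hx1] : exists2 x1, B x1 & forall y, B y ->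
    (u \- quad C%:M (t *: nrm) x0 0) y <= (u \- quad C%:M (t *: nrm) x0 0) x1.
  apply: usc_max_rV => //; apply: usc_onB; first by apply: usc_subset uu _ => x [].
  exact: cont_on_subset (quad_cont _ _ _ _) (@subsetT _ _).
have {}hx1 y : B y -> u y - C * dotp (y - x0) (y - x0) - t * dotp nrm (y - x0) <=
   u x1 - C * dotp (x1 - x0) (x1 - x0) - t * dotp nrm (x1 - x0).
  by move=> /hx1 /=; rewrite !quad_diag !dotpZl !addr0; slra.
have h01 := hx1 x0 x0B; rewrite subrr !dotp0r !mulr0 !subr0 in h01.
have Cd0 : 0 <= C * dotp (x1 - x0) (x1 - x0) by rewrite mulr_ge0 ?(ltW C0)//; exact: dotp_ge0.
have nOx1 : ~ Omega x1.
  move=> Ox1; have := h1 x1 clx1 (le_lt_trans x1r rr1); rewrite vu// ltr_norml => /andP[_ h2].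
  have h3 : - (t * (N * `|nrm| * r)) <= t * dotp nrm (x1 - x0).
    rewrite -mulrN ler_wpM2l ?(ltW t0)//.
    have := dotp_norm nrm (x1 - x0).
    have : N * `|nrm| * `|x1 - x0| <= N * `|nrm| * r by rewrite ler_wpM2l ?mulr_ge0.
    by rewrite ler_norml; slra.
  have h4 : t * (N * `|nrm| * r) = T * (N * `|nrm|) by rewrite -tr; ring.
  have h5 : 0 <= T * (N * `|nrm|) by rewrite !mulr_ge0// ltW.
  by move: h01 h2 h3 h4 h5 Cd0 TE T0 dlE dl0; rewrite mulrDr mulr1; slra.
have c1 : - (k * `|x1 - x0|) <= dotp nrm (x1 - x0).
  have xc : `|x0 - x0| < rc by rewrite subrr normr0.
  have := hc x1 x0 nOx1 clx0 (le_lt_trans x1r rrc) xc.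
  have -> : x0 - x1 = - (x1 - x0) by rewrite opprB.
  by rewrite dotpNr normrN; slra.
have x1lt : `|x1 - x0| < r.
  rewrite lt_neqAle x1r andbT; apply/eqP => E.
  have h2 := hu x1 clx1 (le_lt_trans x1r rru).
  have h3 : - (c0 / 4) <= t * dotp nrm (x1 - x0).
    apply: (@le_trans _ _ (t * - (k * r))); last by rewrite ler_wpM2l ?(ltW t0)// -E.
    by rewrite mulrN mulrCA tr [k * T]mulrC kE.
  have h4 := ler_wpM2l (ltW C0) (norm_dotp (x1 - x0)); rewrite E Crr in h4.
  by move: h01 h2 h3 h4 e40 c00; slra.
have bx1 : bdry Omega x1 by apply/(bdryE oO).
have [Cq gq] := quad_C1 cl C%:M (t *: nrm) x0 0.
have mx : local_max cl (u \- quad C%:M (t *: nrm) x0 0) x1.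
  apply/local_maxP; exists (r - `|x1 - x0|) => [|y cly yx1]; first by rewrite subr_gt0.
  have yB : B y.
    split => //=; rewrite -(subrK x1 y) -addrA (le_trans (ler_normD _ _))//.
    by move: yx1; slra.
  by have := hx1 y yB; rewrite /= !quad_diag !dotpZl !addr0; slra.
have [_ /(_ bx1)] := usub _ x1 Cq clx1 mx.
rewrite quad_diag_grad /neumann; set p := (2 * C) *: (x1 - x0) + t *: nrm.
have gp : G < dotp (gamma x1) p.
  have gd : `|gamma x1 - gam| <= om by apply/ltW/hg => //; exact: le_lt_trans x1r rrg.
  have E : dotp (gamma x1) p = t * nu + t * dotp (gamma x1 - gam) nrm
      + 2 * C * dotp (gamma x1) (x1 - x0).
    rewrite [LHS](dotpDr ((2 * C) *: (x1 - x0)) (t *: nrm)) !dotpZr [LHS]addrC; congr (_ + _).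
    by rewrite -mulrDr dotpBl /nu [dotp nrm gam]dotpC addrC subrK.
  have h2 : - (t * (nu / 4)) <= t * dotp (gamma x1 - gam) nrm.
    rewrite -mulrN ler_wpM2l ?(ltW t0)//.
    have := dotp_norm (gamma x1 - gam) nrm.
    have : N * `|gamma x1 - gam| * `|nrm| <= om * (N * `|nrm|).
      by rewrite mulrAC mulrC ler_wpM2r// mulr_ge0.
    by move: omE; rewrite ler_norml; slra.
  have ng1 : `|gamma x1| <= `|gam| + 1.
    have := ler_normD gam (gamma x1 - gam); rewrite addrC subrK.
    by move: gd om1; slra.
  have h3 : - (N * (`|gam| + 1) * r) <= dotp (gamma x1) (x1 - x0).
    have := dotp_norm (gamma x1) (x1 - x0).
    have : N * `|gamma x1| * `|x1 - x0| <= N * (`|gam| + 1) * r.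
      by apply: ler_pM => //; rewrite ler_wpM2l.
    by rewrite ler_norml; slra.
  have C20 : 0 <= 2 * C by rewrite mulr_ge0// ltW.
  have h4 := ler_wpM2l C20 h3.
  rewrite -(ltr_pM2l r0); apply: (@lt_le_trans _ _ (T * nu / 2)).
    by move: rG r0; slra.
  rewrite E !mulrDr.
  have h5 := ler_wpM2l (ltW r0) h2; have h6 := ler_wpM2l (ltW r0) h4.
  have e1 : r * (t * nu) = T * nu by rewrite -tr; ring.
  have e2 : r * - (t * (nu / 4)) = - (T * nu / 4) by rewrite -tr; field.
  have e3 : r * (2 * C * - (N * (`|gam| + 1) * r)) = - (2 * c0 * (N * (`|gam| + 1))).
    by rewrite -Crr; ring.
  rewrite e2 in h5; rewrite e3 in h6; rewrite e1.
  by move: h5 h6 c0E c00; rewrite [8 * c0 * _]mulrDr mulr1; slra.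
have ng1 : `|gamma x1| <= `|gam| + 1.
  have gd : `|gamma x1 - gam| <= om by apply/ltW/hg => //; exact: le_lt_trans x1r rrg.
  have := ler_normD gam (gamma x1 - gam); rewrite addrC subrK.
  by move: gd om1; slra.
rewrite ge_min !subr_le0 => /orP[/hL pL|gpx].
  have := pL clx1 => {}pL.
  have := dotp_norm (gamma x1) p; rewrite ler_norml => /andP[_ h2].
  have : N * `|gamma x1| * `|p| <= N * (`|gam| + 1) * L.
    by apply: ler_pM => //; rewrite ler_wpM2l.
  by move: h2 gp G2; slra.
have : `|g x1 - g x0| < 1 by apply: hb => //; exact: le_lt_trans x1r rrb.
by have := ler_norm (g x0); move: gpx gp G1; rewrite ltr_norml; slra.
Qed.

(** The oblique doubling needs a subsolution continuous up to the boundary; [neumann_sub_cont]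
    provides this by identifying [u] with the extension of its interior values. At an interior
    maximum of [u - w] the shift argument applies with zero direction. *)
Lemma comparison_neumann (u w : 'rV[R]_m -> R) a a' :
  subsolution Omega H (neumann gamma g) a' u ->
  supersolution Omega H (neumann gamma g) a w -> a <= a'.
Proof.
move=> su sw; have [uu usub] := su; have [wl wsup] := sw.
have [L L0 hL] := subsolution_segLip a'.
have usubO phi x : C1_closed cl phi -> Omega x -> local_max cl (u \- phi) x ->
    H x (grad phi x) <= a'.
  by move=> C Ox /(usub _ _ C (subset_closure Ox))[+ _]; exact.
have uL := hL u uu usubO.
have [v [vc vu vL]] := segLip_extension oO L0 cone_inner_dir uL.
have uE := neumann_sub_cont su vc vu.
have uc : cont_on cl u.
  move=> x clx e e0; have [d d0 hd] := vc x clx e e0; exists d => // y cly yx.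
  by rewrite !uE//; exact: hd.
have [z clz zmax] := usc_max_rV cO O0 (usc_onB_lsc uu wl).
have [Oz|bz] := cl_cases oO clz.
  have [r [r0 hr]] := interior_shift Oz.
  apply: (comparison_shift oO cO O0 contH coerH uc wl clz (conj r0 hr)) => // phi y C cly yz mn.
  have [+ _] := wsup _ _ C cly mn; apply.
  have r20 : 0 < r / 2 by rewrite divr_gt0.
  have r2r : r / 2 < r by move: r0; slra.
  by have := hr y cly yz _ r20 r2r; rewrite scaler0 addr0.
have [nrm cz nu0] := cone bz.
exact: (comparison_oblique oO cO contH gammac gc L0 uc uL bz cz nu0 su sw zmax).
Qed.

End Comparison.

(** * Geometry of graph boundaries *)

Section BoundaryGeometry.
Variables (R : realType) (n : nat).
Implicit Types (x y z e u v : 'rV[R]_n.+1) (r s t d k eps : R).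
Implicit Types (Q : 'M[R]_n.+1) (b : 'rV[R]_n -> R).
Variable Omega : set 'rV[R]_n.+1.
Local Notation cl := (closure Omega).
Local Notation N := (n.+1%:R : R).
Hypothesis oO : open Omega.

Lemma enorm_le u : enorm u <= N * `|u|.
Proof.
rewrite /enorm -[leRHS]ger0_norm ?mulr_ge0// -sqrtr_sqr ler_wsqrtr//.
apply: (le_trans (dotp_le u)); rewrite exprMn ler_wpM2r ?sqr_ge0// expr2 ler_peMl//.
by rewrite ler1n.
Qed.

Lemma enorm_lt u r : N * `|u| < r -> enorm u < r.
Proof. exact/le_lt_trans/enorm_le. Qed.

Lemma col'_norm i u : `|col' i u| <= `|u|.
Proof. by apply: norm_le_entries => // j; rewrite mxE; exact: le_entry_norm. Qed.

Lemma col'B i u v : col' i (u - v) = col' i u - col' i v.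
Proof. by apply/rowP => j; rewrite !mxE. Qed.

Lemma local_graph_closure (j : nat) z r Q b x : local_graph j Omega z r Q b -> cl x ->
  enorm (x - z) < r -> b (col' ord_max (x *m Q)) <= (x *m Q) 0 ord_max.
Proof.
move=> [r0 QQ bC gr] clx xz; rewrite leNgt; apply/negP => lt.
have bc := Ck_cont_on bC.
pose gap := (b (col' ord_max (x *m Q)) - (x *m Q) 0 ord_max) / 2.
have gap0 : 0 < gap by rewrite divr_gt0// subr_gt0.
have [d d0 hd] := bc (col' ord_max (x *m Q)) I _ gap0.
have [C C0 hC] := mulmx_norm Q.
have rx0 : 0 < (r - enorm (x - z)) by rewrite subr_gt0.
have N0 : 0 < N by rewrite ltr0n.
have [s s0 hs] : exists2 s, 0 < s & forall y, `|y - x| < s -> enorm (y - z) < r.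
  have ec : forall y, dotp (y - z) (y - z) < r ^+ 2 -> enorm (y - z) < r.
    move=> y h; rewrite /enorm -[ltRHS]gtr0_norm// -sqrtr_sqr ltr_sqrt//.
    by rewrite exprn_gt0.
  have xr : dotp (x - z) (x - z) < r ^+ 2.
    have := xz; rewrite /enorm -[ltRHS]gtr0_norm// -sqrtr_sqr ltr_sqrt//.
    by rewrite exprn_gt0.
  have e0 : 0 < r ^+ 2 - dotp (x - z) (x - z) by rewrite subr_gt0.
  have [s s0 hs] := @quad_cont _ _ (1 : R)%:M 0 z 0 x I _ e0.
  exists s => // y yx; apply: ec; have := hs y I yx.
  by rewrite !quad_diag !dotp0l !addr0 !mul1r ltr_norml => /andP[_]; rewrite ltrD2r.
pose t := Num.min s (Num.min (d / C) (gap / C)).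
have t0 : 0 < t by rewrite !lt_min s0 (divr_gt0 d0 C0) (divr_gt0 gap0 C0).
have [y Oy] := (closureP_rV _ _).1 clx t t0.
rewrite !lt_min !ltr_pdivlMr// => /and3P[ys yd yg].
have := (gr y (hs y ys)).1 Oy.
have nQ : `|y *m Q - x *m Q| <= `|y - x| * C by rewrite -mulmxBl mulrC.
have := hd (col' ord_max (y *m Q)) I; rewrite -col'B => h.
have {}h := h (le_lt_trans (le_trans (col'_norm _ _) nQ) yd).
have eB : (y *m Q - x *m Q) 0 ord_max = (y *m Q) 0 ord_max - (x *m Q) 0 ord_max.
  by rewrite [LHS]mxE [X in _ + X]mxE.
have := le_trans (le_entry_norm (y *m Q - x *m Q) ord_max) nQ; rewrite eB.
move: h yg; rewrite ltr_norml ler_norml /gap.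
move: ((y *m Q) 0 ord_max) ((x *m Q) 0 ord_max) => Y X; lra.
Qed.

(** Raising the last graph coordinate turns the weak inequality valid on the closure into the strict
    one that defines Omega. *)
Lemma C0_inner_dir : Ck_boundary 0 Omega -> inner_dir Omega.
Proof.
move=> Cb z clz; have [Oz|bz] := cl_cases oO clz.
  by have [r hr] := interior_shift oO Oz; exists 0, r.
have [r [Q [b lg]]] := Cb z bz; have [r0 QQ bC gr] := lg.
pose e : 'rV[R]_n.+1 := delta_mx 0 ord_max *m Q^T.
have N0 : 0 < N by rewrite ltr0n.
have D0 : 0 < N * (`|e| + 1) by rewrite mulr_gt0// ltr_wpDl.
have D1 : 0 < N * (`|e| + 2) by rewrite mulr_gt0// ltr_wpDl.
exists e, (r / (N * (`|e| + 2))); split=> [|x clx]; first by rewrite divr_gt0.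
rewrite ltr_pdivlMr// => xz s s0; rewrite ltr_pdivlMr// => sr.
have ne : 0 <= `|e| by [].
have NX : `|x - z| * N <= `|x - z| * (N * (`|e| + 2)).
  by rewrite ler_wpM2l// ler_peMr ?(ltW N0)//; lra.
have xr : enorm (x - z) < r by apply: enorm_lt; rewrite mulrC; exact: le_lt_trans xz.
have hx := local_graph_closure lg clx xr.
have eQ : e *m Q = delta_mx 0 ord_max.
  by rewrite -mulmxA (mulmx1C QQ) mulmx1.
apply/gr.
  apply: enorm_lt; have -> : x + s *: e - z = (x - z) + s *: e by vring.
  apply: (@le_lt_trans _ _ (N * (`|x - z| + s * `|e|))).
    by rewrite ler_wpM2l// (le_trans (ler_normD _ _))// normrZ gtr0_norm.
  have [h|h] := leP `|x - z| s.
    apply: le_lt_trans sr; have -> : s * (N * (`|e| + 2)) = N * (s + s * `|e|) + N * s by ring.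
    rewrite ler_wpDr ?mulr_ge0 ?(ltW s0)// ler_wpM2l// lerD2r//.
  apply: le_lt_trans xz.
  have -> : `|x - z| * (N * (`|e| + 2)) = N * (`|x - z| + `|x - z| * `|e|) + N * `|x - z| by ring.
  by rewrite ler_wpDr ?mulr_ge0// ler_wpM2l// lerD2l ler_wpM2r// ltW.
have xsQ : (x + s *: e) *m Q = x *m Q + s *: delta_mx 0 ord_max.
  by rewrite mulmxDl -scalemxAl eQ.
have -> : col' ord_max ((x + s *: e) *m Q) = col' ord_max (x *m Q).
  apply/rowP => j; rewrite xsQ [LHS]mxE [RHS]mxE [LHS]mxE [X in _ + X]mxE.
  rewrite [X in s * X]mxE eqxx /= (_ : (lift ord_max j == ord_max) = false) ?mulr0 ?addr0//.
  by apply/negbTE; rewrite eq_sym neq_lift.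
rewrite xsQ [X in _ < X]mxE [X in _ + X]mxE [X in s * X]mxE !eqxx mulr1.
by apply: le_lt_trans hx _; rewrite ltrDl.
Qed.

Lemma dotp_graph_normal b y v : dotp (graph_normal b y) v =
  dotp (grad b (col' ord_max y)) (col' ord_max v) - v 0 ord_max.
Proof.
rewrite /dotp big_ord_recr /=; congr (_ + _); last first.
  by rewrite mxE unlift_none mulN1r.
apply: eq_bigr => i _.
have -> : widen_ord (leqnSn n) i = lift ord_max i.
  by apply: val_inj; rewrite /= /bump leqNgt ltn_ord.
by rewrite [graph_normal _ _ _ _]mxE liftK [col' _ v _ _]mxE.
Qed.

Lemma graph_normal_neq0 b y : 0 < enorm (graph_normal b y).
Proof.
rewrite /enorm sqrtr_gt0; apply: lt_le_trans (norm_dotp _).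
rewrite exprn_gt0// normr_gt0; apply/eqP => /rowP /(_ ord_max).
by rewrite !mxE unlift_none => /eqP; rewrite oppr_eq0 oner_eq0.
Qed.

(** Strict differentiability of the graph function at the one point [z] compares its values at
    arbitrary pairs of nearby points. This makes the cone condition uniform in the apex [x]. *)
Lemma C1_inner_cone (gamma : 'rV[R]_n.+1 -> 'rV[R]_n.+1) : Ck_boundary 1 Omega ->
  (forall x nu, bdry Omega x -> outer_unit_normal Omega x nu ->
     0 < dotp nu (gamma x)) ->
  forall z, bdry Omega z ->
  exists2 nrm, inner_cone Omega z nrm & 0 < dotp nrm (gamma z).
Proof.
move=> Cb ng z bz; have [r [Q [b lg]]] := Cb z bz; have [r0 QQ bC gr] := lg.
pose M := graph_normal b (z *m Q).
exists (M *m Q^T); last first.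
  have M0 := graph_normal_neq0 b (z *m Q).
  have := ng z ((enorm M)^-1 *: (M *m Q^T)) bz; rewrite dotpZl pmulr_rgt0 ?invr_gt0//; apply.
  by exists r, Q, b.
move=> k k0; have [C C0 hC] := mulmx_norm Q.
have k'0 : 0 < k / C by rewrite divr_gt0.
have [d d0 hd] := Ck1_strict_diff openT bC I k'0 (x := col' ord_max (z *m Q)).
have N0 : 0 < N by rewrite ltr0n.
exists (Num.min (r / N) (d / C)) => [|x y clx]; first by rewrite lt_min !divr_gt0.
rewrite !lt_min !ltr_pdivlMr// => /andP[xr xd] /andP[yr yd] h.
have hx : b (col' ord_max (x *m Q)) <= (x *m Q) 0 ord_max.
  by apply: (local_graph_closure lg clx); apply: enorm_lt; rewrite mulrC.
apply/gr; first by apply: enorm_lt; rewrite mulrC.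
have nQ v : `|col' ord_max (v *m Q)| <= C * `|v|.
  exact: le_trans (col'_norm _ _) (hC v).
have h1 := hd (col' ord_max (x *m Q)) (col' ord_max (y *m Q)).
rewrite -!col'B -!mulmxBl in h1.
have {}h1 : `|b (col' ord_max (y *m Q)) - b (col' ord_max (x *m Q)) -
   dotp (grad b (col' ord_max (z *m Q))) (col' ord_max ((y - x) *m Q))| <=
    k / C * `|col' ord_max ((y - x) *m Q)|.
  by apply: h1; apply: le_lt_trans (nQ _) _; rewrite mulrC.
have h2 : k / C * `|col' ord_max ((y - x) *m Q)| <= k * `|y - x|.
  apply: (le_trans (ler_wpM2l (ltW k'0) (nQ _))).
  by rewrite mulrA divfK// gt_eqF.
move: h; rewrite dotp_mulmx trmxK dotp_graph_normal.
have -> : ((y - x) *m Q) 0 ord_max = (y *m Q) 0 ord_max - (x *m Q) 0 ord_max.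
  by rewrite mulmxBl [LHS]mxE [X in _ + X]mxE.
move: h1; rewrite ler_norml; lra.
Qed.

End BoundaryGeometry.

Section BoundedDomain.
Variables (R : realType) (m : nat) (Omega : set 'rV[R]_m).

Lemma bounded_domain_compact : bounded_domain Omega -> compact (closure Omega).
Proof.
move=> [_ _ _ bO]; apply: bounded_closed_compact; last exact: closed_closure.
move: bO => [M [_ hM]]; exists (M + 1); split; first exact: num_real.
move=> M' MM' x /closureP_rV clx /=; apply/ler_addgt0Pr => e e0.
have [y Oy yx] := clx e e0.
have : `|y| <= M' by apply: hM Oy; lra.
have := ler_normB y (y - x); rewrite opprB addrC subrK; lra.
Qed.

End BoundedDomain.

(** A ray from a point of Omega must leave the bounded set; its first exit point is on the
    boundary. *)
Lemma bdry_nonempty (R : realType) (n : nat) (Omega : set 'rV[R]_n.+1) :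
  bounded_domain Omega -> bdry Omega !=set0.
Proof.
move=> [oO cO [x Ox] [M [_ hM]]].
pose e : 'rV[R]_n.+1 := delta_mx 0 ord0.
have e1 : `|e| = 1.
  apply/eqP; rewrite eq_le norm_delta_le1/=.
  by have := le_entry_norm e ord0; rewrite mxE eqxx normr1.
have notO t : `|x| + `|M| + 1 < t -> ~ Omega (x + t *: e).
  move=> h Ot; have : `|x + t *: e| <= `|M| + 1.
    by apply: hM Ot; have := ler_norm M; lra.
  have := ler_normB (t *: e + x) x; rewrite addrK [t *: e + x]addrC normrZ e1 mulr1.
  have := ler_norm t; lra.
pose S := [set t | 0 <= t /\ forall s : R, 0 <= s -> s <= t -> Omega (x + s *: e)].
have S0 : S 0.
  split => // s s0 s0'; have -> : s = 0 by apply/le_anti; rewrite s0 s0'.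
  by rewrite scale0r addr0.
have sS : has_sup S.
  split; first by exists 0.
  exists (`|x| + `|M| + 1) => t [t0 ht]; rewrite leNgt; apply/negP => h.
  exact: (notO t h (ht t t0 (lexx t))).
pose T := sup S.
have T0 : 0 <= T by apply: ub_le_sup; [exact: sS.2|].
have below s : 0 <= s -> s < T -> Omega (x + s *: e).
  move=> s0 sT; have ds : 0 < T - s by rewrite subr_gt0.
  have [t [t0 ht] st] := sup_adherent ds sS.
  by apply: ht => //; apply/ltW; move: st; rewrite -/T; lra.
exists (x + T *: e); apply/(bdryE oO); split.
  apply/closureP_rV => r r0; have [T00|T00] := eqVneq T 0.
    by exists x => //; rewrite T00 scale0r addr0 subrr normr0.
  have Tp : 0 < T by rewrite lt_neqAle eq_sym T00.
  pose s := Num.max 0 (T - r / 2).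
  exists (x + s *: e).
    by apply: below; rewrite /s ?le_max ?lexx// gt_max Tp/=; lra.
  have -> : x + s *: e - (x + T *: e) = (s - T) *: e by vring.
  rewrite normrZ e1 mulr1 ltr_norml.
  have : s < T by rewrite /s gt_max Tp/=; lra.
  have : T - r / 2 <= s by rewrite /s le_max lexx orbT.
  lra.
move=> OT; have [r r0 hr] := (openP_rV _).1 oO _ OT.
have : S (T + r / 2).
  split=> [|s s0 sT]; first by lra.
  have [h|h] := ltP s T; first exact: below.
  apply: hr; have -> : x + s *: e - (x + T *: e) = (s - T) *: e by vring.
  rewrite normrZ e1 mulr1 ltr_norml; lra.
move=> /(ub_le_sup sS.2); rewrite -/T; lra.
Qed.

(** * Existence *)

Section UltraLimits.
Variable R : realType.

(** The limit is the supremum of the levels that [f] reaches on a set of [F]; an ultrafilter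
    contains either a set or its complement, which gives the upper bound. *)
Lemma ultra_bounded_lim (I : Type) (F : set_system I) (f : I -> R) (M : R) :
  UltraFilter F -> (forall i, `|f i| <= M) ->
  exists l, forall e, 0 < e -> F [set i | `|f i - l| < e].
Proof.
move=> UF fM; have PF : ProperFilter F := ultra_proper.
pose S := [set t | F [set i | t <= f i]].
have M0 i : - M <= f i <= M by rewrite -ler_norml.
have sS : has_sup S.
  split.
    exists (- M); rewrite /S /= (_ : [set i | _] = setT); first exact: filterT.
    by apply/seteqP; split => // i _ /=; case/andP: (M0 i).
  exists M => t /filter_ex[i /= ti]; apply: le_trans ti _.
  by case/andP: (M0 i).
exists (sup S) => e e0.
have [t tS tl] := sup_adherent e0 sS.
have up : F [set i | f i < sup S + e / 2].
  have [//|h] := in_ultra_setVsetC [set i | f i < sup S + e / 2] UF.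
  have : S (sup S + e / 2).
    rewrite /S /= (_ : [set i | _] = ~` [set i | f i < sup S + e / 2])//.
    by apply/seteqP; split => i /=; [move=> h1; apply/negP; rewrite -leNgt|move/negP; rewrite -leNgt].
  by move=> /(ub_le_sup sS.2); lra.
apply: filterS (filterI tS up) => i /= [h1 h2]; rewrite ltr_norml; lra.
Qed.

End UltraLimits.

(** * The discounted problem and the vanishing discount limit *)

Section Existence.
Variables (R : realType) (m : nat).
Implicit Types (x y z p q : 'rV[R]_m) (r s t d eps a b L C lam : R).
Implicit Types (u v w : 'rV[R]_m -> R).
Variable Omega : set 'rV[R]_m.
Local Notation cl := (closure Omega).
Hypothesis oO : open Omega.
Hypothesis cO : compact cl.

(** The boundary operator [be] does not see the value [r], which covers (E-N) and (E-SC); the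
    discount is the only dependence on the value. *)
Definition sub_cond (H be : 'rV[R]_m -> 'rV[R]_m -> R) lam a x r p :=
  (Omega x -> lam * r + H x p <= a) /\
  (bdry Omega x -> Num.min (lam * r + H x p - a) (be x p) <= 0).

Definition super_cond (H be : 'rV[R]_m -> 'rV[R]_m -> R) lam a x r p :=
  (Omega x -> a <= lam * r + H x p) /\
  (bdry Omega x -> 0 <= Num.max (lam * r + H x p - a) (be x p)).

Definition pair_cont (A : set 'rV[R]_m) (H : 'rV[R]_m -> 'rV[R]_m -> R) :=
  forall x p, A x -> forall eps, 0 < eps -> exists2 d, 0 < d &
  forall y q, A y -> `|y - x| < d -> `|q - p| < d -> `|H y q - H x p| < eps.

Lemma pair_contN A H : pair_cont A H -> pair_cont A (fun x p => - H x (- p)).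
Proof.
move=> h x p Ax eps eps0; have [d d0 hd] := h x (- p) Ax eps eps0.
exists d => // y q Ay yx qp; rewrite -opprD normrN; apply: hd => //.
by rewrite -opprD normrN.
Qed.

(** With [eps = 0] this is the closedness required by Perron's method; the slack serves the limit of
    vanishing discount, where the constant converges to [a]. *)
Lemma sub_cond_closed H be lam a x0 r0 p0 : 0 <= lam ->
  pair_cont cl H -> pair_cont (bdry Omega) be -> cl x0 ->
  ~ sub_cond H be lam a x0 r0 p0 -> exists2 d, 0 < d &
  forall x r p eps, cl x -> `|x - x0| < d -> `|r - r0| < d -> `|p - p0| < d ->
    0 <= eps -> eps < d -> ~ sub_cond H be lam (a + eps) x r p.
Proof.
move=> lam0 Hc bc clx0 nE.
have gap0 : 0 < lam * r0 + H x0 p0 - a.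
  rewrite subr_gt0 ltNge; apply/negP => h; apply: nE; split => // _.
  by rewrite ge_min subr_le0 h.
set gap := _ - a in gap0.
have e0 : 0 < gap / 4 by rewrite divr_gt0.
have [dH dH0 hdH] := Hc x0 p0 clx0 _ e0.
have D0 : 0 < lam + 1 by rewrite ltr_wpDl.
have [db db0 hdb] : exists2 d, 0 < d & forall x p, bdry Omega x -> `|x - x0| < d ->
    `|p - p0| < d -> 0 < be x p.
  have [Ox0|bx0] := cl_cases oO clx0.
    have [d d0 hd] := (openP_rV _).1 oO x0 Ox0; exists d => // x p bx /hd Ox.
    by have [] := (bdryE oO x).1 bx.
  have be0 : 0 < be x0 p0.
    rewrite ltNge; apply/negP => h; apply: nE; split; last by rewrite ge_min h orbT.
    by have [_ nO] := (bdryE oO x0).1 bx0.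
  have [d d0 hd] := bc x0 p0 bx0 _ be0; exists d => // x p bx xx pp.
  by have := hd x p bx xx pp; rewrite ltr_norml; lra.
exists (Num.min (Num.min dH db) (Num.min (gap / 4 / (lam + 1)) (gap / 4))).
  by rewrite !lt_min dH0 db0 e0 divr_gt0.
move=> x r p eps clx; rewrite !lt_min => /andP[/andP[x1 x2] _].
rewrite ltr_pdivlMr// => /andP[_ /andP[r1 _]] /andP[/andP[p1 p2] _] eps0.
move=> /andP[_ /andP[_ epsg]] [E1 E2].
have hH := hdH x p clx x1 p1.
have hr : `|lam * r - lam * r0| < gap / 4.
  rewrite -mulrBr normrM (ger0_norm lam0); apply: le_lt_trans r1.
  by rewrite mulrC ler_wpM2l// lerDl.
have pos : 0 < lam * r + H x p - (a + eps).
  have gE : lam * r0 + H x0 p0 - a = gap by [].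
  by move: hH hr; rewrite !ltr_norml; clearbody gap; lra.
have [/E1|bx] := cl_cases oO clx; first by move: pos; lra.
by have := E2 bx; rewrite leNgt lt_min pos (hdb x p bx x2 p2).
Qed.

Lemma super_cond_opp H be lam a x r p : super_cond H be lam a x r p <->
  sub_cond (fun x p => - H x (- p)) (fun x p => - be x (- p)) lam (- a) x (- r) (- p).
Proof.
have E : lam * - r + - H x (- - p) = - (lam * r + H x p) by rewrite opprK mulrN opprD.
have E2 : Num.min (lam * - r + - H x (- - p) - - a) (- be x (- - p)) =
    - Num.max (lam * r + H x p - a) (be x p).
  by rewrite E oppr_max !opprK opprB addrC.
by rewrite /super_cond /sub_cond E2 E lerN2 oppr_le0.
Qed.

Lemma super_cond_closed H be lam a x0 r0 p0 : 0 <= lam ->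
  pair_cont cl H -> pair_cont (bdry Omega) be -> cl x0 ->
  ~ super_cond H be lam a x0 r0 p0 -> exists2 d, 0 < d &
  forall x r p eps, cl x -> `|x - x0| < d -> `|r - r0| < d -> `|p - p0| < d ->
    0 <= eps -> eps < d -> ~ super_cond H be lam (a - eps) x r p.
Proof.
move=> lam0 Hc bc clx0 nE.
have [] := @sub_cond_closed (fun x p => - H x (- p)) (fun x p => - be x (- p))
  lam (- a) x0 (- r0) (- p0) lam0 (pair_contN Hc) (pair_contN bc) clx0.
  by move=> h; apply: nE; apply/super_cond_opp.
move=> d d0 hd; exists d => // x r p eps clx xx rr pp eps0 epsd /super_cond_opp.
rewrite opprB addrC; apply: hd => //.
  by rewrite -opprD normrN.
by rewrite -opprD normrN.
Qed.

(* Where the supersolution condition fails, a smooth function is locally a strict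
   classical subsolution, hence satisfies the viscosity one at nearby points. *)
Lemma not_super_cond_bump H be lam a phi x0 r0 : 0 <= lam ->
  pair_cont cl H -> pair_cont (bdry Omega) be ->
  (forall phi psi x, bdry Omega x -> C1_closed cl phi -> C1_closed cl psi ->
     local_max cl (phi \- psi) x -> be x (grad psi x) <= be x (grad phi x)) ->
  C1_closed cl phi -> cl x0 -> ~ super_cond H be lam a x0 r0 (grad phi x0) ->
  exists2 d, 0 < d & forall x r, cl x -> `|x - x0| < d -> `|r - r0| < d ->
    forall psi, C1_closed cl psi -> local_max cl (phi \- psi) x ->
      sub_cond H be lam a x r (grad psi x).
Proof.
move=> lam0 Hc bc mono C clx0 nG.
have [d d0 hd] := super_cond_closed lam0 Hc bc clx0 nG.
have [d' d'0 hd'] := C1_closed_gradcont C clx0 d0.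
exists (Num.min d d') => [|x r clx]; first by rewrite lt_min d0.
rewrite !lt_min => /andP[xd xd'] /andP[rd _] psi Cpsi mx.
have nS := hd x r (grad phi x) 0 clx xd rd (hd' x clx xd') (lexx _) d0.
rewrite subr0 in nS.
have lt : lam * r + H x (grad phi x) < a.
  rewrite ltNge; apply/negP => h; apply: nS; split => // _.
  by rewrite le_max subr_ge0 h.
split=> [Ox|bx].
  rewrite -(test_grad_eq C Cpsi _ mx); first exact: ltW.
  have [s s0 hs] := (openP_rV _).1 oO x Ox.
  by apply/nbhs_rVP; exists s => // y /hs; exact: subset_closure.
have blt : be x (grad phi x) < 0.
  rewrite ltNge; apply/negP => h; apply: nS; split; last by rewrite le_max h orbT.
  by have [_ nO] := (bdryE oO x).1 bx.
by rewrite ge_min (le_trans (mono _ _ _ bx C Cpsi mx) (ltW blt)) orbT.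
Qed.

(** Not every point is touched by a test function, but a steep paraboloid centred at [y] touches [w]
    at some point [x] of Omega near [y] with [w y <= w x]. *)
Lemma test_value_bound (w : 'rV[R]_m -> R) M : usc_on cl w ->
  (forall phi x, C1_closed cl phi -> Omega x -> local_max cl (w \- phi) x -> w x <= M) ->
  forall y, Omega y -> w y <= M.
Proof.
move=> uw hw y Oy; have [rho rho0 hrho] := (openP_rV _).1 oO y Oy.
have cl0 : cl !=set0 by exists y; exact: subset_closure.
have [xM clxM hM] := usc_max_rV cO cl0 uw.
have rr0 : 0 < rho ^+ 2 by rewrite exprn_gt0.
pose b := (w xM - w y) / rho ^+ 2 + 1.
have wy := hM y (subset_closure Oy).
have b0 : 0 < b by rewrite ltr_wpDl// divr_ge0 ?(ltW rr0)// subr_ge0.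
have bE : b * rho ^+ 2 = w xM - w y + rho ^+ 2 by rewrite /b mulrDl mul1r divfK ?gt_eqF.
clearbody b.
have [C g] := quad_C1 cl b%:M 0 y 0.
have [x clx hx] := usc_max_rV cO cl0 (usc_onB uw (C1_closed_cont C)).
have {}hx x' : cl x' -> w x' - b * dotp (x' - y) (x' - y) <= w x - b * dotp (x - y) (x - y).
  by move=> /hx /=; rewrite !quad_diag !dotp0l !addr0.
have := hx y (subset_closure Oy); rewrite subrr dotp0l mulr0 subr0 => h.
have bd := ler_wpM2l (ltW b0) (norm_dotp (x - y)).
have b1 : 0 <= b * `|x - y| ^+ 2 by rewrite mulr_ge0 ?sqr_ge0 ?(ltW b0).
have wx := hM x clx.
have Ox : Omega x.
  apply: hrho; have : b * `|x - y| ^+ 2 < b * rho ^+ 2 by rewrite bE; lra.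
  by rewrite ltr_pM2l// ltr_pXn2r ?nnegrE ?normr_ge0 ?(ltW rho0).
have : w x <= M.
  apply: (hw _ x C Ox); apply/local_maxP; exists 1 => // x' clx' _ /=.
  by rewrite !quad_diag !dotp0l !addr0; exact: hx.
lra.
Qed.

Lemma cont_closure_le (w : 'rV[R]_m -> R) M : cont_on cl w ->
  (forall y, Omega y -> w y <= M) -> forall y, cl y -> w y <= M.
Proof.
move=> wc hw y cly; apply/ler_addgt0Pr => e e0.
have [d d0 hd] := wc y cly e e0; have [x Ox xy] := (closureP_rV _ _).1 cly d d0.
by have := hd x (subset_closure Ox) xy; have := hw x Ox; rewrite ltr_norml; lra.
Qed.

Variables (H be : 'rV[R]_m -> 'rV[R]_m -> R).
Hypothesis O0 : Omega !=set0.
Hypothesis connO : connected Omega.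
Hypothesis dO : inner_dir Omega.
Hypothesis contH : {within [set xp : 'rV[R]_m * 'rV[R]_m | cl xp.1],
  continuous (fun xp => H xp.1 xp.2)}.
Hypothesis coerH : coercive Omega H.
Hypothesis bec : pair_cont (bdry Omega) be.
Hypothesis mono : forall phi psi x, bdry Omega x -> C1_closed cl phi ->
  C1_closed cl psi -> local_max cl (phi \- psi) x ->
  be x (grad psi x) <= be x (grad phi x).

Let cl0 : cl !=set0.
Proof. by have [x Ox] := O0; exists x; exact: subset_closure. Qed.

Let Hc : pair_cont cl H.
Proof. by move=> x p clx; exact: H_cont. Qed.

Let B : 'rV[R]_m -> R -> 'rV[R]_m -> R := fun x _ p => be x p.

Lemma subsolution_vsub a v : subsolution Omega H B a v <->
  usc_on cl v /\ vsub cl (sub_cond H be 0 a) v.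
Proof.
by split=> -[uv h]; split => // phi x C clx mx; have := h phi x C clx mx;
  rewrite /sub_cond mul0r add0r.
Qed.

Lemma supersolution_vsuper a v : supersolution Omega H B a v <->
  lsc_on cl v /\ vsuper cl (super_cond H be 0 a) v.
Proof.
by split=> -[uv h]; split => // phi x C clx mx; have := h phi x C clx mx;
  rewrite /super_cond mul0r add0r.
Qed.

Lemma vsub_shift E E' (w : 'rV[R]_m -> R) c :
  (forall x p, cl x -> E x (w x) p -> E' x (w x + c) p) ->
  vsub cl E w -> vsub cl E' (fun x => w x + c).
Proof.
move=> EE h phi x C clx mx; apply: EE => //; apply: h => //.
case/local_maxP : mx => r r0 hr; apply/local_maxP; exists r => // y cly /(hr y cly) /=.
lra.
Qed.

Lemma vsuper_shift G G' (w : 'rV[R]_m -> R) c :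
  (forall x p, cl x -> G x (w x) p -> G' x (w x + c) p) ->
  vsuper cl G w -> vsuper cl G' (fun x => w x + c).
Proof.
move=> EE h phi x C clx mx; apply: EE => //; apply: h => //.
case/local_minP : mx => r r0 hr; apply/local_minP; exists r => // y cly /(hr y cly) /=.
lra.
Qed.

Lemma segLip_shift L (w : 'rV[R]_m -> R) c : segLip Omega L w ->
  segLip Omega L (fun x => w x + c).
Proof. by move=> h x y seg; have := h x y seg; rewrite opprD addrACA subrr addr0. Qed.

Lemma cont_on_shift (w : 'rV[R]_m -> R) c : cont_on cl w ->
  cont_on cl (fun x => w x + c).
Proof.
move=> h x clx e e0; have [d d0 hd] := h x clx e e0; exists d => // y cly yx.
by rewrite opprD addrACA subrr addr0; exact: hd.
Qed.

Lemma cont_on_bounded (w : 'rV[R]_m -> R) : cont_on cl w ->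
  exists2 C, 0 <= C & forall x, cl x -> `|w x| <= C.
Proof.
move=> wc; have [x1 cx1 h1] := usc_max_rV cO cl0 (cont_usc wc).
have [x2 cx2 h2] := usc_max_rV cO cl0 (cont_usc (cont_onN wc)).
exists (Num.max `|w x1| `|w x2|) => [|x clx]; first by rewrite le_max normr_ge0.
rewrite ler_norml; apply/andP; split.
  rewrite lerNl; apply: (le_trans (h2 x clx)).
  by rewrite le_max -[X in _ || (_ <= X)]normrN ler_norm orbT.
by apply: (le_trans (h1 x clx)); rewrite le_max ler_norm.
Qed.

(** The bounds are uniform in [lam]: a shift of [w0] bounds [lam v] below by [- C1], the minimum of
    [H] bounds it above, and the equation then gives [H <= C1] at test points, hence one Lipschitz
    constant. *)
Lemma discounted_solution a0 w0 : cont_on cl w0 -> vsub cl (sub_cond H be 0 a0) w0 ->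
  exists C L, [/\ 0 <= C, 0 <= L & forall lam, 0 < lam -> lam <= 1 -> exists v,
    [/\ cont_on cl v, segLip Omega L v, vsub cl (sub_cond H be lam 0) v,
        vsuper cl (super_cond H be lam 0) v &
        forall x, cl x -> `|lam * v x| <= C]].
Proof.
move=> w0c w0s; have [C0 C00 hC0] := cont_on_bounded w0c.
pose C1 := 2 * C0 + `|a0|.
have [Hm hHm] := H_min cO cl0 contH coerH.
have [L L0 hL] := subsolution_segLip oO cO coerH C1.
exists (Num.max C1 `|Hm|), L; split => //; first by rewrite le_max normr_ge0 orbT.
move=> lam lam0 lam1.
(* This makes [lam * wl <= - |a0|], which absorbs the constant [a0] and turns [wl] into a
   subsolution of the discounted problem. *)
pose c := - C0 - `|a0| / lam.
pose wl x := w0 x + c.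
have lc x : cl x -> - C1 <= lam * wl x /\ lam * wl x <= - `|a0|.
  move=> clx; have := hC0 x clx; rewrite ler_norml => /andP[b1 b2].
  have -> : lam * wl x = lam * (w0 x - C0) - `|a0|.
    by rewrite /wl /c; field; rewrite gt_eqF.
  have h1 : lam * (w0 x - C0) <= 0 by rewrite pmulr_rle0// subr_le0.
  have h2 : - (2 * C0) <= lam * (w0 x - C0).
    have : lam * (2 * C0) <= 1 * (2 * C0) by rewrite ler_wpM2r// mulr_ge0.
    have : lam * - (2 * C0) <= lam * (w0 x - C0) by rewrite ler_pM2l//; lra.
    lra.
  by rewrite /C1; split; lra.
have wls : vsub cl (sub_cond H be lam 0) wl.
  apply: vsub_shift w0s => x p clx; rewrite /sub_cond mul0r add0r.
  have [_ h] := lc x clx; rewrite /wl in h; have := ler_norm a0 => h'.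
  move=> [h1 h2]; split=> [/h1|/h2]; first by lra.
  rewrite !ge_min => /orP[h3|->]; last by rewrite orbT.
  by apply/orP; left; lra.
pose S := perron_class cl (sub_cond H be lam 0) set0 w0 wl.
have SL w : S w -> segLip Omega L w.
  move=> [wc wE ww _]; apply: hL; first exact: cont_usc.
  move=> phi x C Ox mx; have clx := subset_closure Ox.
  have [/(_ Ox) h _] := wE _ _ C clx mx.
  have [h1 _] := lc x clx; have := ww x clx => h2.
  have : lam * wl x <= lam * w x by rewrite ler_pM2l.
  by rewrite /C1 in h1 *; lra.
have Sup w : S w -> forall x, cl x -> lam * w x <= - Hm.
  move=> [wc wE ww _] x clx.
  rewrite mulrC -ler_pdivlMr//; apply: cont_closure_le => //.
  apply: test_value_bound; first exact: cont_usc.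
  move=> phi y C Oy my; rewrite ler_pdivlMr// mulrC.
  have [/(_ Oy) h _] := wE _ _ C (subset_closure Oy) my.
  by have := hHm y (grad phi y) (subset_closure Oy); lra.
have lam00 := ltW lam0.
have [|||||v [vS vG]] := @perron R m cl (sub_cond H be lam 0) (super_cond H be lam 0)
    set0 w0 wl cO.
- move=> x0 r0 p0 clx0 nE; have [d d0 hd] := sub_cond_closed lam00 Hc bec clx0 nE.
  exists d => // x r p clx xx rr pp; have := hd x r p 0 clx xx rr pp (lexx _) d0.
  by rewrite addr0.
- move=> phi x0 r0 C clx0 nG _.
  have [d d0 hd] := not_super_cond_bump lam00 Hc bec mono C clx0 nG.
  by exists d => // x r clx xx rr; split => //; exact: hd.
- split => //; exact: cont_on_shift.
- move=> x clx eps eps0; have [d d0 hd] := equicont oO L0 dO clx eps0.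
  exists d => // w wS y cly yx; have [wc _ _ _] := wS.
  by apply: hd => //; [exact: SL|rewrite subrr normr0].
- move=> x clx; exists (- Hm / lam) => w wS.
  by rewrite ler_pdivlMr// mulrC; exact: Sup.
have [vc vE vw _] := vS; exists v; split => //; first exact: SL.
move=> x clx; have := Sup v vS x clx; have [h1 _] := lc x clx.
have : lam * wl x <= lam * v x by rewrite ler_pM2l//; exact: vw.
have : - Hm <= `|Hm| by rewrite -normrN ler_norm.
rewrite ler_norml; have : C1 <= Num.max C1 `|Hm| by rewrite le_max lexx.
have : `|Hm| <= Num.max C1 `|Hm| by rewrite le_max lexx orbT.
lra.
Qed.

Lemma ergodic_solution a0 w0 : cont_on cl w0 -> subsolution Omega H B a0 w0 ->
  exists a v L, [/\ 0 <= L, cont_on cl v, segLip Omega L v & solution Omega H B a v].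
Proof.
move=> w0c /subsolution_vsub[_ w0s].
have [C [L [C0 L0 hv]]] := discounted_solution w0c w0s.
have [x0 Ox0] := O0; have clx0 := subset_closure Ox0.
pose lam (k : nat) : R := k.+1%:R^-1.
have lam0 k : 0 < lam k by rewrite invr_gt0.
have lam1 k : lam k <= 1 by rewrite invf_le1// ler1n.
have [V hV] := choice (fun k => hv (lam k) (lam0 k) (lam1 k)).
pose u k x := V k x + - V k x0.
have uL k : segLip Omega L (u k) by apply: segLip_shift; have [] := hV k.
have uc k : cont_on cl (u k) by apply: cont_on_shift; have [] := hV k.
have [F [UF sF]] := ultraFilterLemma (eventually_filter : ProperFilter \oo).
have PF : ProperFilter F := ultra_proper.
have limu x : exists l, cl x -> forall e, 0 < e -> F [set k | `|u k x - l| < e].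
  have [clx|nclx] := pselect (cl x); last by exists 0.
  have [M hM] := pointwise_osc oO L0 dO connO clx0 clx.
  have [|l hl] := @ultra_bounded_lim R nat F (fun k => u k x) M UF.
    move=> k; have := hM (u k) (uL k) (uc k).
    by rewrite {1}/u subrr sub0r normrN.
  by exists l.
have [v hlim] := choice limu.
have [a ha] := @ultra_bounded_lim R nat F (fun k => - (lam k * V k x0)) C UF
  (fun k => let: And5 _ _ _ _ h := hV k in eq_ind_r (fun t => t <= C) (h x0 clx0) (normrN _)).
have vloc x : cl x -> forall e, 0 < e -> exists2 d, 0 < d & forall y, cl y ->
    `|y - x| < d -> `|v y - v x| <= e /\ forall k, `|u k y - u k x| <= e.
  move=> clx e e0; have e4 : 0 < e / 4 by rewrite divr_gt0.
  have [d d0 hd] := equicont oO L0 dO clx e4; exists d => // y cly yx.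
  have xx : `|x - x| < d by rewrite subrr normr0.
  have hk k := hd (u k) (uL k) (uc k) y x cly clx yx xx.
  split=> [|k]; last by have := hk k; lra.
  have [k [/= k1 k2]] := filter_ex (filterI (hlim x clx _ e4) (hlim y cly _ e4)).
  by have := hk k; move: k1 k2; rewrite !ltr_norml !ler_norml; lra.
have vc : cont_on cl v.
  move=> x clx e e0; have e2 : 0 < e / 2 by rewrite divr_gt0.
  have [d d0 hd] := vloc x clx _ e2; exists d => // y cly /(hd y cly)[h _].
  by apply: le_lt_trans h _; lra.
have unif e : 0 < e -> F [set k | forall x, cl x -> `|u k x - v x| <= e].
  move=> e0; have e4 : 0 < e / 4 by rewrite divr_gt0.
  move/compact_near_coveringP/near_covering_withinP : (cO).
  move=> /(_ nat F (fun k x => `|u k x - v x| <= e) _); apply => x clx.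
  have [d d0 hd] := vloc x clx _ e4.
  exists ([set y | `|y - x| < d], [set k | `|u k x - v x| < e / 4]) => /=.
    by split; [apply/nbhs_rVP; exists d|exact: hlim].
  move=> [y k] /= [yx kx] cly; have [h1 h2] := hd y cly yx.
  have := h2 k; move: h1 kx; rewrite ltr_norml !ler_norml; lra.
have [Cv Cv0 hCv] := cont_on_bounded vc.
(* At stage [k] the function [u k] satisfies the undiscounted condition with the variable constant
   [- lam k * V k x0 - lam k * u k x]; this is uniformly close to [a] since [u k] is bounded. *)
have good e : 0 < e -> exists k, (forall x, cl x -> `|u k x - v x| <= e) /\
    forall x, cl x -> `|a - (- (lam k * V k x0) - lam k * u k x)| <= e.
  move=> e0; have e2 : 0 < e / 2 by rewrite divr_gt0.
  have C10 : 0 < Cv + 1 by lra.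
  have small : F [set k | lam k * (Cv + 1) < e / 2].
    apply: sF; have [n hn] : exists n : nat, (Cv + 1) / (e / 2) < n%:R.
      by exists (Num.truncn ((Cv + 1) / (e / 2))).+1; exact: truncnS_gt.
    exists n => // k /= nk; rewrite /lam mulrC ltr_pdivrMr// mulrC -ltr_pdivrMr//.
    by apply: lt_le_trans hn _; rewrite ler_nat; exact: leqW.
  have [k [/= [k1 k2] [k3 k4]]] := filter_ex (filterI (filterI (unif e e0) (unif 1 ltr01)) (filterI (ha _ e2) small)).
  exists k; split => // x clx.
  have lu : `|lam k * u k x| <= lam k * (Cv + 1).
    rewrite normrM (gtr0_norm (lam0 k)) ler_pM2l//.
    by have := k2 x clx; have := hCv x clx; rewrite !ler_norml; lra.
  move: k3 k4 lu; rewrite ltr_norml !ler_norml; lra.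
have shiftE k x r p : lam k * (r + V k x0) + H x p = lam k * r + lam k * V k x0 + H x p by rewrite mulrDr.
have vS : vsub cl (sub_cond H be 0 a) v.
  apply: (@vsub_stable R m cl _ (fun e => sub_cond H be 0 (a + e))) => //.
    move=> y r0 p0 cly nE; have [d d0 hd] := sub_cond_closed (lexx 0) Hc bec cly nE.
    by exists d => // x r p e clx xx rr pp e0; apply: hd => //; exact: ltW.
  move=> y e cly e0; have [k [k1 k2]] := good e e0.
  exists (u k); split; first exact: cont_usc.
  - by move=> x clx; have := k1 x clx; rewrite ler_norml; lra.
  - by have := k1 y cly; rewrite ler_norml; lra.
  have [_ _ sk _ _] := hV k.
  apply: vsub_shift sk => x p clx; rewrite /sub_cond mul0r add0r.
  have := k2 x clx; have -> : lam k * u k x = lam k * V k x - lam k * V k x0 by rewrite /u mulrDr mulrN.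
  rewrite ler_norml => k3.
  move=> [h1 h2]; split=> [/h1|/h2]; first by lra.
  rewrite !ge_min => /orP[h3|->]; last by rewrite orbT.
  by apply/orP; left; lra.
have vG : vsuper cl (super_cond H be 0 a) v.
  apply/vsuper_opp.
  apply: (@vsub_stable R m cl _ (fun e x r p => super_cond H be 0 (a - e) x (- r) (- p))) => //.
  - exact: cont_onN.
  - move=> y r0 p0 cly nE; have [d d0 hd] := super_cond_closed (lexx 0) Hc bec cly nE.
    exists d => // x r p e clx xx rr pp e0 ed; apply: hd => //; last exact: ltW.
      by rewrite -opprD normrN.
    by rewrite -opprD normrN.
  move=> y e cly e0; have [k [k1 k2]] := good e e0.
  exists (fun x => - u k x); split; first exact/cont_usc/cont_onN.
  - by move=> x clx; have := k1 x clx; rewrite ler_norml; lra.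
  - by have := k1 y cly; rewrite ler_norml; lra.
  apply/(vsuper_opp cl (super_cond H be 0 (a - e))).
  have [_ _ _ sk _] := hV k.
  apply: vsuper_shift sk => x p clx; rewrite /super_cond mul0r add0r.
  have := k2 x clx; have -> : lam k * u k x = lam k * V k x - lam k * V k x0 by rewrite /u mulrDr mulrN.
  rewrite ler_norml => k3.
  move=> [h1 h2]; split=> [/h1|/h2]; first by lra.
  rewrite !le_max => /orP[h3|->]; last by rewrite orbT.
  by apply/orP; left; lra.
exists a, v, L; split => //.
  move=> x y seg; apply/ler_addgt0Pr => e e0; have e2 : 0 < e / 2 by rewrite divr_gt0.
  have clx : cl x by apply: subset_closure; have := seg 0; rewrite scale0r addr0; apply.
  have cly : cl y by apply: subset_closure; have := seg 1; rewrite scale1r addrC subrK; apply.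
  have [k hk] := filter_ex (unif _ e2).
  have := uL k x y seg; have := hk x clx; have := hk y cly; rewrite !ler_norml; lra.
split; first by apply/subsolution_vsub; split => //; exact: cont_usc.
by apply/supersolution_vsuper; split => //; exact: cont_lsc.
Qed.

End Existence.

(** * A subsolution of the oblique problem at some level *)

Section NeumannStart.
Variables (R : realType) (m : nat).
Implicit Types (x y z p q : 'rV[R]_m) (r s t d eps a b L C c : R).
Implicit Types (u v w : 'rV[R]_m -> R).
Variables (Omega : set 'rV[R]_m) (H : 'rV[R]_m -> 'rV[R]_m -> R).
Local Notation cl := (closure Omega).
Local Notation N := (m%:R : R).
Hypothesis oO : open Omega.
Hypothesis cO : compact cl.
Hypothesis O0 : Omega !=set0.
Hypothesis contH : {within [set xp : 'rV[R]_m * 'rV[R]_m | cl xp.1],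
  continuous (fun xp => H xp.1 xp.2)}.
Hypothesis coerH : coercive Omega H.
Hypothesis b0 : bdry Omega !=set0.

Lemma bdry_compact : compact (bdry Omega).
Proof.
have -> : bdry Omega = cl `&` ~` Omega.
  by apply/seteqP; split => x; [move=> /(bdryE oO)|move=> h; apply/(bdryE oO)].
by apply: compact_closedI => //; exact: open_closedC.
Qed.

(** The sup-norm distance to the complement of Omega; it vanishes on the boundary. *)
Definition cdist x := inf [set `|x - y| | y in ~` Omega].

Let cdist_has_inf x : has_inf [set `|x - y| | y in ~` Omega].
Proof.
have [y by0] := b0; have [_ nOy] := (bdryE oO y).1 by0.
split; first by exists `|x - y|, y.
by exists 0 => _ [z _ <-].
Qed.

Lemma cdist_le x y : ~ Omega y -> cdist x <= `|x - y|.
Proof. by move=> nOy; apply: ge_inf; [exact: (cdist_has_inf x).2|exists y]. Qed.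

Lemma cdist_ge x c : (forall y, ~ Omega y -> c <= `|x - y|) -> c <= cdist x.
Proof.
move=> h; apply: lb_le_inf; first exact: (cdist_has_inf x).1.
by move=> _ [y nOy <-]; exact: h.
Qed.

Lemma cdist_lip x y : cdist y - `|y - x| <= cdist x.
Proof.
apply: cdist_ge => z nOz; have := cdist_le y nOz.
have := ler_distD x y z; lra.
Qed.

Variables (gamma : 'rV[R]_m -> 'rV[R]_m) (g : 'rV[R]_m -> R).
Hypothesis gammac : cont_on cl gamma.
Hypothesis gc : cont_on (bdry Omega) g.
Hypothesis cone : forall z, bdry Omega z -> exists2 nrm,
  inner_cone Omega z nrm & 0 < dotp nrm (gamma z).

Lemma cdist_boundary_growth_loc z : bdry Omega z -> exists c d, [/\ 0 < c, 0 < d &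
  forall x, bdry Omega x -> `|x - z| < d -> exists2 t0, 0 < t0 &
    forall t, 0 < t -> t < t0 -> c * t <= cdist (x + t *: - gamma x)].
Proof.
move=> bz; have [nrm cz nu0] := cone bz.
have clz : cl z by have [] := (bdryE oO z).1 bz.
set nu := dotp nrm (gamma z) in nu0.
pose Gm := `|gamma z| + 1.
have Gm0 : 0 < Gm by rewrite ltr_wpDl.
pose c := Num.min 1 (nu / (8 * (N * `|nrm| + 1))).
have Nn : 0 <= N * `|nrm| by rewrite mulr_ge0.
have D0 : 0 < 8 * (N * `|nrm| + 1) by rewrite mulr_gt0// ltr_wpDl.
have c0 : 0 < c by rewrite lt_min ltr01 divr_gt0.
have [c1 c2] : c <= 1 /\ c * (8 * (N * `|nrm| + 1)) <= nu.
  have : c <= Num.min 1 (nu / (8 * (N * `|nrm| + 1))) by [].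
  by rewrite le_min ler_pdivlMr// => /andP[].
clearbody c.
have k0 : 0 < nu / (8 * (Gm + 1)) by rewrite divr_gt0// mulr_gt0// ltr_wpDl// ltW.
have kE : nu / (8 * (Gm + 1)) * (Gm + 1) = nu / 8.
  by field; rewrite gt_eqF// ltr_wpDl// ltW.
move: (nu / (8 * (Gm + 1))) k0 kE => k k0 kE.
have [rc rc0 hc] := cz k k0.
have om0 : 0 < Num.min 1 (nu / (8 * (N * `|nrm| + 1))) by rewrite lt_min ltr01 divr_gt0.
have [rg rg0 hg] := gammac clz om0.
have d0 : 0 < Num.min rc rg / 2 by rewrite divr_gt0// lt_min rc0.
exists c, (Num.min rc rg / 2); split => // x bx.
have clx : cl x by have [] := (bdryE oO x).1 bx.
move=> xz; have : Num.min rc rg / 2 < Num.min rc rg by lra.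
rewrite lt_min => /andP[drc drg].
have := hg x clx (lt_trans xz drg); rewrite lt_min ltr_pdivlMr// => /andP[gx1 gx2].
have ngx : `|gamma x| <= Gm.
  have := ler_normD (gamma z) (gamma x - gamma z); rewrite addrC subrK /Gm; lra.
have nux : nu - nu / 8 <= dotp nrm (gamma x).
  have -> : gamma x = gamma z + (gamma x - gamma z) by rewrite addrC subrK.
  rewrite dotpDr -/nu; have := dotp_norm nrm (gamma x - gamma z).
  have : `|gamma x - gamma z| * (8 * (N * `|nrm|)) <= `|gamma x - gamma z| * (8 * (N * `|nrm| + 1)).
    by rewrite ler_wpM2l// ler_wpM2l// lerDl.
  by rewrite ler_norml; lra.
exists ((rc - Num.min rc rg / 2) / (Gm + 1)).
  by rewrite divr_gt0 ?subr_gt0// ltr_wpDl// ltW.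
move=> t t0; rewrite ltr_pdivlMr; last by rewrite ltr_wpDl// ltW.
move=> tG; apply: cdist_ge => y nOy; rewrite leNgt; apply/negP => lt.
apply: nOy; have yE : y - x = - (t *: gamma x) - (x + t *: - gamma x - y) by vring.
have ct : c * t <= t by rewrite ler_piMl// ltW.
have ny : `|y - x| <= t * Gm + c * t.
  rewrite yE (le_trans (ler_normB _ _))// normrN normrZ gtr0_norm// lerD// ?(ltW lt)//.
  by rewrite ler_wpM2l// ltW.
apply: (hc x y clx) => //; first exact: lt_trans xz drc.
  rewrite -(subrK x y) -addrA (le_lt_trans (ler_normD _ _))//.
  by move: tG xz; rewrite mulrDr mulr1; lra.
have h1 : - dotp nrm (x + t *: - gamma x - y) <= N * `|nrm| * (c * t).
  have := dotp_norm nrm (x + t *: - gamma x - y).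
  have : N * `|nrm| * `|x + t *: - gamma x - y| <= N * `|nrm| * (c * t).
    by rewrite ler_wpM2l// ltW.
  by rewrite ler_norml; lra.
have h2 : k * `|y - x| <= k * (Gm + 1) * t.
  by rewrite -mulrA ler_wpM2l ?(ltW k0)// mulrDl mul1r mulrC; lra.
rewrite kE in h2.
have h3 : N * `|nrm| * (c * t) <= nu / 8 * t.
  rewrite mulrA ler_wpM2r ?(ltW t0)// mulrC; lra.
have h4 := ler_wpM2l (ltW t0) nux.
rewrite yE -yE [in X in X < _]yE dotpBr dotpNr dotpZr.
have h5 : 0 < nu * t by rewrite mulr_gt0.
lra.
Qed.

(** Compactness of the boundary makes the rate [c] uniform; [t0] may depend on the point, as a
    derivative test sees only small [t]. *)
Lemma cdist_boundary_growth : exists2 c, 0 < c & forall x, bdry Omega x ->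
  exists2 t0, 0 < t0 & forall t, 0 < t -> t < t0 -> c * t <= cdist (x + t *: - gamma x).
Proof.
pose P (c : R) x := bdry Omega x -> exists2 t0, 0 < t0 & forall t, 0 < t -> t < t0 ->
   c * t <= cdist (x + t *: - gamma x).
have h : \forall c \near (0 : R)^'+, bdry Omega `<=` P c.
  apply: (compact_near_coveringP _).1 => [|z bz]; first exact: bdry_compact.
  have [c [d [c0 d0 hd]]] := cdist_boundary_growth_loc bz.
  exists ([set x | `|x - z| < d], [set s | s <= c]) => /=.
    by split; [apply/nbhs_rVP; exists d|exact: nbhs_right_le].
  move=> [x s] /= [xz sc] bx; have [t0 t00 ht] := hd x bx xz; exists t0 => // t tp tt.
  by apply: le_trans (ht t tp tt); rewrite ler_wpM2r// ltW.
have hh : \forall c \near (0 : R)^'+, bdry Omega `<=` P c /\ 0 < c.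
  by near=> c; split; near: c => //; exact: nbhs_right_gt.
have [c [hc c0]] := @filter_ex _ ((0 : R)^'+) _ _ hh.
by exists c => // x bx; exact: (hc x bx bx).
Unshelve. all: by end_near. Qed.

(* A large multiple of the distance to the complement: moving from a boundary point
   along - gamma it grows linearly, so any test function from above has a very
   negative oblique derivative there. *)
Lemma neumann_subsolution_exists : exists a w, cont_on cl w /\
  subsolution Omega H (neumann gamma g) a w.
Proof.
have cl0 : cl !=set0 by have [x Ox] := O0; exists x; exact: subset_closure.
have [c c0 hc] := cdist_boundary_growth.
have [y0 by0 hy0] := usc_max_rV bdry_compact b0 (cont_usc (cont_onN gc)).
(* As [y0] minimizes [g] on the boundary, [K c >= - g] there. [K] also bounds test gradients inside,
   which determines the level [a]. *)
pose K := `|g y0| / c.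
have K0 : 0 <= K by rewrite divr_ge0// ltW.
have [a ha] := H_max cO cl0 contH K0.
pose w x := K * cdist x.
have wl x y : w y - K * `|y - x| <= w x.
  by rewrite /w -mulrBr ler_wpM2l//; exact: cdist_lip.
have wc : cont_on cl w.
  move=> x clx e e0; have D0 : 0 < K + 1 by rewrite ltr_wpDl.
  exists (e / (K + 1)) => [|y _]; first by rewrite divr_gt0.
  rewrite ltr_pdivlMr// => yx.
  have := wl x y; have := wl y x; rewrite (distrC x y).
  have : K * `|y - x| <= `|y - x| * (K + 1) by rewrite mulrC ler_wpM2l// lerDl.
  by rewrite ltr_norml => *; apply/andP; split; lra.
exists a, w; split => //; split; first exact: cont_usc.
move=> phi x C clx mx; split=> [Ox|bx].
  apply: ha => //; apply: norm_le_entries => // i.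
  have [s s0 hs] := (openP_rV _).1 oO x Ox.
  have dir (v : 'rV[R]_m) : `|v| <= 1 -> - K <= dotp (grad phi x) v.
    move=> v1; apply: (test_dir C clx mx); exists s => // t t0 ts.
    have tv : `|x - (x + t *: v)| <= t.
      by rewrite opprD addrA subrr sub0r normrN normrZ (gtr0_norm t0) ler_piMr// ltW.
    split.
      apply: subset_closure; apply: hs; rewrite distrC; exact: le_lt_trans ts.
    have := wl (x + t *: v) x.
    have : K * `|x - (x + t *: v)| <= K * t by rewrite ler_wpM2l.
    lra.
  have := dir (delta_mx 0 i) (norm_delta_le1 _ _).
  have := dir (- delta_mx 0 i); rewrite normrN => /(_ (norm_delta_le1 _ _)).
  by rewrite dotpNr dotp_delta ler_norml; lra.
have [t0 t00 ht] := hc x bx.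
have [nrm cx nu0] := cone bx.
have [r r0 [_ hr]] := inner_cone_shift cx nu0.
have wx : w x <= 0.
  have [_ nOx] := (bdryE oO x).1 bx.
  by have := cdist_le x nOx; rewrite subrr normr0 => h; rewrite /w mulr_ge0_le0.
have : K * c <= dotp (grad phi x) (- gamma x).
  apply: (test_dir C clx mx); exists (Num.min t0 r); first by rewrite lt_min t00.
  move=> t tp; rewrite lt_min => /andP[tt tr].
  split; first by apply/subset_closure/hr => //; rewrite subrr normr0.
  have := ler_wpM2l K0 (ht t tp tt); rewrite -/(w _) mulrA [K * c * t]mulrC; lra.
rewrite dotpNr /K divfK ?gt_eqF// => h.
rewrite ge_min /neumann dotpC; apply/orP; right.
have := hy0 x bx; have := ler_norm (- g y0); rewrite normrN; lra.
Qed.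

Lemma neumann_pair_cont : pair_cont (bdry Omega) (fun x p => dotp (gamma x) p - g x).
Proof.
move=> x p bx eps eps0; have [clx _] := (bdryE oO x).1 bx.
have e4 : 0 < eps / 4 by rewrite divr_gt0.
have D1 : 0 < N * (`|p| + 1) + 1 by rewrite ltr_wpDl// mulr_ge0// addr_ge0.
have D2 : 0 < N * `|gamma x| + 1 by rewrite ltr_wpDl// mulr_ge0.
have e1 : 0 < eps / 4 / (N * (`|p| + 1) + 1) by rewrite divr_gt0.
have [d1 d10 h1] := gammac clx e1; have [d2 d20 h2] := gc bx e4.
exists (Num.min (Num.min d1 d2) (Num.min 1 (eps / 4 / (N * `|gamma x| + 1)))).
  by rewrite !lt_min d10 d20 ltr01 divr_gt0.
move=> y q by0; have [cly _] := (bdryE oO y).1 by0.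
rewrite !lt_min => /andP[/andP[y1 y2] _] /andP[_ /andP[q1]].
rewrite ltr_pdivlMr// => q2.
have := h1 y cly y1; rewrite ltr_pdivlMr// => {}h1.
have {}h2 := h2 y by0 y2.
have -> : dotp (gamma y) q - g y - (dotp (gamma x) p - g x) =
   dotp (gamma y - gamma x) q + dotp (gamma x) (q - p) - (g y - g x).
  by rewrite dotpBl dotpBr; ring.
have nq : `|q| <= `|p| + 1.
  have := ler_normD p (q - p); rewrite addrC subrK; lra.
have a1 := dotp_norm (gamma y - gamma x) q.
have a2 := dotp_norm (gamma x) (q - p).
have a3 : N * `|gamma y - gamma x| * `|q| <= `|gamma y - gamma x| * (N * (`|p| + 1) + 1).
  rewrite mulrAC mulrC ler_wpM2l//; apply: (@le_trans _ _ (N * (`|p| + 1))).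
    by rewrite ler_wpM2l.
  by rewrite lerDl.
have a4 : N * `|gamma x| * `|q - p| <= `|q - p| * (N * `|gamma x| + 1).
  by rewrite mulrC ler_wpM2l// lerDl.
move: a1 a2 h2; rewrite !ltr_norml !ler_norml => /andP[? ?] /andP[? ?] /andP[? ?].
by apply/andP; split; lra.
Qed.

(** The direction [- gamma x] points into Omega, so touching from above orders the derivatives along
    it. *)
Lemma neumann_mono phi psi x : bdry Omega x -> C1_closed cl phi -> C1_closed cl psi ->
  local_max cl (phi \- psi) x ->
  dotp (gamma x) (grad psi x) - g x <= dotp (gamma x) (grad phi x) - g x.
Proof.
move=> bx Cphi Cpsi mx; have [clx _] := (bdryE oO x).1 bx.
have [nrm cx nu0] := cone bx; have [r r0 [_ hr]] := inner_cone_shift cx nu0.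
have := @test_dir_C1 _ _ cl phi psi x (- gamma x) Cphi Cpsi clx mx.
rewrite !dotpNr lerN2 lerD2r !(dotpC (gamma x)); apply.
exists r => // t t0 tr; apply/subset_closure/hr => //.
by rewrite subrr normr0.
Qed.

End NeumannStart.

(** * The Dirichlet problem at levels that admit a subsolution *)

Section Dirichlet.
Variables (R : realType) (m : nat).
Implicit Types (x y z p q : 'rV[R]_m) (r s t d eps a b L C c : R).
Implicit Types (u v w : 'rV[R]_m -> R).
Variables (Omega : set 'rV[R]_m) (H : 'rV[R]_m -> 'rV[R]_m -> R).
Local Notation cl := (closure Omega).
Hypothesis oO : open Omega.
Hypothesis cO : compact cl.
Hypothesis connO : connected Omega.
Hypothesis dO : inner_dir Omega.
Hypothesis contH : {within [set xp : 'rV[R]_m * 'rV[R]_m | cl xp.1],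
  continuous (fun xp => H xp.1 xp.2)}.
Hypothesis coerH : coercive Omega H.
Hypothesis b0 : bdry Omega !=set0.

(** Perron's class consists of subsolutions in Omega lying below [g] on the boundary; the ceiling
    yields the boundary part of the subsolution property. The choice [be = -1] makes the boundary
    half of [sub_cond] vacuous. *)
Lemma dirichlet_solution a g u : cont_on (bdry Omega) g -> cont_on cl u ->
  subsolution_in Omega H a u ->
  exists v L, [/\ 0 <= L, cont_on cl v, segLip Omega L v &
    solution Omega H (dirichlet g) a v].
Proof.
move=> gc uc [_ usub]; have [y0 by0] := b0; have [cly0 _] := (bdryE oO y0).1 by0.
have Hc : pair_cont cl H by move=> x p clx; exact: H_cont.
pose be : 'rV[R]_m -> 'rV[R]_m -> R := fun _ _ => -1.
have bec : pair_cont (bdry Omega) be.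
  by move=> x p _ e e0; exists 1 => // *; rewrite subrr normr0.
have mono (phi psi : 'rV[R]_m -> R) x : bdry Omega x -> C1_closed cl phi -> C1_closed cl psi ->
  local_max cl (phi \- psi) x -> be x (grad psi x) <= be x (grad phi x) by [].
have [L L0 hL] := subsolution_segLip oO cO coerH a.
have [y1 by1 hy1] := usc_max_rV (bdry_compact oO cO) b0 (cont_usc (cont_onN gc)).
have cl0 : cl !=set0 by exists y0.
have [y2 cly2 hy2] := usc_max_rV cO cl0 (cont_usc uc).
(* The minimum of [g] on the boundary minus the maximum of [u]: the shifted function lies below
   [g]. *)
pose w0 x := u x + (g y1 - u y2).
have w0S : perron_class cl (sub_cond Omega H be 0 a) (bdry Omega) g w0 w0.
  split => //; first exact: cont_on_shift.
    move=> phi x C clx mx; rewrite /sub_cond mul0r add0r; split=> [Ox|_].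
      apply: usub => //; case/local_maxP : mx => r r0 hr; apply/local_maxP.
      by exists r => // y cly /(hr y cly); rewrite /w0 /=; lra.
    by rewrite ge_min /be oppr_le0 ler01 orbT.
  by move=> x clx bx; have := hy1 x bx; have := hy2 x clx; rewrite /w0; lra.
have SL w : perron_class cl (sub_cond Omega H be 0 a) (bdry Omega) g w0 w -> segLip Omega L w.
  move=> [wc wE ww _]; apply: hL; first exact: cont_usc.
  move=> phi x C Ox mx; have [/(_ Ox) h _] := wE _ _ C (subset_closure Ox) mx.
  by move: h; rewrite mul0r add0r.
pose G x r p := (Omega x -> a <= H x p) /\
  (bdry Omega x -> 0 <= Num.max (H x p - a) (r - g x)).
have [|||||v [vS vG]] := @perron R m cl (sub_cond Omega H be 0 a) G (bdry Omega) g w0 cO.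
- move=> x0 r0 p0 clx0 nE; have [d d0 hd] := sub_cond_closed oO (lexx 0) Hc bec clx0 nE.
  exists d => // x r p clx xx rr pp; have := hd x r p 0 clx xx rr pp (lexx _) d0.
  by rewrite addr0.
- move=> phi x0 r0 C clx0 nG _.
  have Hlt : H x0 (grad phi x0) < a.
    by rewrite ltNge; apply/negP => h; apply: nG; split => // _; rewrite le_max subr_ge0 h.
  have nS : ~ super_cond Omega H be 0 a x0 r0 (grad phi x0).
    rewrite /super_cond mul0r add0r => -[h1 h2].
    have [/h1|/h2] := cl_cases oO clx0; first by rewrite leNgt Hlt.
    by rewrite le_max subr_ge0 (leNgt a) Hlt /be oppr_ge0 ler10.
  have [d d0 hd] := not_super_cond_bump oO (lexx 0) Hc bec mono C clx0 nS.
  (* Failure of [G] at a boundary point forces [r0 < g x0], which leaves room to raise the function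
     without crossing [g]. *)
  have [d' d'0 hd'] : exists2 d, 0 < d & forall x r, bdry Omega x -> `|x - x0| < d ->
      `|r - r0| < d -> r <= g x.
    have [Ox0|bx0] := cl_cases oO clx0.
      have [s s0 hs] := (openP_rV _).1 oO x0 Ox0; exists s => // x r bx /hs Ox.
      by have [] := (bdryE oO x).1 bx.
    have glt : 0 < (g x0 - r0) / 2.
      rewrite divr_gt0// subr_gt0 ltNge; apply/negP => h; apply: nG; split.
        by have [_ nO] := (bdryE oO x0).1 bx0.
      by rewrite le_max [0 <= r0 - _]subr_ge0 h orbT.
    have [s s0 hs] := gc x0 bx0 _ glt.
    exists (Num.min s ((g x0 - r0) / 2)); first by rewrite lt_min s0.
    move=> x r bx; rewrite !lt_min => /andP[/(hs x bx) h _] /andP[_].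
    by move: h; rewrite !ltr_norml; lra.
  exists (Num.min d d'); first by rewrite lt_min d0.
  move=> x r clx; rewrite !lt_min => /andP[x1 x2] /andP[r1 r2]; split.
    by move=> bx; exact: hd'.
  by move=> psi; exact: hd.
- exact: w0S.
- move=> x clx eps eps0; have [d d0 hd] := equicont oO L0 dO clx eps0.
  exists d => // w wS y cly yx; have [wc _ _ _] := wS.
  by apply: hd => //; [exact: SL|rewrite subrr normr0].
- move=> x clx; have [M hM] := pointwise_osc oO L0 dO connO clx cly0.
  (* At the boundary point [y0] members are capped by [g y0]; their common oscillation bound carries
     this to [x]. *)
  exists (g y0 + M) => w wS; have [wc _ _ wT] := wS.
  have := hM w (SL w wS) wc; have := wT y0 cly0 by0; rewrite ler_norml; lra.
have [vc vE vw vT] := vS.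
exists v, L; split => //; first exact: SL.
split; split; [exact: cont_usc| |exact: cont_lsc|].
  move=> phi x C clx mx; have [h _] := vE _ _ C clx mx; split=> [/h|bx].
    by rewrite mul0r add0r.
  by rewrite /dirichlet ge_min [v x - _ <= 0]subr_le0 vT// orbT.
by move=> phi x C clx mx; exact: vG.
Qed.

End Dirichlet.

(** * Measurability and iterated integrals *)

Section Measurability.
Variable R : realType.

Definition coords_meas d (T : measurableType d) m (F : T -> 'rV[R]_m) :=
  forall i, measurable_fun setT (fun t => F t 0 i).

(** An open set is a countable union of boxes with rational centres and radii [1 / (k + 1)], whose
    preimages only involve the coordinates. *)
Lemma open_preimage_measurable d (T : measurableType d) m (F : T -> 'rV[R]_m)
    (U : set 'rV[R]_m) : coords_meas F -> open U -> measurable (F @^-1` U).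
Proof.
move=> mF /openP_rV oU.
pose B (p : {ffun 'I_m -> rat} * nat) : set 'rV[R]_m :=
  [set x | forall i, `|x 0 i - ratr (p.1 i)| < p.2.+1%:R^-1].
pose G p := if `[< B p `<=` U >] then F @^-1` B p else set0.
have -> : F @^-1` U = \bigcup_p G p.
  apply/seteqP; split=> [t /= Ut|t [p _]]; last first.
    by rewrite /G; case: asboolP => // BU; exact: BU.
  have [r r0 hr] := oU _ Ut.
  have [k hk] : exists k : nat, k.+1%:R^-1 < r / 2.
    have [k _ hk] := near_infty_natSinv_lt (PosNum (divr_gt0 r0 (ltr0Sn R 1))).
    by exists k; exact: (hk k (leqnn k)).
  have k0 : 0 < k.+1%:R^-1 :> R by rewrite invr_gt0.
  have hq i : exists q : rat, `|F t 0 i - ratr q| < k.+1%:R^-1.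
    have lt : F t 0 i - k.+1%:R^-1 < F t 0 i + k.+1%:R^-1 by rewrite ltrBlDr -addrA ltrDl addr_gt0.
    have [q hq] := rat_in_itvoo lt.
    exists q; move: hq; rewrite in_itv /= => /andP[h1 h2].
    by rewrite ltr_distl; apply/andP; split; move: h1 h2; move: (k.+1%:R^-1 : R); clear => e; lra.
  have /choice[q hq'] := hq.
  exists ([ffun i => q i], k) => //; rewrite /G; case: asboolP => [_|[]].
    by move=> i /=; rewrite ffunE.
  move=> y By; apply: hr; apply: norm_lt_entries => // i.
  have := By i; have := hq' i; rewrite /= ffunE !mxE => h1 h2.
  rewrite (_ : y 0 i - F t 0 i = (y 0 i - ratr (q i)) - (F t 0 i - ratr (q i))); last by ring.
  by apply: le_lt_trans (ler_normB _ _) _; move: h1 h2 hk; move: (k.+1%:R^-1 : R); clear => e; lra.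
apply: countable_bigcupT_measurable; first exact: countableP.
move=> p; rewrite /G; case: asboolP => // _.
rewrite (_ : F @^-1` B p = \bigcap_(i in [set: 'I_m]) [set t | `|F t 0 i - ratr (p.1 i)| < p.2.+1%:R^-1]).
  apply: fin_bigcap_measurable; first exact: finite_finset.
  move=> i _.
  have mg : measurable_fun setT (fun t => `|F t 0 i - ratr (p.1 i)|).
    by apply: measurableT_comp => //; apply: measurable_funB => //; exact: mF.
  rewrite (_ : [set t | _] = (fun t => `|F t 0 i - ratr (p.1 i)|) @^-1` `]-oo, (p.2.+1%:R^-1 : R)[).
    by rewrite -[X in measurable X]setTI; exact: mg.
  by apply/seteqP; split=> t /=; rewrite in_itv.
by apply/seteqP; split=> t /= h i; [move=> _|]; exact: h.
Qed.

(* Testing measurability on coordinatewise measurable maps avoids putting product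
   sigma-algebras on parameter spaces and row vectors. *)
Definition coord_meas m (f : 'rV[R]_m -> R) := forall d (T : measurableType d)
  (F : T -> 'rV[R]_m), coords_meas F -> measurable_fun setT (f \o F).

(** The solution is arbitrary outside the closure, while the integrals run over the whole space;
    cutting it off does not change products with test functions supported in Omega. *)
Definition zext m (O : set 'rV[R]_m) (f : 'rV[R]_m -> R) x := if `[< O x >] then f x else 0.

Lemma coord_meas_zext m (O : set 'rV[R]_m) (f : 'rV[R]_m -> R) : open O -> cont_on O f ->
  coord_meas (zext O f).
Proof.
move=> oO cf d T F mF.
move=> mD; apply: (measurability _ (RGenOInfty.measurableE R)) => //.
move=> _ [_ [a ->] <-]; rewrite setTI.
have oA : open [set x | O x /\ a < f x].
  apply/openP_rV => x [Ox ax].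
  have [d1 d10 h1] := (openP_rV O).1 oO x Ox.
  have [d2 d20 h2] := cf x Ox (f x - a) ltac:(move: ax; clear; lra).
  exists (Num.min d1 d2); first by rewrite lt_min d10.
  move=> y; rewrite lt_min => /andP[y1 y2]; have Oy := h1 y y1; split=> //.
  by have := h2 y Oy y2; rewrite ltr_distl => /andP[]; clear; lra.
have mA := open_preimage_measurable mF oA.
have mO := open_preimage_measurable mF oO.
(* For negative [a] the zero values outside [O] exceed [a] as well. *)
case: (ltP a 0) => a0.
  rewrite (_ : _ @^-1` _ = (F @^-1` [set x | O x /\ a < f x]) `|` ~` (F @^-1` O)).
    by apply: measurableU => //; exact: measurableC.
  apply/seteqP; split=> t /=; rewrite in_itv /= andbT /zext.
    by case: asboolP => [Ot|nO _]; [left|right].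
  by move=> [[Ot at']|Ot]; case: asboolP.
rewrite (_ : _ @^-1` _ = F @^-1` [set x | O x /\ a < f x]) //.
apply/seteqP; split=> t /=; rewrite in_itv /= andbT /zext.
  by case: asboolP => // _; rewrite ltNge a0.
by move=> [Ot at']; case: asboolP.
Qed.

Lemma coord_meas_cont m (f : 'rV[R]_m -> R) : cont_on setT f -> coord_meas f.
Proof.
move=> cf; have -> : f = zext setT f by apply/funext => x; rewrite /zext; case: asboolP => // -[].
by apply: coord_meas_zext cf; exact: openT.
Qed.

Lemma coord_meas_borel m (f : 'rV[R]_m -> R) (A : set 'rV[R]_m) : coord_meas f -> borel_fun A f.
Proof.
move=> mf; apply: measurable_funTS.
apply: (mf _ (g_sigma_algebraType (@open 'rV[R]_m)) id) => i.
move=> mD; apply: (measurability _ (RGenOInfty.measurableE R)) => //.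
move=> _ [_ [a ->] <-]; rewrite setTI; apply: sub_sigma_algebra.
apply/openP_rV => x /=; rewrite in_itv /= andbT => ax.
exists (x 0 i - a) => [|y yx]; first by rewrite subr_gt0.
rewrite in_itv /= andbT; have := le_lt_trans (le_entry_norm (y - x) i) yx.
by rewrite !mxE ltr_distl => /andP[]; clear; lra.
Qed.

End Measurability.

(** * Iterated integrals and Fubini *)

Section IteratedIntegral.
Variable R : realType.
Local Notation mu := (@lebesgue_measure R).

(** Tonelli is applied to the positive and negative parts separately, and [fine] is measurable. *)
Lemma measurable_Rintegral_param d (S : measurableType d) (f : S * R -> R) :
  measurable_fun setT f -> measurable_fun setT (fun s => \int[mu]_t f (s, t)).
Proof.
move=> mf; have mf' : measurable_fun setT (EFin \o f) by exact/measurable_EFinP.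
apply: (measurableT_comp (fine_measurable measurableT)).
rewrite (_ : (fun s => _) = fun s => fubini_F mu (EFin \o f)^\+%E s - fubini_F mu (EFin \o f)^\-%E s)%E.
  by apply: emeasurable_funB; apply: measurable_fun_fubini_tonelli_F => //;
    [exact: measurable_funepos|exact: measurable_funeneg].
apply/funext => s; rewrite integralE /fubini_F.
by congr (_ - _)%E; apply: eq_integral => x _; rewrite ?funeposE ?funenegE.
Qed.

(** Joint measurability in a parameter and a vector, tested by substitution as in [coord_meas]. *)
Definition jmeas d (S : measurableType d) m (f : S -> 'rV[R]_m -> R) :=
  forall d' (T : measurableType d') (s : T -> S) (F : T -> 'rV[R]_m), measurable_fun setT s ->
    coords_meas F -> measurable_fun setT (fun t => f (s t) (F t)).

Lemma coords_meas_row d (T : measurableType d) m (r : T -> R) (F : T -> 'rV[R]_m) :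
  measurable_fun setT r -> coords_meas F ->
  coords_meas (fun t => row_mx ((r t)%:M : 'M[R]_1) (F t)).
Proof.
move=> mr mF i; rewrite -(splitK i); case: (fintype.split i) => j /=.
  rewrite (_ : (fun t => _) = r) //.
  by apply/funext => t /=; rewrite row_mxEl !ord1 mxE eqxx mulr1n.
rewrite (_ : (fun t => _) = fun t => F t 0 j); first exact: mF.
by apply/funext => t /=; rewrite row_mxEr.
Qed.

Lemma jmeas_row d (S : measurableType d) m (f : S -> 'rV[R]_(1 + m) -> R) : jmeas f ->
  jmeas (fun (st : S * R) x => f st.1 (row_mx (st.2%:M : 'M[R]_1) x)).
Proof.
move=> mf d' T s F ms mF; apply: (mf _ T (fst \o s) (fun t => row_mx ((s t).2%:M : 'M[R]_1) (F t))).
  by apply: measurableT_comp ms; exact: measurable_fst.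
by apply: coords_meas_row mF; apply: measurableT_comp ms; exact: measurable_snd.
Qed.

Lemma jmeas_slice d (S : measurableType d) m (f : S -> 'rV[R]_m -> R) s : jmeas f -> coord_meas (f s).
Proof. by move=> mf d' T F mF; apply: (mf d' T (fun=> s)) mF; exact: measurable_cst. Qed.

Lemma coord_meas_row m (f : 'rV[R]_(1 + m) -> R) : coord_meas f ->
  jmeas (fun (t : R) x => f (row_mx (t%:M : 'M[R]_1) x)).
Proof.
by move=> mf d' T s F ms mF; apply: (mf _ T (fun t => row_mx ((s t)%:M : 'M[R]_1) (F t))); exact: coords_meas_row.
Qed.

(** By induction on the dimension: the outer integration variable is moved into the parameter space,
    which becomes [S * R]. *)
Lemma iterated_integral_param d (S : measurableType d) m (f : S -> 'rV[R]_m -> R) :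
  jmeas f -> measurable_fun setT (fun s => iterated_integral (f s)).
Proof.
elim: m d S f => [|m IH] d S f mf /=.
  by apply: (mf _ S id (fun=> 0)) => [|[]//]; exact: measurable_id.
apply: (measurable_Rintegral_param
  (f := fun st : S * R => iterated_integral (fun x : 'rV_m => f st.1 (row_mx (st.2%:M : 'M[R]_1) x)))).
exact/IH/jmeas_row.
Qed.

(** Bounded with bounded support: inherited by slices, and enough for integrability at every
    stage. *)
Definition box_bounded m (A M : R) (f : 'rV[R]_m -> R) :=
  forall x, `|f x| <= M /\ (f x != 0 -> `|x| <= A).

Definition itv_bounded (A M : R) (f : R -> R) :=
  forall x, `|f x| <= M /\ (f x != 0 -> `|x| <= A).

Lemma itv_bounded_supp A M f x : itv_bounded A M f -> ~ `[- A, A]%classic x -> f x = 0.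
Proof.
move=> bf nx; apply/eqP/negPn/negP => fx; apply: nx; rewrite /= in_itv /= -ler_norml.
exact: (bf x).2.
Qed.

Lemma itv_bounded_restrict A M f : itv_bounded A M f -> f = f \_ `[- A, A].
Proof.
move=> bf; apply/funext => x; rewrite patchE; case: ifPn => // /negP nx /=.
by rewrite (itv_bounded_supp bf) // => h; apply: nx; apply/mem_set.
Qed.

Lemma itv_bounded_integrable A M f : measurable_fun setT f -> itv_bounded A M f ->
  mu.-integrable setT (EFin \o f).
Proof.
move=> mf bf; rewrite (itv_bounded_restrict bf) -restrict_EFin.
apply/(integrable_restrict mu (measurable_itv `[- A, A]) measurableT).
rewrite setTI; apply: measurable_bounded_integrable => //.
- by rewrite /= lebesgue_measure_itv /=; case: ifP => _; rewrite -?EFinB ltry.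
- exact: measurable_funTS.
- by exists M; split; [exact: num_real|move=> y My x _ /=; apply: le_trans (bf x).1 (ltW My)].
Qed.

Lemma itv_bounded_int A M f : 0 <= A -> measurable_fun setT f -> itv_bounded A M f ->
  `|\int[mu]_t f t| <= M * (A + A).
Proof.
move=> A0 mf bf.
have M0 : 0 <= M by apply: le_trans (bf 0).1; exact: normr_ge0.
have fi := itv_bounded_integrable mf bf.
rewrite -lee_fin /Rintegral -fine_abse ?integrable_fin_num//.
rewrite fineK ?abse_fin_num ?integrable_fin_num//.
have -> : (\int[mu]_x (f x)%:E = \int[mu]_(x in `[(- A)%R, A]) (f x)%:E)%E.
  by rewrite [RHS]integral_mkcond (restrict_EFin f) -(itv_bounded_restrict bf).
have mf' : measurable_fun `[- A, A] (EFin \o f) by apply: measurable_funTS; exact/measurable_EFinP.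
apply: (le_trans (le_abse_integral mu (measurable_itv _) mf')).
have M0' : (0 <= M%:E)%E by rewrite lee_fin.
have ae : \forall x \ae mu, `[- A, A]%classic x -> (`|(EFin \o f) x| <= M%:E)%E.
  by apply: aeW => x _; rewrite lee_fin; exact: (bf x).1.
have H : (\int[mu]_(x in `[(- A)%R, A]) `|(EFin \o f) x| <= M%:E * mu `[(- A)%R, A])%E.
  exact: integral_le_bound M0' ae.
apply: (le_trans H).
rewrite /= lebesgue_measure_itv /= lte_fin; case: ifP => _; last first.
  by rewrite mule0 lee_fin mulr_ge0// addr_ge0.
by rewrite -EFinB -EFinM lee_fin opprK.
Qed.

Lemma row_mx_norm m (t : R) (x : 'rV[R]_m) (A : R) : `|row_mx (t%:M : 'M[R]_1) x| <= A ->
  `|t| <= A /\ `|x| <= A.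
Proof.
move=> h; have A0 := le_trans (normr_ge0 _) h; split.
  by have := le_trans (le_entry_norm _ (lshift m ord0)) h; rewrite row_mxEl mxE eqxx mulr1n.
by apply: norm_le_entries => // j; have := le_trans (le_entry_norm _ (rshift 1 j)) h; rewrite row_mxEr.
Qed.

Lemma iterated_integral0 m : iterated_integral (fun _ : 'rV[R]_m => 0) = 0.
Proof.
elim: m => //= m IH; under eq_Rintegral do rewrite IH.
by rewrite /Rintegral integral0.
Qed.

Lemma box_bounded_row m A M (f : 'rV[R]_(1 + m) -> R) t : box_bounded A M f ->
  box_bounded A M (fun x => f (row_mx (t%:M : 'M[R]_1) x)).
Proof.
by move=> bf x; have [h1 h2] := bf (row_mx (t%:M : 'M[R]_1) x); split=> // /h2 /row_mx_norm[].
Qed.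

Lemma iterated_integral_bounded m A M (f : 'rV[R]_m -> R) : 0 <= A -> coord_meas f -> box_bounded A M f ->
  `|iterated_integral f| <= M * (A + A) ^+ m.
Proof.
move=> A0; elim: m f => [|m IH] f mf bf /=; first by rewrite expr0 mulr1; exact: (bf 0).1.
rewrite exprSr mulrA; apply: itv_bounded_int => //.
  by apply: (@iterated_integral_param _ R m (fun t x => f (row_mx (t%:M : 'M[R]_1) x))); exact: coord_meas_row.
move=> t; split.
  apply: IH; last exact: box_bounded_row.
  exact: (jmeas_slice t (coord_meas_row mf)).
case: (lerP `|t| A) => // At; rewrite (_ : (fun x => _) = fun=> 0) ?iterated_integral0 ?eqxx//.
apply/funext => x; apply/eqP/negPn/negP => fx.
have /row_mx_norm[tA _] := (bf _).2 fx.
by move: At; rewrite ltNge tA.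
Qed.

Lemma Rintegral_swap A M (k : R * R -> R) : 0 <= A -> measurable_fun setT k ->
  (forall p, `|k p| <= M) -> (forall p, k p != 0 -> `|p.1| <= A /\ `|p.2| <= A) ->
  \int[mu]_t \int[mu]_s k (t, s) = \int[mu]_s \int[mu]_t k (t, s).
Proof.
move=> A0 mk kM ks.
have mk1 t : measurable_fun setT (fun s => k (t, s)) by apply: measurableT_comp mk _; exact: measurable_pair1.
have mk2 s : measurable_fun setT (fun t => k (t, s)) by apply: measurableT_comp mk _; exact: measurable_pair2.
have b1 t : itv_bounded A M (fun s => k (t, s)) by move=> s; split=> // /ks[].
have b2 s : itv_bounded A M (fun t => k (t, s)) by move=> t; split=> // /ks[].
have mE : measurable_fun setT (EFin \o k) by exact/measurable_EFinP.
have ik : (mu \x mu)%E.-integrable setT (EFin \o k).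
  apply/integrable12ltyP => //.
  have mak : measurable_fun setT (fun p => `|k p|) by apply: measurableT_comp mk.
  pose h t := \int[mu]_s `|k (t, s)|.
  have bk t : itv_bounded A M (fun s => `|k (t, s)|).
    by move=> s; rewrite normr_id normr_eq0; exact: b1.
  have mk1a t : measurable_fun setT (fun s => `|k (t, s)|) by apply: measurableT_comp (mk1 t).
  have Eh t : (\int[mu]_s `|(EFin \o k) (t, s)| = (h t)%:E)%E.
    by rewrite /h /Rintegral fineK//; apply: integrable_fin_num => //; exact: itv_bounded_integrable (mk1a t) (bk t).
  under eq_integral do rewrite Eh.
  have mh : measurable_fun setT h by exact: (measurable_Rintegral_param mak).
  have bh : itv_bounded A (M * (A + A)) h.
    move=> t; split; first by apply: itv_bounded_int.
    case: (lerP `|t| A) => // At; rewrite /h.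
    rewrite /Rintegral integral0_eq ?eqxx// => s _.
    have [->|/ks[/= tA]] := eqVneq (k (t, s)) 0; first by rewrite normr0.
    by move: At; rewrite ltNge tA.
  have /(integrable_fin_num measurableT) := itv_bounded_integrable mh bh.
  by rewrite fin_numElt => /andP[].
have := Fubini ik; rewrite /Rintegral => E; congr fine.
transitivity (\int[mu]_t \int[mu]_s (k (t, s))%:E)%E.
  apply: eq_integral => t _; rewrite fineK//; apply: integrable_fin_num => //.
  exact: itv_bounded_integrable (mk1 t) (b1 t).
rewrite E; apply: eq_integral => s _; rewrite fineK//; apply: integrable_fin_num => //.
exact: itv_bounded_integrable (mk2 s) (b2 s).
Qed.

Lemma iterated_integral_swap m A M (f : R -> 'rV[R]_m -> R) : 0 <= A -> jmeas f ->
  (forall t x, `|f t x| <= M) -> (forall t x, f t x != 0 -> `|t| <= A /\ `|x| <= A) ->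
  \int[mu]_t iterated_integral (f t) = iterated_integral (fun x => \int[mu]_t f t x).
Proof.
move=> A0; elim: m f => [|m IH] f mf fM fs //=.
rewrite (@Rintegral_swap A (M * (A + A) ^+ m)
  (fun p => iterated_integral (fun x => f p.1 (row_mx (p.2%:M : 'M[R]_1) x))))//=; first last.
- move=> [t s] /=; apply: contra_neqP => h.
  rewrite (_ : (fun x => _) = fun=> 0) ?iterated_integral0//.
  apply/funext => x; apply/eqP/negPn/negP => fx; apply: h.
  by have [? /row_mx_norm[]] := fs _ _ fx.
- move=> [t s] /=; apply: iterated_integral_bounded => //.
    exact: (jmeas_slice (t, s) (jmeas_row mf)).
  by move=> x; split=> // /fs[_ /row_mx_norm[]].
- exact/iterated_integral_param/jmeas_row.
apply: eq_Rintegral => s _; rewrite (IH (fun t x => f t (row_mx (s%:M : 'M[R]_1) x)))//.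
- move=> d T r F mr mF; apply: (mf d T r (fun t => row_mx (s%:M : 'M[R]_1) (F t))) => //.
  by apply: coords_meas_row mF; exact: measurable_cst.
- by move=> t x /fs[? /row_mx_norm[]].
Qed.

Definition ins m (i : 'I_m.+1) (t : R) (y : 'rV[R]_m) : 'rV[R]_m.+1 :=
  \row_j (if unlift i j is Some k then y 0 k else t).

Lemma ins_ord0 m t (y : 'rV[R]_m) : ins ord0 t y = row_mx (t%:M : 'M[R]_1) y.
Proof.
apply/rowP => j; rewrite mxE; case: unliftP => [k ->|->].
  have -> : lift ord0 k = rshift 1 k :> 'I_(1 + m) by exact/ord_inj.
  exact/esym/row_mxEr.
have -> : ord0 = lshift m ord0 :> 'I_(1 + m) by exact/ord_inj.
by rewrite (row_mxEl (t%:M : 'M[R]_1)) mxE mulr1n.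
Qed.

Lemma ins_lift m (i : 'I_m.+1) t s (y : 'rV[R]_m) :
  ins (lift ord0 i) t (row_mx (s%:M : 'M[R]_1) y : 'rV_m.+1) = row_mx (s%:M : 'M[R]_1) (ins i t y).
Proof.
apply/rowP => j; rewrite mxE; case: unliftP => [k ->|->]; last first.
  have -> : lift ord0 i = rshift 1 i :> 'I_(1 + m.+1) by exact/ord_inj.
  by apply/esym; rewrite (row_mxEr (s%:M : 'M[R]_1)) mxE unlift_none.
have E0 p : ord0 = lshift p ord0 :> 'I_(1 + p) by exact/ord_inj.
case: (unliftP ord0 k) => [l ->|->].
  have -> : lift (lift ord0 i) (lift ord0 l) = rshift 1 (lift i l).
    by apply/ord_inj; rewrite /= /bump /= !add1n ltnS addnS.
  rewrite [RHS](row_mxEr (s%:M : 'M[R]_1) (ins i t y)) [RHS]mxE liftK.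
  have -> : lift ord0 l = rshift 1 l :> 'I_(1 + m) by exact/ord_inj.
  exact: (row_mxEr (s%:M : 'M[R]_1)).
have -> : lift (lift ord0 i) ord0 = lshift m.+1 ord0 :> 'I_(1 + m.+1) by exact/ord_inj.
rewrite [RHS](row_mxEl (s%:M : 'M[R]_1) (ins i t y)) [RHS]mxE E0.
by rewrite (row_mxEl (s%:M : 'M[R]_1)) mxE.
Qed.

Lemma ins_norm m (i : 'I_m.+1) t (y : 'rV[R]_m) A : `|ins i t y| <= A -> `|t| <= A /\ `|y| <= A.
Proof.
move=> h; have A0 := le_trans (normr_ge0 _) h; split.
  by have := le_trans (le_entry_norm _ i) h; rewrite mxE unlift_none.
by apply: norm_le_entries => // j; have := le_trans (le_entry_norm _ (lift i j)) h; rewrite mxE liftK.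
Qed.

(** Makes coordinate [i] the innermost variable. The first coordinate is carried inwards by
    [iterated_integral_swap]; for a later one the outermost integral is left in place and the
    induction hypothesis applies to its slices. *)
Lemma iterated_integral_ins m (i : 'I_m.+1) A M (f : 'rV[R]_m.+1 -> R) : 0 <= A -> coord_meas f ->
  box_bounded A M f ->
  iterated_integral f = iterated_integral (fun y : 'rV[R]_m => \int[mu]_t f (ins i t y)).
Proof.
move=> A0; elim: m i f => [|m IH] i f mf bf.
  rewrite /= (ord1 i); apply: eq_Rintegral => t _; by rewrite ins_ord0.
case: (unliftP ord0 i) => [j ->|->]; last first.
  rewrite [LHS]/= (@iterated_integral_swap m.+1 A M (fun t x => f (row_mx (t%:M : 'M[R]_1) x)))//.
  - congr iterated_integral; apply/funext => y; apply: eq_Rintegral => t _; by rewrite ins_ord0.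
  - exact: coord_meas_row.
  - by move=> t x; exact: (bf _).1.
  - by move=> t x /(bf _).2 /row_mx_norm.
change (\int[mu]_s iterated_integral (fun x : 'rV[R]_m.+1 => f (row_mx (s%:M : 'M[R]_1) x)) =
  \int[mu]_s iterated_integral (fun y : 'rV[R]_m =>
    \int[mu]_t f (ins (lift ord0 j) t (row_mx (s%:M : 'M[R]_1) y)))).
apply: eq_Rintegral => s _; rewrite (IH j).
- congr iterated_integral; apply/funext => y; apply: eq_Rintegral => t _; by rewrite ins_lift.
- exact: (jmeas_slice s (coord_meas_row mf)).
- exact: box_bounded_row.
Qed.

(** Infinite integrals cause no trouble, as [fine] sends both infinities to 0. *)
Lemma Rintegral_opp (f : R -> R) : \int[mu]_t (- f t) = - \int[mu]_t f t.
Proof.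
rewrite /Rintegral integralE [in RHS]integralE.
rewrite (_ : (fun t => (- f t)%:E) = (\- (EFin \o f))%E) // funeposN funenegN.
have a0 : (0 <= \int[mu]_t (EFin \o f)^\+%E t)%E by apply: integral_ge0 => t _; exact: funepos_ge0.
have b0 : (0 <= \int[mu]_t (EFin \o f)^\-%E t)%E by apply: integral_ge0 => t _; exact: funeneg_ge0.
move: a0 b0; case: (\int[mu]_t _)%E => [a| |]; case: (\int[mu]_t _)%E => [b| |]//= _ _.
  by rewrite opprB.
all: by rewrite oppr0.
Qed.

Lemma iterated_integral_opp m (f : 'rV[R]_m -> R) :
  iterated_integral (fun x => - f x) = - iterated_integral f.
Proof.
by elim: m f => //= m IH f; rewrite -Rintegral_opp; apply: eq_Rintegral => t _; exact: IH.
Qed.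

End IteratedIntegral.

(** * Weak derivatives of Lipschitz functions *)

Section LipschitzDerivative.
Variable R : realType.
Local Notation mu := (@lebesgue_measure R).

Lemma stieltjes_itv (f : cumulative R R) a b : a <= b ->
  lebesgue_stieltjes_measure f `]a, b]%classic = (f b - f a)%:E.
Proof.
move=> ab; rewrite [LHS](measurable_mu_extE (wlength f)); last exact: is_ocitv.
exact: wlength_itv_bnd.
Qed.

(** A null set is covered by half-open intervals of total length below [e / (K + 1)]; their
    [f]-lengths are at most [K] times as large. *)
Lemma stieltjes_dominated (f : cumulative R R) (K : R) : 0 <= K ->
  (forall x y, x <= y -> f y - f x <= K * (y - x)) ->
  lebesgue_stieltjes_measure f `<< mu.
Proof.
move=> K0 fK; apply/null_content_dominatesP => N mN N0.
have wK (X : set R) : ocitv X -> (wlength f X <= K%:E * wlength idfun X)%E.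
  move=> [[a b] _ <-] /=; case: (leP a b) => ab.
    by rewrite !wlength_itv_bnd// -EFinM lee_fin fK.
  by rewrite set_itv_ge ?bnd_simp -?leNgt ?(ltW ab)// !wlength0 mule0.
apply/eqP; rewrite eq_le measure_ge0 andbT; apply/lee_addgt0Pr => e e0; rewrite add0e.
have [_ [G [mG NG] <-] Gs] : exists2 s, [set (\sum_(k <oo) wlength idfun (A k))%E | A in
    measurable_cover (N : set (ocitv_type R))] s & (s < (e / (K + 1))%:E)%E.
  apply/ereal_inf_lt; rewrite [ltLHS](_ : _ = 0%E) ?lte_fin ?divr_gt0//.
  by apply: lt_le_trans ltr01 _; rewrite lerDr.
apply: (@le_trans _ _ (\sum_(k <oo) wlength f (G k))%E).
  by apply: ereal_inf_lbound; exists G.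
apply: (@le_trans _ _ (\sum_(k <oo) K%:E * wlength idfun (G k))%E).
  apply: lee_nneseries => k *; first exact: wlength_ge0.
  exact/wK/mG.
rewrite nneseriesZl; last by move=> k _; exact: wlength_ge0.
apply: (@le_trans _ _ (K%:E * (e / (K + 1))%:E)%E).
  by apply: lee_wpmul2l; rewrite ?lee_fin// ltW.
have K1 : 0 < K + 1 by apply: lt_le_trans ltr01 _; rewrite lerDr.
rewrite -EFinM lee_fin mulrCA -[leRHS]mulr1 ler_wpM2l ?(ltW e0)//.
by rewrite ler_pdivrMr// mul1r lerDl.
Qed.

Lemma lipschitz_cont (h : R -> R) C x : (forall s t, `|h s - h t| <= C * `|s - t|) ->
  h y @[y --> x] --> h x.
Proof.
move=> hL; apply/cvgrPdist_lt => e e0.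
have C0 : 0 <= C by have := le_trans (normr_ge0 _) (hL 1 0); rewrite subr0 normr1 mulr1.
have C1 : 0 < C + 1 by apply: lt_le_trans ltr01 _; rewrite lerDr.
near=> y; apply: le_lt_trans (hL x y) _.
apply: (@le_lt_trans _ _ ((C + 1) * `|x - y|)); first by rewrite ler_wpM2r// lerDl.
rewrite -ltr_pdivlMl// mulrC; near: y.
by apply/nbhs_ballP; exists (e / (C + 1)) => //=; rewrite divr_gt0.
Unshelve. all: by end_near. Qed.

(* t |-> h t + C t is nondecreasing and Lipschitz, so its Stieltjes measure has a
   Radon-Nikodym density, and this density is almost everywhere its derivative. *)
Lemma lipschitz_density (h : R -> R) C B1 : (forall s t, `|h s - h t| <= C * `|s - t|) -> 0 < B1 ->
  exists d : R -> R, [/\ mu.-integrable setT (EFin \o d),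
    forall a b, - B1 <= a -> a <= b -> b <= B1 ->
      \int[mu]_(t in `]a, b]) d t = h b - h a + C * (b - a) &
    {ae mu, forall t, - B1 < t -> t < B1 -> is_derive t 1 h (d t - C)}].
Proof.
move=> hL B0; have C0 : 0 <= C by have := le_trans (normr_ge0 _) (hL 1 0); rewrite subr0 normr1 mulr1.
pose f t := h t + C * t.
have nd : forall x y : R, x <= y -> f x <= f y.
  move=> x y xy; have := hL x y; rewrite (ler0_norm (_ : x - y <= 0)) ?subr_le0// => h1.
  rewrite /f.
  by have := ler_norm (h x - h y); move: h1; rewrite opprB mulrBr; move: (C * x) (C * y); clear => a b; lra.
have rc : forall x, f y @[y --> x^'+] --> f x.
  move=> x; apply: (@cvg_at_right_filter _ _ f x); apply: cvgD; first exact: lipschitz_cont hL.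
  by apply: cvgMr; exact: cvg_id.
pose cf : cumulative R R := HB.pack f (isCumulative.Build R _ R f nd rc).
pose nu0 := lebesgue_stieltjes_measure cf.
have dom0 : nu0 `<< mu.
  apply: (@stieltjes_dominated cf (2 * C)) => [|x y xy]; first by rewrite mulr_ge0.
  have := hL y x; rewrite (ger0_norm (_ : 0 <= y - x)) ?subr_ge0// => h1.
  have := ler_norm (h y - h x); move: h1; rewrite /= /f -!mulrA !mulrBr.
  by move: (C * x) (C * y); clear => a b; lra.
have BB : - B1 <= B1 by rewrite (le_trans (y := 0))// ?oppr_le0 ltW.
(* Restriction to a bounded interval makes the Stieltjes measure finite, so that its density is
   integrable. *)
pose I : set (measurableTypeR R) := `]- B1, B1]%classic.
have mI : measurable I by exact: measurable_itv.
have fI : (nu0 I < +oo)%E by rewrite /nu0 stieltjes_itv// ltry.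
pose nu : {finite_measure set (measurableTypeR R) -> \bar R} := mfrestr mI fI.
have dom : nu `<< mu.
  apply/null_content_dominatesP => N mN N0; rewrite /nu /= /mfrestr /mrestr.
  by apply: (dom0 N); [exact/measure0_null_setP|exact: measurableI|exact: subIsetl].
have [d [d0 dfin di dE]] := radon_nikodym_sigma_finite dom.
have Ed : EFin \o (fine \o d) = d by apply/funext => x /=; rewrite fineK.
have dint a b : - B1 <= a -> a <= b -> b <= B1 ->
    \int[mu]_(t in `]a, b]) (fine \o d) t = h b - h a + C * (b - a).
  move=> Ba ab bB; rewrite /Rintegral.
  have -> : (\int[mu]_(t in [set` `]a, b]%R]) ((fine \o d) t)%:E)%E = nu `]a, b]%classic.
    by rewrite dE; [apply: eq_integral => t _; rewrite /= fineK|exact: measurable_itv].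
  rewrite /nu /= /mfrestr /mrestr (_ : `]a, b] `&` I = `]a, b]%classic); last first.
    apply/seteqP; split=> t /=; first by case.
    rewrite !in_itv /= => /andP[a1 a2]; split; first by rewrite a1.
    by rewrite /I /= in_itv /= (le_lt_trans Ba a1) (le_trans a2 bB).
  by rewrite stieltjes_itv// /= /f; ring.
have iD : mu.-integrable setT (EFin \o (fine \o d)) by rewrite Ed.
move: (fine \o d) iD dint => D iD dint {d d0 dfin di dE Ed dom nu fI mI I BB dom0 nu0 cf rc nd f}.
exists D; split => //.
have ly : locally_integrable setT D.
  by apply: open_integrable_locally; first exact: openT.
have iy y : mu.-integrable [set` Interval (BRight (- B1)) (BRight y)] (EFin \o D).
  by apply: integrableS iD => //; exact: measurable_itv.
(* Lebesgue differentiation: almost everywhere the primitive of the density has the density as its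
   derivative. *)
have H := FTC1 iy ly; apply: (@filterS _ _ (ae_filter_ringOfSetsType (@lebesgue_measure R)) _ _ _ H) => t + tB1 tB2.
rewrite /= lte_fin => /(_ tB1) [dF F'].
have hF : is_derive t 1 (fun x => \int[mu]_(t in [set` Interval (BRight (- B1)) (BRight x)]) D t) (D t).
  by apply: DeriveDef; [exact: dF|rewrite -derive1E; exact: F'].
have hf : is_derive t 1 (fun x => h x - h (- B1) + C * (x + B1)) (D t).
  apply: near_eq_is_derive hF; near=> x.
  have xB1 : - B1 <= x.
    by apply/ltW; rewrite ltrNl; near: x; apply: Nlt_nbhsl; rewrite ltrNl.
  have xB2 : x <= B1 by apply/ltW; near: x; exact: lt_nbhsl.
  by have := dint (- B1) x (lexx _) xB1 xB2; rewrite opprK.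
have hg : is_derive t 1 (C *: id + cst (C * B1 - h (- B1)) : R -> R) C.
  by apply: is_derive_eq; rewrite addr0 /GRing.scale /= mulr1.
have -> : h = (fun x => h x - h (- B1) + C * (x + B1)) - (C *: id + cst (C * B1 - h (- B1))).
  by apply/funext => x; rewrite !fctE /GRing.scale /=; ring.
exact: is_deriveB.
Unshelve. all: by end_near. Qed.

(** The margins are nested: [h] vanishes beyond [A], the derivative is cut off at [A + 1], and the
    density is valid up to [A + 2]. The integral is then [h (A + 1) - h (- (A + 1)) = 0]. *)
Lemma lipschitz_derivative (h : R -> R) C A : 0 < A -> (forall s t, `|h s - h t| <= C * `|s - t|) ->
  (forall t, h t != 0 -> `|t| <= A) ->
  exists D : R -> R, [/\ mu.-integrable setT (EFin \o D), \int[mu]_t D t = 0 &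
    {ae mu, forall t : R, is_derive (t : R) (1 : R) h (D t)}].
Proof.
move=> A0 hL hA; have A2 : 0 < A + 2 by rewrite addr_gt0.
have [d [di dE dD]] := lipschitz_density hL A2.
pose I : set R := `]- (A + 1), A + 1]%classic.
have mI : measurable I by exact: measurable_itv.
have iC : mu.-integrable I (EFin \o cst C).
  apply: measurable_bounded_integrable => //.
    by rewrite /I /= lebesgue_measure_itv /=; case: ifP => _; rewrite -?EFinB ltry.
  by exists `|C|; split; [exact: num_real|move=> y Cy x _ /=; exact: ltW].
have id' : mu.-integrable I (EFin \o d) by apply: integrableS di.
have h0 t : A < `|t| -> h t = 0.
  by move=> At; apply/eqP/negPn/negP => /hA; rewrite leNgt At.
exists ((fun t => d t - C) \_ I); split.
- rewrite -restrict_EFin; apply/(integrable_restrict mu mI measurableT); rewrite setTI.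
  have -> : EFin \o (fun t => d t - C) = ((EFin \o d) \- (EFin \o cst C))%E by [].
  by apply: integrableB.
- rewrite -Rintegral_mkcond RintegralB// dE; try (move: A0; clear; lra).
  rewrite !h0 ?normrN ?ger0_norm; try (move: A0; clear; lra).
  rewrite Rintegral_cst// /I /= lebesgue_measure_itv /= lte_fin.
  rewrite ifT; last by move: A0; clear; lra.
  by rewrite -EFinB /=; ring.
- apply: (@filterS _ _ (ae_filter_ringOfSetsType (@lebesgue_measure R)) _ _ _ dD) => t ht.
  rewrite patchE; case: ifPn => [/set_mem|/negP nI].
    rewrite /I /= in_itv /= => /andP[t1 t2]; apply: ht; move: t1 t2; clear; lra.
  apply: (@near_eq_is_derive R R^o R^o (cst 0) h (t : R) 1 0).
  have At : A < `|t|.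
    rewrite ltNge ler_norml; apply/negP => /andP[t1 t2]; apply: nI; apply/mem_set.
    by rewrite /I /= in_itv /=; apply/andP; split; move: t1 t2; clear; lra.
  apply/nbhs_ballP; exists (`|t| - A) => /= [|s]; first by rewrite subr_gt0.
  rewrite /ball /= => ts; apply/esym/h0.
  have : `|t| <= `|t - s| + `|s| by rewrite -[X in `|X| <= _](subrK s) ler_normD.
  by move: ts; clear; lra.
Qed.

End LipschitzDerivative.

(** * The product rule along a line *)

Section WeakDerivative.
Variable R : realType.
Local Notation mu := (@lebesgue_measure R).

Definition clamp (L x : R) : R := Num.max (- L) (Num.min L x).

Lemma clamp_bound L x : 0 <= L -> `|clamp L x| <= L.
Proof.
move=> L0; rewrite ler_norml /clamp le_max lexx /= ge_max ge_min lexx /= andbT.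
by rewrite (le_trans (y := 0))// oppr_le0.
Qed.

Lemma clamp_id L x : `|x| <= L -> clamp L x = x.
Proof. by rewrite ler_norml => /andP[h1 h2]; rewrite /clamp min_r// max_r. Qed.

(* The limit of q if it exists and |q| <= L eventually; clamping makes it bounded
   and measurable without any convergence assumption. *)
Definition upper_derivative L (q : nat -> R) : R := clamp L (limn_sup (fun k => clamp L (q k) : R^o)).

Lemma upper_derivativeE L (q : nat -> R) (l : R) : (\forall k \near \oo, `|q k| <= L) ->
  q k @[k --> \oo] --> l -> upper_derivative L q = l.
Proof.
move=> hL ql.
have ql' : (fun k => clamp L (q k) : R^o) k @[k --> \oo] --> (l : R^o).
  apply: cvg_trans ql; apply: near_eq_cvg; near=> k.
  by apply/esym/clamp_id; near: k.
rewrite /upper_derivative cvg_limn_supE; last by apply/cvg_ex; exists l.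
rewrite (cvg_lim _ ql')//; apply: clamp_id.
rewrite leNgt; apply/negP => Ll.
have h : \forall k \near \oo, L < `|q k| by apply: cvgr_gt Ll; exact: cvg_norm ql.
have [k [h1]] := filter_ex (filterI hL h).
by rewrite ltNge h1.
Unshelve. all: by end_near. Qed.

Section Line.
Variables (O : set R) (F P P' : R -> R) (M L Mp Lp A : R).
Hypotheses (A0 : 0 < A) (L0 : 0 <= L).
Hypothesis oO : forall t, O t -> exists2 d, 0 < d & forall s, `|s - t| < d -> O s.
Hypothesis FM : forall t, `|F t| <= M.
Hypothesis FL : forall s t, (forall r, 0 <= r -> r <= 1 -> O (s + r * (t - s))) ->
  `|F t - F s| <= L * `|t - s|.
Hypothesis dP : forall t : R, is_derive t (1 : R) P (P' t).
Hypothesis PM : forall t, `|P t| <= Mp.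
Hypothesis PL : forall s t, `|P t - P s| <= Lp * `|t - s|.
Hypothesis PA : forall t, P t != 0 -> `|t| <= A.
Hypothesis PO : forall t, ~ O t -> exists2 d, 0 < d & forall s, `|s - t| < d -> P s = 0.

(** [F] may jump across the complement of [O]. If the segment meets the complement, [P] vanishes at
    the meeting point, so [P s] and [P t] are bounded by [Lp] times the distances to it, and these
    add up to [|t - s|]. *)
Lemma mul_lipschitz s t : `|F t * P t - F s * P s| <= (L * Mp + M * Lp) * `|t - s|.
Proof.
have M0 : 0 <= M := le_trans (normr_ge0 _) (FM 0).
have Mp0 : 0 <= Mp := le_trans (normr_ge0 _) (PM 0).
have d0 : 0 <= `|t - s| by [].
have Lp0 : 0 <= Lp by have := le_trans (normr_ge0 _) (PL 0 1); rewrite subr0 normr1 mulr1.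
case: (pselect (forall r, 0 <= r -> r <= 1 -> O (s + r * (t - s)))) => seg.
  rewrite (_ : _ - _ = (F t - F s) * P t + F s * (P t - P s)); last by ring.
  apply: le_trans (ler_normD _ _) _; rewrite !normrM mulrDl; apply: lerD.
    by rewrite mulrAC; apply: ler_pM => //; exact: FL.
  by rewrite -mulrA; apply: ler_pM.
have [r [r0 r1 nO]] : exists r, [/\ 0 <= r, r <= 1 & ~ O (s + r * (t - s))].
  apply: contrapT => h; apply: seg => r r0 r1; apply: contrapT => nO; apply: h; by exists r.
have [d e0 /(_ (s + r * (t - s)))] := PO nO.
rewrite subrr normr0 => /(_ e0) P0.
have hs : `|P s| <= Lp * (r * `|t - s|).
  have := PL (s + r * (t - s)) s; rewrite P0 subr0.
  by rewrite opprD addrA subrr sub0r normrN normrM (ger0_norm r0).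
have ht : `|P t| <= Lp * ((1 - r) * `|t - s|).
  have := PL (s + r * (t - s)) t; rewrite P0 subr0.
  rewrite (_ : t - (s + r * (t - s)) = (1 - r) * (t - s)); last by ring.
  by rewrite normrM (ger0_norm (_ : 0 <= 1 - r)) ?subr_ge0.
apply: le_trans (ler_normB _ _) _; rewrite !normrM.
have h1 : `|F t| * `|P t| <= M * (Lp * ((1 - r) * `|t - s|)) by apply: ler_pM.
have h2 : `|F s| * `|P s| <= M * (Lp * (r * `|t - s|)) by apply: ler_pM.
apply: le_trans (lerD h1 h2) _.
rewrite (_ : M * _ + _ = M * Lp * `|t - s|); last by ring.
by rewrite mulrDl lerDr !mulr_ge0.
Qed.

Definition quotients (f : R -> R) (t : R) (k : nat) : R := k.+1%:R * (f (t + k.+1%:R^-1) - f t).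

Lemma quotients_cvg (f : R -> R) (t l : R) : is_derive t (1 : R) f l ->
  quotients f t k @[k --> \oo] --> l.
Proof.
move=> fd.
have := cvg_dnbhs_at_right (@ex_derive _ _ _ _ _ _ _ fd).
rewrite -/(derive f t 1) derive_val => /cvg_at_rightP h.
have {}h := h (fun k => k.+1%:R^-1).
have -> : quotients f t = (fun k => (k.+1%:R^-1 : R)^-1 *: ((f \o shift t) ((k.+1%:R^-1)%:A) - f t)).
  apply/funext => k; rewrite /quotients /= invrK /GRing.scale /= mulr1.
  by rewrite [_^-1 + t]addrC.
by apply: h; split; [move=> k; rewrite invr_gt0|exact: cvg_harmonic].
Qed.

(** A product rule that does not presuppose differentiability of [F]: wherever [F * P] is
    differentiable and [P t] is nonzero, the quotients of [F] converge because those of [F * P] and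
    [P] do. [D] is the derivative of the compactly supported product, hence has zero integral. *)
Lemma weak_derivative_line : exists D : R -> R, [/\ mu.-integrable setT (EFin \o D),
  \int[mu]_t D t = 0 &
  {ae mu, forall t : R, F t * P' t + upper_derivative L (quotients F t) * P t = D t}].
Proof.
have hA (t : R) : F t * P t != 0 -> `|t| <= A.
  by move=> FP; apply: PA; move: FP; rewrite mulf_eq0 negb_or => /andP[].
have [D [iD D0 dD]] := lipschitz_derivative A0 (fun s t => mul_lipschitz t s) hA.
exists D; split => //.
apply: (@filterS _ _ (ae_filter_ringOfSetsType (@lebesgue_measure R)) _ _ _ dD) => t dt.
case: (pselect (O t)) => Ot; last first.
  have [d d0 Pd] := PO Ot.
  have z : is_derive (t : R) (1 : R) (fun x => F x * P x) 0.
    apply: (@near_eq_is_derive R R^o R^o (cst 0) _ (t : R) 1 0).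
    by apply/nbhs_ballP; exists d => //= s; rewrite /ball /= distrC => /Pd ->; rewrite mulr0.
  have z' : is_derive (t : R) (1 : R) P 0.
    apply: (@near_eq_is_derive R R^o R^o (cst 0) _ (t : R) 1 0).
    by apply/nbhs_ballP; exists d => //= s; rewrite /ball /= distrC => /Pd ->.
  have -> : D t = 0 by rewrite -(@derive_val _ _ _ _ _ _ _ dt) (@derive_val _ _ _ _ _ _ _ z).
  have -> : P' t = 0 by rewrite -(@derive_val _ _ _ _ _ _ _ (dP t)) (@derive_val _ _ _ _ _ _ _ z').
  by rewrite Pd ?subrr ?normr0// !mulr0 addr0.
have [d d0 Od] := oO Ot.
have hk : \forall k \near \oo, `|(t + k.+1%:R^-1) - t| < d.
  near=> k; rewrite addrC addKr ger0_norm//; near: k.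
  exact: (near_infty_natSinv_lt (PosNum d0)).
have qL : \forall k \near \oo, `|quotients F t k| <= L.
  apply: filterS hk => k hk; rewrite /quotients normrM ger0_norm//.
  rewrite -ler_pdivlMl// mulrC.
  have := FL (s := t) (t := t + k.+1%:R^-1); rewrite [t + _ - t]addrC addKr (ger0_norm (_ : 0 <= k.+1%:R^-1)) ?invr_ge0//.
  apply=> r r0 r1; apply: Od; rewrite addrC addKr normrM (ger0_norm r0).
  apply: le_lt_trans hk; rewrite [t + _ - t]addrC addKr.
  by rewrite ler_piMl.
have cF : F (t + k.+1%:R^-1) @[k --> \oo] --> F t.
  apply/cvgrPdist_lt => e e0.
  have L1 : 0 < L + 1 by apply: lt_le_trans ltr01 _; rewrite lerDr.
  near=> k.
  have : `|quotients F t k| <= L by near: k.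
  rewrite /quotients normrM ger0_norm// -ler_pdivlMl// distrC => h.
  apply: le_lt_trans h _; rewrite mulrC.
  apply: (@le_lt_trans _ _ ((L + 1) * k.+1%:R^-1)); first by rewrite ler_wpM2r// lerDl.
  rewrite mulrC -ltr_pdivlMr//; near: k.
  exact: (near_infty_natSinv_lt (PosNum (divr_gt0 e0 L1))).
have cP := quotients_cvg (dP t).
have cD := quotients_cvg dt.
have E k : quotients F t k * P t = quotients (fun x => F x * P x) t k - F (t + k.+1%:R^-1) * quotients P t k.
  by rewrite /quotients; ring.
have c1 : (fun k => quotients F t k * P t) k @[k --> \oo] --> D t - F t * P' t.
  have -> : (fun k => quotients F t k * P t) = (fun k => quotients (fun x => F x * P x) t k - F (t + k.+1%:R^-1) * quotients P t k).
    exact/funext.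
  by apply: cvgB cD _; apply: cvgM cF cP.
(* At a zero of [P] the quotients of [F] may diverge, but their product with [P t] is 0, so the
   derivative of the product is [F t * P' t]. *)
have [P0|Pn0] := eqVneq (P t) 0.
  have c2 : (fun k => quotients F t k * P t) k @[k --> \oo] --> (0 : R).
    by rewrite P0 (_ : (fun k => _) = cst 0); [exact: cvg_cst|apply/funext => k; rewrite mulr0].
  have /eqP : D t - F t * P' t = 0 by apply: (cvg_unique _ c1 c2).
  by rewrite subr_eq0 P0 mulr0 addr0 => /eqP.
have c3 : quotients F t k @[k --> \oo] --> (D t - F t * P' t) / P t.
  have -> : quotients F t = (fun k => quotients F t k * P t / P t) by apply/funext => k; rewrite mulfK.
  by apply: cvgM c1 _; exact: cvg_cst.
by rewrite (upper_derivativeE qL c3) mulfVK// addrC subrK.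
Unshelve. all: by end_near. Qed.

End Line.
End WeakDerivative.

(** * From Lipschitz bounds along segments to W^{1,oo} *)

Section LipschitzSobolev.
Variable R : realType.
Local Notation mu := (@lebesgue_measure R).

Lemma bounded_derive_lipschitz (P P' : R -> R) (M : R) :
  (forall t : R, is_derive t (1 : R) P (P' t)) -> (forall t, `|P' t| <= M) ->
  forall s t, `|P t - P s| <= M * `|t - s|.
Proof.
move=> dP PM s t; wlog st : s t / s <= t.
  by case: (leP s t) => [|/ltW] st h; [exact: h|rewrite distrC [`|t - s|]distrC; exact: h].
have cP : {within `[s, t], continuous P}.
  apply: continuous_subspaceT => x; apply/differentiable_continuous/derivable1_diffP.
  exact: (@ex_derive _ _ _ _ _ _ _ (dP x)).
have [c _ ->] := MVT_segment st (fun x _ => dP x) cP.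
by rewrite normrM ler_wpM2r.
Qed.

Section Fixed.
Variables (m : nat) (Omega : set 'rV[R]_m.+1) (v : 'rV[R]_m.+1 -> R) (L : R) (i : 'I_m.+1).
Local Notation cl := (closure Omega).
Hypotheses (oO : open Omega) (cO : compact cl) (O0 : Omega !=set0) (L0 : 0 <= L).
Hypotheses (vc : cont_on cl v) (vL : segLip Omega L v).
Local Notation e := (delta_mx 0 i : 'rV[R]_m.+1).
Local Notation v0 := (zext Omega v).

Definition weak_derivative x := upper_derivative L (quotients (fun s => v0 (x + s *: e)) 0).

Lemma cont_on_Omega : cont_on Omega v.
Proof. by apply: (@cont_on_subset _ _ _ _ _ _ vc); exact: subset_closure. Qed.

(** A limit superior of measurable functions; the inner clamps keep each sequence bounded, as the
    measurability of [limn_sup] requires. *)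
Lemma weak_derivative_meas : coord_meas weak_derivative.
Proof.
move=> d T F mF.
have mv : coord_meas v0 := coord_meas_zext oO cont_on_Omega.
have mq k : measurable_fun setT (fun t => quotients (fun s => v0 (F t + s *: e)) 0 k).
  have mF' (c : R) : measurable_fun setT (fun t => v0 (F t + c *: e)).
    apply: (mv _ T (fun t => F t + c *: e)) => j.
    rewrite (_ : (fun t => _) = fun t => F t 0 j + (c *: e) 0 j).
      by apply: measurable_funD; [exact: mF|exact: measurable_cst].
    by apply/funext => t; rewrite !mxE.
  by apply: measurable_funM; [exact: measurable_cst|apply: measurable_funB].
have mc (f : T -> R) : measurable_fun setT f -> measurable_fun setT (fun t => clamp L (f t)).
  move=> mf; apply: measurable_maxr; first exact: measurable_cst.
  by apply: measurable_minr => //; exact: measurable_cst.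
apply: (mc (fun t => limn_sup (fun k => clamp L (quotients (fun s => v0 (F t + s *: e)) 0 k) : R^o))).
apply: (@measurable_fun_limn_sup _ _ _ _ (fun k t => clamp L (quotients (fun s => v0 (F t + s *: e)) 0 k))).
- move=> t _; exists L => _ [k _ <-].
  by have := @clamp_bound R L (quotients (fun s => v0 (F t + s *: e)) 0 k) L0; rewrite ler_norml => /andP[].
- move=> t _; exists (- L) => _ [k _ <-].
  by have := @clamp_bound R L (quotients (fun s => v0 (F t + s *: e)) 0 k) L0; rewrite ler_norml => /andP[].
- by move=> k; exact: mc.
Qed.

Lemma ins_line t (y : 'rV[R]_m) : ins i t y = ins i 0 y + t *: e.
Proof.
apply/rowP => j; rewrite !mxE eqxx /=; case: (unliftP i j) => [k ->|->].
  by rewrite [lift i k == i]eq_sym (negbTE (neq_lift i k)) mulr0 addr0.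
by rewrite eqxx mulr1 add0r.
Qed.

Lemma ins_coords (y : 'rV[R]_m) : coords_meas (fun t : R => ins i t y).
Proof.
move=> j; rewrite (_ : (fun t => _) = fun t => if unlift i j is Some k then y 0 k else t); last first.
  by apply/funext => t; rewrite mxE.
by case: (unlift i j) => [k|]; [exact: measurable_cst|exact: measurable_id].
Qed.

Lemma norm_line (x : 'rV[R]_m.+1) s t : `|(x + t *: e) - (x + s *: e)| <= `|t - s|.
Proof.
rewrite (_ : _ - _ = (t - s) *: e); last by vring.
by rewrite normrZ ler_piMr// norm_delta_le1.
Qed.

Lemma weak_derivative_line_eq x t :
  weak_derivative (x + t *: e) = upper_derivative L (quotients (fun s => v0 (x + s *: e)) t).
Proof.
rewrite /weak_derivative; congr (upper_derivative L _); apply/funext => k.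
by rewrite /quotients add0r scale0r addr0 -!addrA -scalerDl.
Qed.

(* Along each line parallel to e, zext v * phi is Lipschitz with compact support, so
   its a.e. derivative has zero integral; Fubini makes these integrals innermost. *)
Lemma weak_derivative_partial : weak_partial Omega i v weak_derivative.
Proof.
move=> phi [Cphi [K [cK KO Kphi]]].
have [M M0 vM] := cont_on_bounded cO O0 vc.
have [A A0 OA] : exists2 A, 0 < A & forall x, cl x -> `|x| <= A.
  have [|A A0 hA] := @cont_on_bounded R _ _ cO O0 (fun x => `|x|).
    move=> x _ r r0; exists r => // y _; apply: le_lt_trans; exact: ler_dist_dist.
  exists (A + 1) => [|x clx]; first by apply: lt_le_trans ltr01 _; rewrite lerDr.
  by apply: le_trans (_ : A <= _); [have := hA x clx; rewrite normr_id|rewrite lerDl].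
have subcl : Omega `<=` cl by exact: subset_closure.
have phic : cont_on setT phi := Ck_cont_on (Cphi 0).
have [_ /(_ i)[dphi /within_contP pphic]] := Cphi 1%N.
have nK x : ~ K x -> exists2 d, 0 < d & forall y, `|y - x| < d -> phi y = 0.
  move=> nKx; have : open (~` K) by apply: closed_openC; apply: compact_closed cK; exact: norm_hausdorff.
  by move=> /openP_rV /(_ x nKx)[d d0 hd]; exists d => // y /hd /Kphi.
have pK x : ~ K x -> partial i phi x = 0.
  move=> /nK[d d0 hd]; rewrite /partial.
  rewrite (@near_eq_derive _ _ _ phi (cst 0)) ?derive_cst//.
  by apply/nbhs_rVP; exists d.
have bnd (f : 'rV[R]_m.+1 -> R) : cont_on setT f -> (forall x, ~ K x -> f x = 0) ->
    exists2 C, 0 <= C & forall x, `|f x| <= C.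
  move=> fc f0; have [|C C0 hC] := @cont_on_bounded R _ _ cO O0 f.
    by apply: (@cont_on_subset _ _ _ _ _ _ fc) => x _.
  exists C => // x; case: (pselect (K x)) => [/KO/subcl/hC//|/f0 ->].
  by rewrite normr0.
have [Mp Mp0 hMp] := bnd phi phic Kphi.
have [Mq Mq0 hMq] := bnd _ pphic pK.
have suppO (f : 'rV[R]_m.+1 -> R) x : (forall x, ~ K x -> f x = 0) -> f x != 0 -> Omega x.
  by move=> f0 fx; apply: KO; apply: contrapT => /f0 f0'; move: fx; rewrite f0' eqxx.
have v0M x : `|v0 x| <= M.
  by rewrite /zext; case: asboolP => [/subcl/vM//|_]; rewrite normr0.
pose f1 x := v0 x * partial i phi x.
pose f2 x := weak_derivative x * phi x.
have mf1 : coord_meas f1.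
  move=> d T F mF; apply: measurable_funM.
    exact: (coord_meas_zext oO cont_on_Omega mF).
  exact: (coord_meas_cont pphic mF).
have mf2 : coord_meas f2.
  move=> d T F mF; apply: measurable_funM.
    exact: (weak_derivative_meas mF).
  exact: (coord_meas_cont phic mF).
have bf1 : box_bounded A (M * Mq) f1.
  move=> x; split; first by rewrite normrM; apply: ler_pM.
  by rewrite mulf_eq0 negb_or => /andP[_ /(suppO _ _ pK) /subcl /OA].
have bf2 : box_bounded A (L * Mp) f2.
  move=> x; split; first by rewrite normrM; apply: ler_pM => //; exact: clamp_bound.
  by rewrite mulf_eq0 negb_or => /andP[_ /(suppO _ _ Kphi) /subcl /OA].
(* Outside Omega the partial derivative of [phi] vanishes, so [v] may be replaced by its cut-off. *)
have -> : (fun x => v x * partial i phi x) = f1.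
  apply/funext => x; rewrite /f1 /zext; case: asboolP => // nO.
  by rewrite pK ?mulr0// => /KO.
rewrite (iterated_integral_ins i (ltW A0) mf1 bf1) (iterated_integral_ins i (ltW A0) mf2 bf2).
rewrite -iterated_integral_opp; congr iterated_integral; apply/funext => y.
have sl (f : 'rV[R]_m.+1 -> R) C : coord_meas f -> box_bounded A C f ->
    mu.-integrable setT (EFin \o (fun t => f (ins i t y))).
  move=> mf bf; apply: (@itv_bounded_integrable _ A C).
    exact: (mf _ _ _ (ins_coords y)).
  by move=> t; have [h1 h2] := bf (ins i t y); split=> // /h2 /ins_norm[].
have i1 := sl f1 _ mf1 bf1; have i2 := sl f2 _ mf2 bf2.
apply/eqP; rewrite -addr_eq0 -RintegralD//; apply/eqP.
pose x0 := ins i 0 y.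
have [ | | | | | | | |D [iD D0 aeD]] := @weak_derivative_line R [set t | Omega (x0 + t *: e)]
  (fun t => v0 (x0 + t *: e)) (fun t => phi (x0 + t *: e)) (fun t => partial i phi (x0 + t *: e))
  M L Mp Mq A A0 L0.
- move=> t /= Ot; have [d d0 hd] := (openP_rV Omega).1 oO _ Ot.
  by exists d => // s st; apply: hd; exact: le_lt_trans (norm_line _ _ _) st.
- by move=> t; exact: v0M.
- move=> s t seg.
  have seg' r : 0 <= r -> r <= 1 -> Omega ((x0 + s *: e) + r *: ((x0 + t *: e) - (x0 + s *: e))).
    move=> r0 r1; have := seg r r0 r1; rewrite /=; congr Omega; vring.
  have h0 : Omega (x0 + s *: e) by have := seg 0 (lexx _) ler01; rewrite /= mul0r addr0.
  have h1 : Omega (x0 + t *: e) by have := seg 1 ler01 (lexx _); rewrite /= mul1r [s + _]addrC subrK.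
  rewrite /zext; case: asboolP => // _; case: asboolP => // _.
  by apply: le_trans (vL seg') _; rewrite ler_wpM2l// norm_line.
- by move=> t; apply: derivable_line; exact: dphi.
- by move=> t; exact: hMp.
- apply: bounded_derive_lipschitz (fun t => hMq _) => t.
  by apply: derivable_line; exact: dphi.
- move=> t /(suppO _ _ Kphi) /subcl /OA; rewrite -ins_line => /ins_norm[]//.
- move=> t /= nO; have [|d d0 hd] := nK (x0 + t *: e); first by move=> /KO.
  by exists d => // s st; apply: hd; exact: le_lt_trans (norm_line _ _ _) st.
rewrite -[RHS]D0 /Rintegral; congr fine; apply: ae_eq_integral => //.
- by have := integrableD measurableT i1 i2; move=> /measurable_int.
- exact: measurable_int iD.
- apply: (@filterS _ _ (ae_filter_ringOfSetsType (@lebesgue_measure R)) _ _ _ aeD) => t <- _.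
  by rewrite /f1 /f2 ins_line weak_derivative_line_eq.
Qed.

End Fixed.

Lemma segLip_W1oo m (Omega : set 'rV[R]_m.+1) v L : open Omega -> compact (closure Omega) ->
  Omega !=set0 -> 0 <= L -> cont_on (closure Omega) v -> segLip Omega L v -> W1oo Omega v.
Proof.
move=> oO cO O0 L0 vc vL; split; first exact/within_contP.
  have [C _ hC] := cont_on_bounded cO O0 vc.
  by exists C => x /(@subset_closure _ Omega) /hC.
move=> i; exists (weak_derivative Omega v L i); split.
- by apply: coord_meas_borel; exact: weak_derivative_meas.
- by exists L => x _; exact: clamp_bound.
- exact: weak_derivative_partial.
Qed.

End LipschitzSobolev.

(** * Additive eigenvalues *)

Section Eigenvalue.
Variables (R : realType) (m : nat) (Omega : set 'rV[R]_m) (H : 'rV[R]_m -> 'rV[R]_m -> R).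

Lemma ereal_inf_attained (S : set R) c : S c -> (forall a, S a -> c <= a) ->
  c%:E = ereal_inf [set a%:E | a in S].
Proof.
move=> Sc lb; apply/eqP; rewrite eq_le; apply/andP; split.
  by apply: le_ereal_inf_tmp => _ [a Sa <-]; rewrite lee_fin lb.
by apply: ereal_inf_lbound; exists c.
Qed.

Lemma subsolutionW B a v : subsolution Omega H B a v -> subsolution_in Omega H a v.
Proof.
move=> [uv h]; split=> // phi x C Ox mx.
by have [h1 _] := h phi x C (subset_closure Ox) mx; exact: h1.
Qed.

Lemma subsolution_in_le a a' v : a <= a' -> subsolution_in Omega H a v -> subsolution_in Omega H a' v.
Proof. by move=> aa [uv h]; split=> // phi x C Ox mx; apply: le_trans (h phi x C Ox mx) aa. Qed.

Lemma state_constraint_sub a v : open Omega -> subsolution_in Omega H a v ->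
  subsolution Omega H (@state_constraint R m) a v.
Proof.
move=> oO [uv h]; split=> // phi x C _ mx; split=> [Ox|_]; first exact: h.
by rewrite ge_min /state_constraint oppr_le0 ler01 orbT.
Qed.

End Eigenvalue.

Theorem theorem1p2 (R : realType) (n : nat) (Omega : set 'rV[R]_n.+1)
    (H : 'rV[R]_n.+1 -> 'rV[R]_n.+1 -> R)
    (domainO : bounded_domain Omega)
    (contH : {within [set xp : 'rV[R]_n.+1 * 'rV[R]_n.+1 | closure Omega xp.1],
               continuous (fun xp => H xp.1 xp.2)})
    (coerH : coercive Omega H) :
  (* (i) *)
  (Ck_boundary 1 Omega ->
   forall (gamma : 'rV[R]_n.+1 -> 'rV[R]_n.+1) (g : 'rV[R]_n.+1 -> R),
     {within closure Omega, continuous gamma} ->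
     {within bdry Omega, continuous g} ->
     (forall x nu, bdry Omega x -> outer_unit_normal Omega x nu ->
        0 < dotp nu (gamma x)) ->
     exists c_n : R,
       [/\ exists v, W1oo Omega v /\ solution Omega H (neumann gamma g) c_n v,
           forall (w : 'rV[R]_n.+1 -> R) (a : R),
             {within closure Omega, continuous w} ->
             solution Omega H (neumann gamma g) a w -> a = c_n &
           c_n%:E = ereal_inf [set a%:E | a in [set a : R |
             exists w, subsolution Omega H (neumann gamma g) a w]]])
  /\
  (* (ii) and (iii) *)
  (Ck_boundary 0 Omega ->
   exists c_sc : R,
     [/\ exists v, W1oo Omega v /\
           solution Omega H (@state_constraint R n.+1) c_sc v,
         forall (w : 'rV[R]_n.+1 -> R) (a : R),
           {within closure Omega, continuous w} ->
           solution Omega H (@state_constraint R n.+1) a w -> a = c_sc,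
         c_sc%:E = ereal_inf [set a%:E | a in [set a : R |
           exists w, subsolution_in Omega H a w]] &
         forall g : 'rV[R]_n.+1 -> R, {within bdry Omega, continuous g} ->
           forall a : R,
             (exists v, W1oo Omega v /\ solution Omega H (dirichlet g) a v)
             <-> c_sc <= a]).

Proof.
have [oO connO O0 _] := domainO.
have cO : compact (closure Omega) := bounded_domain_compact domainO.
have clO0 : closure Omega !=set0 by case: O0 => x Ox; exists x; exact: subset_closure.
have b0 := bdry_nonempty domainO.
split=> [C1O gamma g /within_contP gammac /within_contP gc nrm|C0O].
  have cone := C1_inner_cone C1O nrm.
  have dO := cone_inner_dir oO cone.
  have [a0 [w0 [w0c w0s]]] := neumann_subsolution_exists oO cO O0 contH b0 gammac gc cone.
  have [c [v [L [L0 vc vL [vsub vsuper]]]]] := ergodic_solution oO cO O0 connO dO contH coerH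
    (neumann_pair_cont oO gammac gc) (@neumann_mono _ _ _ oO _ g cone) w0c w0s.
  have cmp := @comparison_neumann _ _ _ _ oO cO clO0 contH coerH _ _ gammac gc cone.
  exists c; split.
  - by exists v; split; [exact: segLip_W1oo vL|split].
  - move=> w a _ [wsub wsuper]; apply/eqP; rewrite eq_le.
    by rewrite (cmp _ _ _ _ vsub wsuper) (cmp _ _ _ _ wsub vsuper).
  - apply: ereal_inf_attained; first by exists v.
    by move=> a [w ws]; exact: cmp ws vsuper.
have dO := C0_inner_dir oO C0O.
(* [C] bounds [H x 0]. Test gradients of the constant 0 vanish inside Omega, so it is a subsolution
   at level [C] and starts the construction for (E-SC). *)
have [C hC] := H_max cO clO0 contH (lexx 0).
have w0c : cont_on (closure Omega) (cst 0 : 'rV[R]_n.+1 -> R).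
  by move=> x _ e e0; exists 1 => // y _ _; rewrite subrr normr0.
have w0s : subsolution Omega H (@state_constraint R n.+1) C (cst 0).
  apply: state_constraint_sub => //; split; first exact: cont_usc.
  move=> phi x Cphi Ox mx; apply: hC; first exact: subset_closure.
  have [|||C0 g0] := @C1_closedI R n.+1 setT (closure Omega) (cst 0) (fun=> 0) openT.
  - by [].
  - by move=> y _ e e0; exists 1 => // z _; rewrite subrr sub0r dotp0l oppr0 normr0 mulr_ge0// ltW.
  - by move=> y _ e e0; exists 1 => // z _ _; rewrite subrr normr0.
  have nx : nbhs x (closure Omega).
    by apply: (filterS (@subset_closure _ Omega)); exact: open_nbhs_nbhs.
  by rewrite -(test_grad_eq C0 Cphi nx mx) g0 ?normr0.
have scc : pair_cont (bdry Omega) (fun _ _ : 'rV[R]_n.+1 => -1 : R).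
  by move=> x p _ e e0; exists 1 => // y q _ _ _; rewrite subrr normr0.
have [c [v [L [L0 vc vL [vsub vsuper]]]]] := ergodic_solution oO cO O0 connO dO contH coerH
  scc (fun _ _ _ _ _ _ _ => lexx _) w0c w0s.
have cmp u w a a' : subsolution_in Omega H a' u ->
    supersolution Omega H (@state_constraint R n.+1) a w -> a <= a'.
  exact: (comparison_state_constraint oO cO clO0 contH coerH dO).
exists c; split.
- by exists v; split; [exact: segLip_W1oo vL|split].
- move=> w a _ [wsub wsuper]; apply/eqP; rewrite eq_le.
  by rewrite (cmp _ _ _ _ (subsolutionW vsub) wsuper) (cmp _ _ _ _ (subsolutionW wsub) vsuper).
- apply: ereal_inf_attained; first by exists v; exact: subsolutionW vsub.
  by move=> a [w ws]; exact: cmp ws vsuper.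
- move=> g /within_contP gc a; split=> [[w [_ [wsub _]]]|ca].
    exact: cmp (subsolutionW wsub) vsuper.
  (* For [a >= c] the (E-SC) solution [v] is itself a subsolution at level [a]. *)
  have [w [L' [L'0 wc wL ws]]] := dirichlet_solution oO cO connO dO contH coerH b0 gc vc
    (subsolution_in_le ca (subsolutionW vsub)).
  by exists w; split=> //; exact: segLip_W1oo wL.
Qed.
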